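(* Let $n\ge 2$, $D=2\cos\frac{\pi}{n+1}+1$ and $k\ge 1$. Let $M$ be the $\mathrm{II}_1$ factor generated by $\{e_i,l_i,r_i\mid i\ge 1\}$ and let $M_{-k}\subseteq M$ be the subfactor generated by $\{e_i,l_i,r_i\mid i\ge k\}$. Then $$M_{-k}'\cap M=A_{k-1}=\pi(M_{k-1}(D)).$$
   Context: A Motzkin $n$-diagram is a noncrossing partial matching (up to isotopy) of $n$ top points and $n$ bottom points of a rectangle by strings inside the rectangle: each point is joined to at most one other point. $M_n(D)$ is the $\mathbb{C}$-vector space with basis the Motzkin $n$-diagrams and product $xy=D^{\kappa(x,y)}z$, where $x$ is stacked above $y$, the bottom points of $x$ are identified with the top points of $y$, $z$ is the resulting diagram on the outer points, and $\kappa(x,y)$ is the number of closed loops formed (non-closed strings not reaching the outer points are discarded with factor $1$). $M_0(D)=\mathbb{C}$. $M_n(D)\subset M_{n+1}(D)$ by adding a vertical string on the right. The conjugate-linear map $*$ reflects diagrams top to bottom. The trace is $\mathrm{tr}(x)=D^{c(x)-n}$ for an $n$-diagram $x$, where $c(x)$ is the number of closed loops obtained by joining the $i$-th top point to the $i$-th bottom point outside, for all $i$; for the given $D$ it is positive semidefinite. Generators: $l_i$ is the diagram in which top point $i$ is joined to bottom point $i+1$, top point $i+1$ and bottom point $i$ are isolated, and all other strings are vertical; $r_i=l_i^*$; $e_i$ is $D^{-1}$ times the diagram in which top points $i,i+1$ are joined, bottom points $i,i+1$ are joined, and all other strings are vertical. $\pi$ is the GNS representation of $\bigcup_k M_k(D)$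 with respect to $\mathrm{tr}$, $A_k=\pi(M_k(D))$, $A_0=\mathbb{C}$, and $M=\left(\bigcup_k A_k\right)''$, a $\mathrm{II}_1$ factor. In $M$ the symbols $e_i,l_i,r_i$ denote the images under $\pi$, and ''generated'' means generated as a von Neumann algebra. *)

(* Defs.v *)
From HB Require Import structures.
From mathcomp Require Import all_boot all_order all_algebra.
From mathcomp Require Import sesquilinear.
From mathcomp Require Import all_classical all_reals all_analysis.
From mathcomp Require Import complex.

Set Implicit Arguments.
Unset Strict Implicit.
Unset Printing Implicit Defensive.

Import Order.TTheory GRing.Theory Num.Theory.

Local Open Scope classical_set_scope.
Local Open Scope ring_scope.
Local Open Scope complex_scope.

(** * Partial matchings *)

(* [inl i] is the i-th top point and [inr i] the i-th bottom point of the
   rectangle, both counted from the left, starting at 0. *)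
Definition pts (k : nat) : finType := ('I_k + 'I_k)%type.

(* A partial matching of [V] is an involution of [V]: matched points are
   exchanged, isolated points are fixed. *)

(* Clockwise rank on the boundary of the rectangle. *)
Definition bdry k (p : pts k) : nat :=
  match p with
  | inl i => i
  | inr i => k + (k - i.+1)
  end%N.

Definition noncrossing k (f : {ffun pts k -> pts k}) : bool :=
  [forall p : pts k, forall q : pts k,
    ~~ [&& bdry p < bdry q, bdry q < bdry (f p) & bdry (f p) < bdry (f q)]%N].

Definition is_motzkin k (f : {ffun pts k -> pts k}) : bool :=
  [forall p : pts k, f (f p) == p] && noncrossing f.

Definition motzkin (k : nat) := {f : {ffun pts k -> pts k} | is_motzkin f}.

Definition joined (V : finType) (f g : V -> V) : rel V :=
  [rel v w | (f v == w) || (g v == w)].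

(* The superposition of the partial matchings [f] and [g] is a disjoint union
   of paths and cycles; the cycles are the components all of whose points are
   matched by both [f] and [g]. *)
Definition on_loop (V : finType) (f g : V -> V) : pred V :=
  [pred v | [forall w, connect (joined f g) v w ==> (f w != w) && (g w != w)]].

Definition nloops (V : finType) (f g : V -> V) : nat :=
  n_comp (joined f g) (on_loop f g).

(* Stacking [x] above [y]: [inl (inl i)], [inl (inr i)] and [inr i] are the
   top, middle and bottom points. *)
Definition stk (k : nat) : finType := (pts k + 'I_k)%type.

Definition stk_up k (x : pts k -> pts k) (v : stk k) : stk k :=
  match v with
  | inl p => inl (x p)
  | inr i => inr i
  end.

Definition stk_of_down k (p : pts k) : stk k :=
  match p with
  | inl i => inl (inr i)
  | inr i => inr i
  end.

Definition stk_down k (y : pts k -> pts k) (v : stk k) : stk k :=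
  match v with
  | inl (inl i) => inl (inl i)
  | inl (inr i) => stk_of_down (y (inl i))
  | inr i => stk_of_down (y (inr i))
  end.

Definition stk_of_outer k (p : pts k) : stk k :=
  match p with
  | inl i => inl (inl i)
  | inr i => inr i
  end.

Definition compose k (x y : pts k -> pts k) : {ffun pts k -> pts k} :=
  [ffun p => odflt p
    [pick q | (q != p) && connect (joined (stk_up x) (stk_down y))
                                  (stk_of_outer p) (stk_of_outer q)]].

Definition kappa k (x y : pts k -> pts k) : nat :=
  nloops (stk_up x) (stk_down y).

Definition flip k (p : pts k) : pts k :=
  match p with
  | inl i => inr i
  | inr i => inl i
  end.

Definition reflect_diag k (x : pts k -> pts k) : {ffun pts k -> pts k} :=
  [ffun p => flip (x (flip p))].

(* The number of closed loops once the i-th top point is joined to the i-th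
   bottom point outside, for every i. *)
Definition cl_loops k (x : pts k -> pts k) : nat := nloops x (@flip k).

Definition widen_pt k (p : pts k) : pts k.+1 :=
  match p with
  | inl i => inl (widen_ord (leqnSn k) i)
  | inr i => inr (widen_ord (leqnSn k) i)
  end.

Definition add_strand k (x : pts k -> pts k) : {ffun pts k.+1 -> pts k.+1} :=
  [ffun p => match p with
    | inl i => if unlift ord_max i is Some j then widen_pt (x (inl j))
               else inr ord_max
    | inr i => if unlift ord_max i is Some j then widen_pt (x (inr j))
               else inl ord_max
    end].

Definition l_diag k (a b : 'I_k) : {ffun pts k -> pts k} :=
  [ffun p => match p with
    | inl i => if i == a then inr b else if i == b then inl i else inr i
    | inr i => if i == b then inl a else if i == a then inr i else inl i
    end].

Definition e_diag k (a b : 'I_k) : {ffun pts k -> pts k} :=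
  [ffun p => match p with
    | inl i => if i == a then inl b else if i == b then inl a else inr i
    | inr i => if i == a then inr b else if i == b then inr a else inl i
    end].

(** * The Motzkin algebras M_k(D) *)

(* The copy [R[i]^o] of [R[i]] selects complex, not real, scalars. *)
Definition malg (R : realType) (k : nat) := {ffun motzkin k -> R[i]^o}.

(* The basis vector of the Motzkin diagram [f].  The diagrams it is used for
   below are all noncrossing, because stacking, reflecting and adding a strand
   preserve planarity. *)
Definition mbasis (R : realType) k (f : {ffun pts k -> pts k}) : malg R k :=
  [ffun d : motzkin k => (val d == f)%:R : R[i]^o].

Definition mmul (R : realType) (D : R) k (x y : malg R k) : malg R k :=
  \sum_(d : motzkin k) \sum_(d' : motzkin k)
    (x d * y d' * (D ^+ kappa (val d) (val d'))%:C)
      *: mbasis R (compose (val d) (val d')).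

Definition mstar (R : realType) k (x : malg R k) : malg R k :=
  \sum_(d : motzkin k) (x d : R[i])^* *: mbasis R (reflect_diag (val d)).

Definition mincl (R : realType) k (x : malg R k) : malg R k.+1 :=
  \sum_(d : motzkin k) x d *: mbasis R (add_strand (val d)).

Definition mtr (R : realType) (D : R) k (x : malg R k) : R[i] :=
  \sum_(d : motzkin k) x d * (D ^+ cl_loops (val d) / D ^+ k)%:C.

(* For i >= 1, l_i, r_i and e_i as elements of M_(i+1)(D), the first of the
   algebras containing them.  The i-th and (i+1)-th points have the indices
   i-1 and i, the latter being the last one. *)
Definition mot_l (R : realType) (i : nat) : malg R i.+1 :=
  mbasis R (l_diag (inord i.-1) ord_max).

Definition mot_r (R : realType) (i : nat) : malg R i.+1 := mstar (mot_l R i).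

Definition mot_e (R : realType) (D : R) (i : nat) : malg R i.+1 :=
  (D^-1)%:C *: mbasis R (e_diag (inord i.-1) ord_max).

(** * Operators on a Hilbert space *)

Definition bounded_op (R : realType) (H : normedModType R[i])
  (f : H -> H) : Prop := linear f /\ continuous f.

Definition commutant (R : realType) (H : normedModType R[i])
    (S : set (H -> H)) : set (H -> H) :=
  [set f | bounded_op f /\ forall g, S g -> f \o g = g \o f].

Definition adjoints (R : realType) (H : normedModType R[i])
    (dot : H -> H -> R[i]) (S : set (H -> H)) : set (H -> H) :=
  [set g | bounded_op g /\
     exists2 f, S f & forall u v, dot (f u) v = dot u (g v)].

Definition vN_gen (R : realType) (H : normedModType R[i])
    (dot : H -> H -> R[i]) (S : set (H -> H)) : set (H -> H) :=
  commutant (commutant (S `|` adjoints dot S)).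

(** * The GNS representation of the union of the M_k(D) *)

(* [H] is the completion of the union of the M_k(D) for <x, y> = tr(y^* x),
   [Lam] being the canonical map, and [rho] is left multiplication.  Maps out
   of the union are families indexed by k compatible with the inclusions. *)
Record is_GNS (R : realType) (D : R) (H : completeNormedModType R[i])
    (dot : H -> H -> R[i]) (Lam : forall k, malg R k -> H)
    (rho : forall k, malg R k -> H -> H) : Prop := IsGNS {
  GNS_lam_linear : forall k, linear (Lam k) ;
  GNS_lam_incl : forall k (x : malg R k), Lam k.+1 (mincl x) = Lam k x ;
  GNS_lam_dot : forall k (x y : malg R k),
    dot (Lam k x) (Lam k y) = mtr D (mmul D (mstar y) x) ;
  GNS_lam_dense : closure (\bigcup_k range (Lam k)) = [set: H] ;
  GNS_rho_bounded : forall k (x : malg R k), bounded_op (rho k x) ;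
  GNS_rho_incl : forall k (x : malg R k), rho k.+1 (mincl x) = rho k x ;
  GNS_rho_lam : forall k (x y : malg R k),
    rho k x (Lam k y) = Lam k (mmul D x y)
}.

(* The images of e_i, l_i, r_i for i >= k (used for k >= 1 only). *)
Definition gens (R : realType) (D : R) (H : normedModType R[i])
    (rho : forall k, malg R k -> H -> H) (k : nat) : set (H -> H) :=
  [set T | exists2 i, (k <= i)%N &
     [\/ T = rho i.+1 (mot_e D i), T = rho i.+1 (mot_l R i)
       | T = rho i.+1 (mot_r R i)]].

(* Main.v *)
(* With 0-based strands and K = k - 1, let T in M commute with the generators on
   the strands from K on, and let xi = T Omega.  The orthogonal projections a_i
   of xi onto the algebras on K + j + i strands commute with the generators on
   the strands K, ..., K + j + i - 1 (modulo null vectors), and for large j they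
   are close to xi.  Such commuting vectors are controlled by the Jones-Wenzl
   projections f_t on the strands from K on: their squared norm is a weighted sum
   over t < n of their sizes on projections p_t with t through strings, the sum
   being cut at n because tr (f_n) = 0, i.e. sin ((n+1) theta) = 0 for
   theta = pi / (n+1).  Compressing a_n by projections onto isolated points gives
   b in A_K agreeing with a_n at t = 0, and the size at t of a_i - b is bounded by
   that of a_(i+1) - b at t - 1 and that of a_i - a_(i+1), because p_t is
   equivalent, up to an expectation, to p_(t-1) with one more strand.  So a_0 - b
   is small after n steps, xi lies in the finite-dimensional space A_K Omega, and
   T is in A_K since Omega is separating: right multiplications are bounded as tr
   is a trace. *)
From HB Require Import structures.
Require Import Defs.
From mathcomp Require Import all_boot zify.
From mathcomp Require boolp.

Set Implicit Arguments.
Unset Strict Implicit.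
Unset Printing Implicit Defensive.

(** * Stacking diagrams *)

(** Two obstacles shape the estimates. The trace is only semidefinite, so the Jones-Wenzl element at
    height [n] and the commutators of the projected vectors are null vectors rather than zero;
    nothing is divided out, and commutation and vanishing are expressed by traces against arbitrary
    elements. Moreover, the number [j] of strands needed to approximate the vector grows without
    control, so no constant may depend on [j]. The path counts [wt] do grow with [j]; therefore only
    products of a path count with a size are estimated, and these pass on because a path ending at
    one height extends by one step to the height below. The resulting constant depends on [n] and
    [D] alone. Exactly [n] steps are taken because the compression controls height 0 only, each step
    gains one height, and all heights are below [n]. Each step costs one more strand, on which the
    next vector still commutes with the generators; this is the room into which the leg of a cup is
    moved. *)

Section TwoInvolutions.
Variables (V : finType) (f g : V -> V).
Hypotheses (fK : involutive f) (gK : involutive g).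

Lemma connect_joined_sym : connect_sym (joined f g).
Proof.
apply: sym_connect_sym => v w /=; congr (_ || _).
- by rewrite -(inj_eq (can_inj fK)) fK eq_sym.
- by rewrite -(inj_eq (can_inj gK)) gK eq_sym.
Qed.

Lemma connect_joined_ind (P : pred V) v w :
  (forall u, P u -> P (f u) && P (g u)) -> P v -> connect (joined f g) v w -> P w.
Proof.
move=> clP Pv /connectP[p pth ->]; elim: p v Pv pth => [|u p IHp] v Pv //=.
case/andP=> vu pth; apply: (IHp u) => //.
by have /andP[Pf Pg] := clP v Pv; case/orP: vu => /eqP <-.
Qed.

Lemma joined_f v : connect (joined f g) v (f v).
Proof. by apply: connect1; rewrite /joined /= eqxx. Qed.

Lemma joined_g v : connect (joined f g) v (g v).
Proof. by apply: connect1; rewrite /joined /= eqxx orbT. Qed.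

Local Notation h := (g \o f).

Lemma gf_inj : injective h.
Proof. by apply: inj_comp; apply: can_inj; [apply: gK | apply: fK]. Qed.

Lemma iter_gf_inj n : injective (iter n h).
Proof. by elim: n => //= n IHn; apply: inj_comp IHn; apply: gf_inj. Qed.

Lemma iter_gf_eq v n : (iter n h v == v) = (order h v %| n).
Proof.
have itM k : iter (k * order h v) h v = v.
  by elim: k => // k IHk; rewrite mulSn iterD IHk iter_order //; apply: gf_inj.
rewrite {1}(divn_eq n (order h v)) addnC iterD itM.
apply/eqP/idP => [Hv|]; last by rewrite /dvdn => /eqP ->.
have := @findex_iter _ h v (n %% order h v).
rewrite ltn_mod order_gt0 => /(_ isT); rewrite Hv findex0 => H0.
by rewrite /dvdn -H0.
Qed.

(** As [f] conjugates [h] to its inverse and fixes [v], it sends the [i]-th iterate of [v] to the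
    one of index [-i]; applying [h] another [i] times avoids the inverse. *)
Lemma iter_gfK v i : f v = v -> iter i h (f (iter i h v)) = v.
Proof.
move=> fv; elim: i => // i IHi.
rewrite iterSr [iter i.+1 h v]iterS /= fK; set w := iter i h v in IHi *.
by rewrite gK.
Qed.

(** The orbit of [v] under [h] is stable under [f], which reverses it, and hence under [g], which is
    [h] after [f]. *)
Lemma joined_orbit v w : f v = v -> connect (joined f g) v w ->
  exists i, w = iter i h v.
Proof.
move=> fv vw; suff: fconnect h v w by move/iter_findex=> <-; eexists.
have gE u : g u = h (f u) by rewrite /= fK.
have clf u : fconnect h v u -> fconnect h v (f u).
  move/iter_findex => uE.
  rewrite fconnect_sym; last exact: gf_inj.
  rewrite -[X in fconnect _ _ X](iter_gfK (findex h v u) fv) uE; exact: fconnect_iter.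
apply: (connect_joined_ind _ _ vw) => [u vu|]; last exact: connect0.
rewrite clf //= gE; apply: (connect_trans (clf u vu)); exact: fconnect1.
Qed.

Lemma iter_fixf v i : f v = v -> (f (iter i h v) == iter i h v) = (order h v %| i + i).
Proof.
move=> fv; rewrite -(inj_eq (@iter_gf_inj i)) iter_gfK // eq_sym.
by rewrite -iterD iter_gf_eq.
Qed.

Lemma iter_fixg v i : f v = v ->
  (g (iter i.+1 h v) == iter i.+1 h v) = (order h v %| i + i.+1).
Proof.
move=> fv; rewrite iterS /= gK eq_sym -[g _]/(iter 1 h (iter i h v)) -iterD.
rewrite -(inj_eq (@iter_gf_inj i)) iter_gfK // -iterD.
by rewrite iter_gf_eq add1n.
Qed.

(** The flag records which of the two matchings ends at [v]: a point fixed by both is a path with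
    two ends. *)
Definition is_end (b : bool) v := if b then f v == v else g v == v.

Lemma dvdn_lt2 N m : N %| m -> 0 < m < N + N -> m = N.
Proof.
case/dvdnP=> [[|[|k]]] ->; lia.
Qed.

(** The component of [v] is its orbit under [h], of length [N]. The iterate [j] is fixed by [f] iff
    [N] divides 2j, and the iterate [j + 1] by [g] iff [N] divides 2j + 1, so the parity of [N]
    decides which matching provides the other end. *)
Lemma two_ends_f v : f v = v -> exists b' w,
  [/\ is_end b' w, connect (joined f g) v w, (b', w) != (true, v)
    & forall b u, is_end b u -> connect (joined f g) v u ->
        (b, u) = (true, v) \/ (b, u) = (b', w)].
Proof.
move=> fv; set N := order h v.
have N0 : 0 < N by apply: order_gt0.
have itc i : connect (joined f g) v (iter i h v).
  elim: i => //= i IHi; apply: connect_trans IHi _.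
  exact: connect_trans (joined_f _) (joined_g _).
have fend u : f u = u -> connect (joined f g) v u ->
    u = v \/ exists2 j, u = iter j h v & j + j = N.
  move=> fu /(joined_orbit fv)[j0 uE].
  have vu : fconnect h v u by rewrite uE fconnect_iter.
  have := iter_findex vu; have := findex_max vu.
  case: (findex h v u) => [_ <-|j ltj ujE]; [by left | right; exists j.+1 => //].
  have := iter_fixf j.+1 fv; rewrite ujE fu eqxx => /esym/dvdn_lt2; apply.
  lia.
have gend u : g u = u -> connect (joined f g) v u ->
    exists2 j, u = iter j.+1 h v & j + j.+1 = N.
  move=> gu /(joined_orbit fv)[j0 uE].
  have vu : fconnect h v u by rewrite uE fconnect_iter.
  have [j ltj ujE] : exists2 j, j < N & iter j.+1 h v = u.
    have := iter_findex vu; have := findex_max vu.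
    case: (findex h v u) => [_ /= <-|j ltj ujE].
      exists N.-1; first by lia.
      by have := iter_order gf_inj v; rewrite -/N -{1}(prednK N0).
    by exists j => //; apply: ltnW.
  exists j => //; have := iter_fixg j fv; rewrite ujE gu eqxx => /esym/dvdn_lt2.
  apply; lia.
have [oddN|evenN] := boolP (odd N).
  have NE : N./2 + N./2.+1 = N by lia.
  exists false, (iter N./2.+1 h v); split=> //.
  - by rewrite /is_end iter_fixg // NE.
  - move=> [] u /eqP uu vu.
      by have [->|[j _ jN]] := fend u uu vu; [left | lia].
    have [j -> jN] := gend u uu vu; right.
    by have -> : j = N./2 by lia.
have NE : N./2 + N./2 = N by lia.
exists true, (iter N./2 h v); split=> //.
- by rewrite /is_end iter_fixf // NE.
- apply/eqP => -[/eqP]; rewrite iter_gf_eq -/N gtnNdvd //; lia.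
- move=> [] u /eqP uu vu.
    have [->|[j -> jN]] := fend u uu vu; [by left | right].
    by have -> : j = N./2 by lia.
  have [j _ jN] := gend u uu vu; lia.
Qed.

End TwoInvolutions.

Lemma joinedC (V : finType) (f g : V -> V) : joined f g =2 joined g f.
Proof. by move=> v w; rewrite /joined /= orbC. Qed.

Lemma two_ends (V : finType) (f g : V -> V) b v :
  involutive f -> involutive g -> is_end f g b v -> exists b' w,
  [/\ is_end f g b' w, connect (joined f g) v w, (b', w) != (b, v)
    & forall c u, is_end f g c u -> connect (joined f g) v u ->
        (c, u) = (b, v) \/ (c, u) = (b', w)].
Proof.
move=> fK gK; case: b => /eqP end_v; first exact: two_ends_f.
have [b' [w [end_w vw neq uniqw]]] := two_ends_f gK fK end_v.
have endC c u : is_end f g c u = is_end g f (~~ c) u by case: c.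
have conC := eq_connect (joinedC f g).
exists (~~ b'), w; split=> //.
- by rewrite endC negbK.
- by rewrite conC.
- by apply: contra neq => /eqP[+ ->]; case: (b').
- move=> c u; rewrite endC conC => end_u /(uniqw _ _ end_u).
  case=> -[cE ->]; [left | right]; last by rewrite -cE negbK.
  by case: c cE {end_u}.
Qed.

(** A colouring of this kind is constant on components and false on every component with an end, so
    it amounts to a set of loops, represented by their roots. *)
Lemma nloopsE (V : finType) (f g : V -> V) : involutive f -> involutive g ->
  #|[pred a : {ffun V -> bool} | [forall v, [&& a (f v) == a v, a (g v) == a v
     & (f v == v) || (g v == v) ==> ~~ a v]]]| = 2 ^ nloops f g.
Proof.
move=> fK gK; set e := joined f g.
have symC : connect_sym e := connect_joined_sym fK gK.
pose L : {set V} := [set v | roots e v && on_loop f g v].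
have -> : nloops f g = #|L| by rewrite cardsE; apply: eq_card.
rewrite -card_powerset.
pose F (S : {set V}) : {ffun V -> bool} := [ffun v => root e v \in S].
have F_inj : {in powerset L &, injective F}.
  move=> S S'; rewrite !inE => /subsetP SL /subsetP SL' /ffunP SS'.
  apply/setP=> v; have := SS' v; rewrite !ffunE.
  have [/eqP -> //|nroot] := boolP (root e v == v).
  have notL : v \notin L by rewrite inE /roots /= (negPf nroot).
  by rewrite (contraNF (SL v) notL) (contraNF (SL' v) notL).
rewrite -(card_in_imset F_inj); apply: eq_card => a; rewrite inE.
apply/forallP/imsetP => [aP|[S /[!inE] /subsetP SL ->] v].
  have acl v w : connect e v w -> a w = a v.
    move=> vw; apply/eqP; apply: (@connect_joined_ind _ f g (fun u => a u == a v) v) vw => // u /eqP <-.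
    by have /and3P[/eqP -> /eqP -> _] := aP u; rewrite eqxx.
  exists [set v in L | a v]; first by rewrite inE; apply/subsetP=> v /[!inE] /andP[].
  apply/ffunP=> v; rewrite ffunE !inE /roots /= root_root // eqxx /=.
  rewrite (acl _ _ (connect_root e v)); case av: (a v); rewrite ?andbF // andbT.
  apply/esym/forallP=> w; apply/implyP => rw; have := aP w.
  have -> : a w = true.
    by rewrite (acl _ _ rw) (acl _ _ (connect_root e v)).
  by case/and3P=> _ _; rewrite implybF negb_or.
rewrite !ffunE.
have rE w : connect e v w -> root e w = root e v.
  by rewrite -(root_connect symC) => /eqP.
rewrite (rE _ (joined_f _ _ v)) (rE _ (joined_g _ _ v)) !eqxx /=.
apply/implyP => fix_v; apply/negP => /SL; rewrite inE => /andP[_ /forallP/(_ v)].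
by rewrite symC connect_root /= -negb_or fix_v.
Qed.

Definition cols k := {ffun 'I_k -> bool}.

Definition colr k (A B : cols k) (p : pts k) : bool :=
  match p with inl i => A i | inr i => B i end.

Definition good (V : finType) (f : V -> V) (a : V -> bool) : bool :=
  [forall v, (a (f v) == a v) && ((f v == v) ==> ~~ a v)].

(* The matrix of the diagram [x] in the representation by two-coloured strings:
   joined points have the same colour and isolated points have the colour
   [false].  A closed loop can be coloured in two ways, so stacking diagrams
   multiplies these matrices up to the factor 2 ^ kappa; as they determine
   diagram and exponent, all identities between diagrams, including the
   numbers of loops, can be read off from them. *)
Definition tens k (x : pts k -> pts k) (A B : cols k) : bool :=
  good x (colr A B).

Section Stack.
Variables (k : nat) (x y : pts k -> pts k).
Hypotheses (xK : involutive x) (yK : involutive y).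

Lemma stk_upK : involutive (stk_up x).
Proof. by case=> [p|i] //=; rewrite xK. Qed.

Lemma stk_downK : involutive (stk_down y).
Proof.
have dK p : stk_down y (stk_of_down p) = stk_of_down (y p) by case: p.
by case=> [[i|i]|i] //=; rewrite dK yK.
Qed.

Lemma stk_down_of_down p : stk_down y (stk_of_down p) = stk_of_down (y p).
Proof. by case: p. Qed.

Lemma stk_of_down_inj : injective (@stk_of_down k).
Proof. by case=> i [] j //= []->. Qed.

Lemma stk_of_outer_inj : injective (@stk_of_outer k).
Proof. by case=> i [] j //= []->. Qed.

Let f := stk_up x.
Let g := stk_down y.
Let c := connect (joined f g).

Definition outer_side (p : pts k) : bool := if p is inr _ then true else false.

Lemma outer_end p : is_end f g (outer_side p) (stk_of_outer p).
Proof. by case: p => i /=. Qed.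

Lemma outer_end_inj p q :
  (outer_side p, stk_of_outer p) = (outer_side q, stk_of_outer q) -> p = q.
Proof. by case=> _ /stk_of_outer_inj. Qed.

(** Outer points also end a path of the superposition, because [stk_up] fixes the bottom points and
    [stk_down] the top ones; the ends singled out here are the isolated points of the two
    diagrams. *)
Definition isolated_end (v : stk k) : Prop :=
  (exists2 p, v = inl p & x p = p) \/ (exists2 p, v = stk_of_down p & y p = p).

Lemma end_cases b v : is_end f g b v ->
  (exists p, (b, v) = (outer_side p, stk_of_outer p)) \/ isolated_end v.
Proof.
case: b => /=.
  case: v => [p /eqP[xp]|i _]; last by left; exists (inr i).
  by right; left; exists p.
case: v => [[i _|i]|i] //=; first by left; exists (inl i).
  move=> /eqP; rewrite -[RHS]/(stk_of_down (inl i)) => /stk_of_down_inj yi.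
  by right; right; exists (inl i).
move=> /eqP; rewrite -[RHS]/(stk_of_down (inr i)) => /stk_of_down_inj yi.
by right; right; exists (inr i).
Qed.

Lemma isolated_is_end v : isolated_end v ->
  exists2 b, is_end f g b v & forall p, (b, v) <> (outer_side p, stk_of_outer p).
Proof.
case=> -[p -> yp].
  exists true => [|[i|i]] //; by rewrite /= yp.
exists false; first by rewrite /= /g stk_down_of_down yp.
by case: p yp => i _ [j|j].
Qed.

(** By [two_ends] the path from [p] has exactly one further end: an outer point, which is then the
    partner of [p], or an isolated point, where the string is discarded. *)
Lemma composeP p :
  (exists q, [/\ q != p, compose x y p = q, c (stk_of_outer p) (stk_of_outer q),
     (forall r, c (stk_of_outer p) (stk_of_outer r) -> r = p \/ r = q)
     & forall v, isolated_end v -> ~~ c (stk_of_outer p) v])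
  \/ [/\ compose x y p = p,
     (forall r, c (stk_of_outer p) (stk_of_outer r) -> r = p)
     & exists2 v, isolated_end v & c (stk_of_outer p) v].
Proof.
have [b' [w [end_w cw neq uniqw]]] :=
  two_ends stk_upK stk_downK (outer_end p).
have [[q [b'E wE]]|iso_w] := end_cases end_w.
  have qp : q != p by apply: contra neq => /eqP <-; rewrite b'E wE.
  have uniqr r : c (stk_of_outer p) (stk_of_outer r) -> r = p \/ r = q.
    move=> /(uniqw _ _ (outer_end r))[/outer_end_inj ->|]; first by left.
    by rewrite b'E wE => /outer_end_inj ->; right.
  left; exists q; split=> //; last 1 first.
  - move=> v /isolated_is_end[b end_v nout]; apply/negP=> /(uniqw _ _ end_v).
    by case=> [/nout //|]; rewrite b'E wE => /nout.
  - rewrite /compose ffunE; case: pickP => [r /andP[rp /uniqr[rE|->]] //|/(_ q)].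
      by rewrite rE eqxx in rp.
    by rewrite qp /= => /negP[]; rewrite -wE; exact: cw.
  - by rewrite -wE.
right; have uniqr r : c (stk_of_outer p) (stk_of_outer r) -> r = p.
  move=> cr; have [/outer_end_inj //|[b'E wE]] := uniqw _ _ (outer_end r) cr.
  have [b end_w' nout] := isolated_is_end iso_w.
  have [E|E] := uniqw _ _ end_w' cw; first by case: (nout p).
  by case: (nout r); rewrite E b'E wE.
split=> //; last by exists w.
rewrite /compose ffunE; case: pickP => [r /andP[rp /uniqr rE]|//].
by rewrite rE eqxx in rp.
Qed.

Let csym : connect_sym (joined f g) := connect_joined_sym stk_upK stk_downK.

Lemma compose_inv : involutive (compose x y).
Proof.
move=> p; have [[q [qp -> cpq uniqp _]]|[E _ _]] := composeP p; last by rewrite !E.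
have cqp : c (stk_of_outer q) (stk_of_outer p) by rewrite /c csym.
have [[r [rq -> cqr uniqq _]]|[-> uniqq _]] := composeP q; last first.
  by rewrite (uniqq _ cqp).
by have [/eqP|] := uniqq _ cqp; rewrite 1?eq_sym ?(negPf qp).
Qed.

Lemma eq_compose p q : p != q -> c (stk_of_outer p) (stk_of_outer q) ->
  compose x y p = q.
Proof.
move=> pq cpq; have [[r [rp -> _ uniqp _]]|[-> uniqp _]] := composeP p.
  by have [E|->] := uniqp _ cpq; rewrite // E eqxx in pq.
by rewrite (uniqp _ cpq).
Qed.

Definition col3 (A B C : cols k) (v : stk k) : bool :=
  match v with inl p => colr A B p | inr i => C i end.

Definition stk_good (a : stk k -> bool) : Prop :=
  [/\ forall v, a (f v) = a v, forall v, a (g v) = a v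
    & forall v, isolated_end v -> ~~ a v].

Lemma stk_goodP A B C :
  reflect (stk_good (col3 A B C)) (tens x A B && tens y B C).
Proof.
have dE p : col3 A B C (stk_of_down p) = colr B C p by case: p.
apply: (iffP andP) => [[/forallP tx /forallP ty]|[cf cg iso]].
  split=> [[p|i]|v|v] //=.
  - by have /andP[/eqP] := tx p.
  - case: v => [[i|i]|i] //=.
    + by rewrite dE; have /andP[/eqP] := ty (inl i).
    + by rewrite dE; have /andP[/eqP] := ty (inr i).
  - case=> -[p -> fix_p].
      by have /andP[_] := tx p; rewrite fix_p eqxx.
    by rewrite dE; have /andP[_] := ty p; rewrite fix_p eqxx.
split; apply/forallP=> p; apply/andP; split.
- by have /= -> := cf (inl p).
- by apply/implyP=> /eqP xp; apply: (iso (inl p)); left; exists p.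
- by have := cg (stk_of_down p); rewrite /g stk_down_of_down !dE => ->.
- by apply/implyP=> /eqP yp; rewrite -dE; apply: iso; right; exists p.
Qed.

Lemma stk_good_const a v w : stk_good a -> c v w -> a w = a v.
Proof.
case=> cf cg _ vw; apply/eqP.
apply: (@connect_joined_ind _ f g (fun u => a u == a v) v) vw => // u /eqP <-.
by rewrite cf cg eqxx.
Qed.

Lemma col3_outer A B C p : col3 A B C (stk_of_outer p) = colr A C p.
Proof. by case: p. Qed.

Lemma stk_good_compose A B C : stk_good (col3 A B C) -> tens (compose x y) A C.
Proof.
move=> gd; apply/forallP=> p; rewrite -!(col3_outer A B C).
have [[q [qp -> cpq _ _]]|[-> _ [v iso cv]]] := composeP p.
  by rewrite (stk_good_const gd cpq) eqxx (negPf qp).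
rewrite !eqxx /= -(stk_good_const gd cv).
by case: gd => _ _ /(_ v iso).
Qed.

Lemma compose_stk_good A C : tens (compose x y) A C ->
  exists B, stk_good (col3 A B C).
Proof.
move/forallP=> gd.
(* Colours spread from the outer points along their strings; components that reach no outer point,
   loops in particular, get [false]. *)
pose a v := [exists p, c (stk_of_outer p) v && colr A C p].
have aE p : a (stk_of_outer p) = colr A C p.
  apply/existsP/idP => [[q /andP[cqp Cq]]|Cp]; last first.
    by exists p; rewrite /c connect0.
  have [<- //|qp] := eqVneq q p.
  by have /andP[/eqP] := gd q; rewrite (eq_compose qp cqp) => ->.
have ac v w : c v w -> a w = a v.
  move=> cvw; apply/eq_existsb=> p; congr (_ && _); apply/idP/idP => h.
    by apply: connect_trans h _; rewrite csym.
  exact: connect_trans h cvw.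
exists [ffun i => a (inl (inr i))].
have colE v : col3 A [ffun i => a (inl (inr i))] C v = a v.
  by case: v => [[i|i]|i]; rewrite /= ?ffunE //; [exact: esym (aE (inl i)) | exact: esym (aE (inr i))].
split=> v; rewrite ?colE.
- by apply: ac; rewrite /c joined_f.
- by apply: ac; rewrite /c joined_g.
- move=> iso; apply/existsP=> -[p /andP[cpv Cp]].
  have [[q [_ _ _ _ /(_ v iso)]]|[E _ _]] := composeP p; first by rewrite cpv.
  by have /andP[_] := gd p; rewrite E eqxx Cp.
Qed.

End Stack.

Section TensCompose.
Variables (k : nat) (x y : pts k -> pts k).
Hypotheses (xK : involutive x) (yK : involutive y).

Local Notation gd := (stk_good x y).
Let f := stk_up x.
Let g := stk_down y.

Lemma stk_good_addb a b : gd a -> gd b -> gd (fun v => a v (+) b v).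
Proof.
move=> [af ag ai] [bf bg bi]; split=> v; rewrite ?af ?bf ?ag ?bg //.
by move=> iso; rewrite (negPf (ai v iso)) (negPf (bi v iso)).
Qed.

Lemma stk_good_ext a b : a =1 b -> gd a -> gd b.
Proof.
by move=> ab [af ag ai]; split=> v; rewrite -!ab ?af ?ag //; apply: ai.
Qed.

Definition col0 : cols k := [ffun => false].

Lemma card_tens0 :
  #|[pred B | tens x col0 B && tens y B col0]| = 2 ^ kappa x y.
Proof.
rewrite -(nloopsE (stk_upK xK) (stk_downK yK)).
pose F (B : cols k) : {ffun stk k -> bool} := [ffun v => col3 col0 B col0 v].
have F_inj : injective F.
  by move=> B B' /ffunP BB'; apply/ffunP=> i; have := BB' (inl (inr i)); rewrite !ffunE.
rewrite -(card_imset _ F_inj); apply: eq_card => a; rewrite [RHS]inE.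
apply/imsetP/forallP => [[B /stk_goodP[cf cg iso] ->] v|aP].
  rewrite !ffunE cf cg !eqxx /=; apply/implyP=> fix_v.
  have : exists b, is_end f g b v.
    by case/orP: fix_v; [exists true | exists false].
  case=> b /end_cases[[p [_ ->]]|/iso //].
  by case: p => i; rewrite /= !ffunE.
have aE v : F [ffun i => a (inl (inr i))] v = a v.
  rewrite !ffunE; case: v => [[i|i]|i]; rewrite /= !ffunE //.
    by have /and3P[_ _] := aP (inl (inl i)); rewrite /= eqxx orbT; case: (a _).
  by have /and3P[_ _] := aP (inr i); rewrite /= eqxx; case: (a _).
exists [ffun i => a (inl (inr i))]; last by apply/ffunP=> v; rewrite aE.
apply/stk_goodP.
have cE v : col3 col0 [ffun i => a (inl (inr i))] col0 v = a v.
  by rewrite -aE !ffunE.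
split=> v; rewrite ?cE.
- by have /and3P[/eqP] := aP v.
- by have /and3P[_ /eqP] := aP v.
- move=> /isolated_is_end[b end_v _]; have /and3P[_ _] := aP v.
  by case: b end_v => /= ->; rewrite ?orbT.
Qed.

(** If some middle colouring fits the given outer ones, exclusive or with it is a bijection onto the
    middle colourings for zero outer colours, which colour the closed loops freely. *)
Lemma tens_compose A C :
  \sum_(B : cols k) tens x A B * tens y B C =
  2 ^ kappa x y * tens (compose x y) A C.
Proof.
transitivity #|[pred B | tens x A B && tens y B C]|.
  rewrite -sum1_card [RHS]big_mkcond /=; apply: eq_bigr => B _.
  by rewrite inE mulnb; case: (_ && _).
have [/(compose_stk_good xK yK)[B0 gd0]|bad] := boolP (tens (compose x y) A C).
  rewrite muln1 -card_tens0.
  pose h (B : cols k) : cols k := [ffun i => B i (+) B0 i].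
  have hK : involutive h.
    by move=> B; apply/ffunP=> i; rewrite !ffunE -addbA addbb addbF.
  rewrite -(card_imset _ (can_inj hK)); apply: eq_card => B.
  rewrite [RHS]inE -[B in LHS]hK mem_imset; last exact: can_inj hK.
  rewrite inE; apply/stk_goodP/stk_goodP => gdB.
    apply: stk_good_ext (stk_good_addb gdB gd0) => -[[i|i]|i]; rewrite /= !ffunE ?addbb //.
    by rewrite -addbA addbb addbF.
  by apply: stk_good_ext (stk_good_addb gdB gd0) => -[[i|i]|i]; rewrite /= !ffunE.
rewrite muln0; apply: eq_card0 => B; rewrite inE; apply/negP=> /stk_goodP gdB.
by rewrite (stk_good_compose xK yK gdB) in bad.
Qed.

End TensCompose.

(** Tested on the colouring that is true exactly on the string from [p] to [x p]: in [y], the point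
    [p] must then be matched to a point of that string. *)
Lemma tens_sub k (x y : pts k -> pts k) : involutive x ->
  (forall A B, tens x A B -> tens y A B) -> forall p, x p != p -> y p = x p.
Proof.
move=> xK sub p xp.
pose a q := (q == p) || (q == x p).
have aE q : colr [ffun i => a (inl i)] [ffun i => a (inr i)] q = a q.
  by case: q => i /=; rewrite ffunE.
have /sub/forallP/(_ p) : tens x [ffun i => a (inl i)] [ffun i => a (inr i)].
  apply/forallP => q; rewrite !aE /a.
  rewrite (inj_eq (can_inj xK)) -[x q == p](inj_eq (can_inj xK)) xK orbC eqxx /=.
  apply/implyP=> xq; apply/negP=> /orP[] /eqP qE.
    by rewrite -qE xq in xp.
  by move: xq; rewrite qE xK eq_sym (negPf xp).
rewrite !aE /a eqxx /=; case/andP=> /eqP/orP[/eqP yp|/eqP //].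
by rewrite yp eqxx.
Qed.

Lemma tens_col0 k (x : pts k -> pts k) : tens x (col0 k) (col0 k).
Proof. by apply/forallP=> -[i|i]; rewrite /colr; case: (x _) => j; rewrite !ffunE implybT. Qed.

Lemma tens_inj k (x y : {ffun pts k -> pts k}) a b :
  involutive x -> involutive y ->
  (forall A B, 2 ^ a * tens x A B = 2 ^ b * tens y A B) -> x = y /\ a = b.
Proof.
move=> xK yK txy; have ab : a = b.
  by have := txy (col0 k) (col0 k); rewrite !tens_col0 !muln1 => /eqP; rewrite eqn_exp2l // => /eqP.
split=> //; apply/ffunP=> p; subst b.
have {}txy A B : tens x A B = tens y A B.
  by have /eqP := txy A B; rewrite eqn_pmul2l ?expn_gt0 //; do 2!case: tens.
have [xp|xp] := eqVneq (x p) p; last first.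
  by apply/esym/tens_sub => // A B; rewrite txy.
have [-> //|yp] := eqVneq (y p) p.
by apply: (tens_sub yK) => // A B; rewrite txy.
Qed.

Lemma flipK k : involutive (@flip k). Proof. by case. Qed.

Lemma tens_tr k (x : pts k -> pts k) : involutive x ->
  \sum_(A : cols k) tens x A A = 2 ^ cl_loops x.
Proof.
move=> xK; transitivity #|[pred A : cols k | tens x A A]|.
  rewrite -sum1_card [RHS]big_mkcond /=; apply: eq_bigr => B _.
  by rewrite inE; case: tens.
rewrite -(nloopsE xK (@flipK k)).
pose F (A : cols k) : {ffun pts k -> bool} := [ffun p => colr A A p].
have F_inj : injective F.
  by move=> A A' /ffunP AA'; apply/ffunP=> i; have := AA' (inl i); rewrite !ffunE.
rewrite -(card_imset _ F_inj); apply: eq_card => a; rewrite [RHS]inE.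
have flipN (p : pts k) : (flip p == p) = false by case: p.
apply/imsetP/forallP => [[A /[!inE] /forallP tA ->] p|aP].
  rewrite !ffunE flipN orbF; have /andP[-> ->] := tA p.
  by case: p => i; rewrite /= eqxx.
have aE : a = F [ffun i => a (inl i)].
  apply/ffunP=> -[i|i]; rewrite ffunE /= ffunE //.
  by have /and3P[_ /eqP] := aP (inl i).
exists ([ffun i => a (inl i)] : cols k); last exact: aE.
rewrite inE; apply/forallP => p.
have cE q : colr [ffun i => a (inl i)] [ffun i => a (inl i)] q = a q.
  by rewrite [in RHS]aE ffunE.
by rewrite !cE; have := aP p; rewrite flipN orbF; case/and3P => -> _ ->.
Qed.

Lemma compose_assoc k (x y z : {ffun pts k -> pts k}) :
  involutive x -> involutive y -> involutive z ->
  compose (compose x y) z = compose x (compose y z)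
  /\ kappa x y + kappa (compose x y) z = kappa y z + kappa x (compose y z).
Proof.
move=> xK yK zK.
have xyK := compose_inv xK yK; have yzK := compose_inv yK zK.
apply: tens_inj; [exact: compose_inv | exact: compose_inv |] => A C.
rewrite !expnD -!mulnA -!tens_compose // !big_distrr /=.
under eq_bigr do rewrite mulnA -tens_compose // big_distrl.
under [RHS]eq_bigr do rewrite [_ * (_ * _)]mulnCA -tens_compose // big_distrr.
rewrite exchange_big /=; apply: eq_bigr => B _; apply: eq_bigr => B' _.
by rewrite mulnA.
Qed.

Lemma tens_reflect k (x : pts k -> pts k) A B :
  tens (reflect_diag x) A B = tens x B A.
Proof.
have fc (q : pts k) : colr A B (flip q) = colr B A q by case: q.
have rE q : reflect_diag x (flip q) = flip (x q) by rewrite ffunE flipK.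
have gE q : (colr A B (reflect_diag x (flip q)) == colr A B (flip q))
    && ((reflect_diag x (flip q) == flip q) ==> ~~ colr A B (flip q))
  = (colr B A (x q) == colr B A q) && ((x q == q) ==> ~~ colr B A q).
  by rewrite rE !fc (inj_eq (can_inj (@flipK k))).
apply/forallP/forallP => h p; first by rewrite -gE; apply: h.
by rewrite -[p]flipK gE; apply: h.
Qed.

Lemma reflect_inv k (x : pts k -> pts k) :
  involutive x -> involutive (reflect_diag x).
Proof. by move=> xK p; rewrite !ffunE flipK xK flipK. Qed.

Lemma reflect_compose k (x y : {ffun pts k -> pts k}) :
  involutive x -> involutive y ->
  reflect_diag (compose x y) = compose (reflect_diag y) (reflect_diag x)
  /\ kappa x y = kappa (reflect_diag y) (reflect_diag x).
Proof.
move=> xK yK; have rx := reflect_inv xK; have ry := reflect_inv yK.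
apply: tens_inj; [exact/reflect_inv/compose_inv | exact: compose_inv |] => A C.
rewrite tens_reflect -!tens_compose //; apply: eq_bigr => B _.
by rewrite !tens_reflect mulnC.
Qed.

Lemma reflectK k (x : {ffun pts k -> pts k}) : reflect_diag (reflect_diag x) = x.
Proof. by apply/ffunP=> p; rewrite !ffunE !flipK. Qed.

Lemma sum_tens_compose k (x y : pts k -> pts k) : involutive x -> involutive y ->
  2 ^ (kappa x y + cl_loops (compose x y)) = \sum_(A : cols k) \sum_B tens x A B * tens y B A.
Proof.
move=> xK yK; rewrite expnD -(tens_tr (compose_inv xK yK)) big_distrr /=.
by apply: eq_bigr => A _; rewrite tens_compose.
Qed.

Lemma cl_loops_compose k (x y : {ffun pts k -> pts k}) :
  involutive x -> involutive y ->
  kappa x y + cl_loops (compose x y) = kappa y x + cl_loops (compose y x).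
Proof.
move=> xK yK.
apply: (expnI (isT : 1 < 2)).
apply: etrans (sum_tens_compose xK yK) (etrans _ (esym (sum_tens_compose yK xK))).
rewrite exchange_big /=; apply: eq_bigr => B _.
by apply: eq_bigr => B' _; rewrite mulnC.
Qed.

Lemma cl_loops_reflect k (x : {ffun pts k -> pts k}) :
  involutive x -> cl_loops (reflect_diag x) = cl_loops x.
Proof.
move=> xK; apply: (expnI (isT : 1 < 2)).
rewrite -(tens_tr xK) -(tens_tr (reflect_inv xK)).
by apply: eq_bigr => A _; rewrite tens_reflect.
Qed.

Definition id_diag k : {ffun pts k -> pts k} := [ffun p => flip p].

Lemma id_diagK k : involutive (id_diag k).
Proof. by move=> p; rewrite !ffunE flipK. Qed.

Lemma tens_id k (A B : cols k) : tens (id_diag k) A B = (A == B).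
Proof.
apply/forallP/eqP => [h|-> p]; last by rewrite ffunE; case: p => i /=; rewrite eqxx.
by apply/ffunP=> i; have := h (inl i); rewrite ffunE /= andbT => /eqP.
Qed.

Lemma compose_id k (x : {ffun pts k -> pts k}) : involutive x ->
  (compose (id_diag k) x = x /\ kappa (id_diag k) x = 0)
  /\ (compose x (id_diag k) = x /\ kappa x (id_diag k) = 0).
Proof.
move=> xK; have iK := @id_diagK k; split; apply: tens_inj => //; try exact: compose_inv.
  move=> A C; rewrite -tens_compose // (bigD1 A) //= tens_id eqxx mul1n.
  rewrite big1 ?addn0 ?expn0 ?mul1n // => B BA.
  by rewrite tens_id eq_sym (negPf BA).
move=> A C; rewrite -tens_compose // (bigD1 C) //= tens_id eqxx muln1.
rewrite big1 ?addn0 ?expn0 ?mul1n // => B BA.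
by rewrite tens_id (negPf BA) muln0.
Qed.

(** * Planarity *)

Lemma bdry_inj k : injective (@bdry k).
Proof.
case=> i [] j /=; have := ltn_ord i; have := ltn_ord j => ltj lti E;
  by [congr inl; apply: ord_inj; lia | congr inr; apply: ord_inj; lia | lia].
Qed.

(** The injection [b] orders the points, and [f] exchanges the points of [S] below their image with
    those above. *)
Lemma odd_card_invol (T : finType) (b : T -> nat) (f : T -> T) (S : pred T) :
  injective b -> involutive f -> (forall u, S u -> S (f u)) ->
  (forall u, S u -> f u != u) -> odd #|S| = false.
Proof.
move=> b_inj fK Sf Sn.
have SfE u : S (f u) = S u.
  by apply/idP/idP => [/Sf|/Sf //]; rewrite fK.
rewrite -(cardID [pred u | b u < b (f u)] S).
have -> : #|[predD S & [pred u | b u < b (f u)]]| = #|[predI S & [pred u | b u < b (f u)]]|.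
  rewrite -(card_image (can_inj fK) [predI S & _]); apply: eq_card => u.
  rewrite -[u in RHS]fK mem_image; last exact: can_inj fK.
  rewrite !inE /= -!topredE /= SfE fK andbC; case Su: (S u) => //=.
  rewrite -leqNgt leq_eqVlt (inj_eq b_inj) (negPf (Sn _ Su)) //.
by rewrite oddD addbb.
Qed.

Section Side.
Variables (k : nat) (x : pts k -> pts k) (C : pred (pts k)).
Hypotheses (xK : involutive x) (ncx : noncrossing [ffun p => x p]).
Hypotheses (Cx : forall u, C (x u) = C u) (Cn : forall u, C u -> x u != u).

(* A string with points [C] separates the boundary into two sides, told apart
   by the parity of [nbefore]; no other string changes sides. *)
Definition nbefore (v : pts k) := \sum_(u : pts k) (C u && (bdry u < bdry v)).

Lemma crossingF p q : bdry p < bdry q -> bdry q < bdry (x p) -> bdry (x p) < bdry (x q) -> False.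
Proof.
move=> pq qxp xpxq; have /forallP/(_ p)/forallP/(_ q) := ncx.
by rewrite !ffunE pq qxp xpxq.
Qed.

Lemma odd_nbefore v : ~~ C v -> odd (nbefore (x v)) = odd (nbefore v).
Proof.
wlog lt_v : v / bdry v < bdry (x v).
  move=> IH Cv; have [/IH ->//|] := ltnP (bdry v) (bdry (x v)).
  rewrite leq_eqVlt => /orP[/eqP/bdry_inj ->//|lt_v].
  by rewrite -(IH (x v)) ?xK // Cx.
move=> Cv; pose S := [pred u | C u && (bdry v < bdry u < bdry (x v))].
have -> : nbefore (x v) = nbefore v + #|S|.
  rewrite -sum1_card [X in _ + X]big_mkcond /= -big_split /=.
  apply: eq_bigr => u _; rewrite inE /=; case Cu: (C u) => //=.
  have : bdry u != bdry v.
    by rewrite (inj_eq (@bdry_inj k)); apply: contraNneq Cv => <-.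
  case: (ltngtP (bdry u) (bdry v)) => //= uv _.
  by rewrite (ltn_trans uv lt_v).
rewrite oddD (@odd_card_invol _ (@bdry k) x S) ?addbF //.
- exact: bdry_inj.
- move=> u /= /and3P[Cu vu uxv]; rewrite Cx Cu /=.
  have nv : bdry (x u) != bdry v.
    rewrite (inj_eq (@bdry_inj k)); apply: contraNneq Cv => <-; by rewrite Cx.
  have nxv : bdry (x u) != bdry (x v).
    rewrite (inj_eq (@bdry_inj k)) (inj_eq (can_inj xK)).
    by apply: contraNneq Cv => <-.
  apply/andP; split.
    rewrite ltn_neqAle eq_sym nv leqNgt; apply/negP => lt_xu.
    by apply: (@crossingF (x u) v) => //; rewrite xK.
  rewrite ltn_neqAle nxv leqNgt; apply/negP => lt_xv.
  exact: (@crossingF v u).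
- by move=> u /andP[Cu _]; apply: Cn.
Qed.

End Side.

Lemma sum_pts k (F : pts k -> nat) :
  \sum_(u : pts k) F u = \sum_i F (inl i) + \sum_i F (inr i).
Proof. by rewrite /pts /= big_sumType. Qed.

Lemma nbefore_inl k (C : pred (pts k)) i :
  nbefore C (inl i) = \sum_j (C (inl j) && (j < i)).
Proof.
rewrite /nbefore sum_pts [X in _ + X]big1 ?addn0 // => j _ /=.
have := ltn_ord i; case: (C _) => //=; case: ltnP => //; lia.
Qed.

Lemma nbefore_inr k (C : pred (pts k)) i :
  nbefore C (inr i) = \sum_j C (inl j) + \sum_j (C (inr j) && (i < j)).
Proof.
rewrite /nbefore sum_pts; congr (_ + _); apply: eq_bigr => j _ /=.
  have := ltn_ord j; case: (C _) => //=; case: ltnP => //; lia.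
have := ltn_ord j; have := ltn_ord i; case: (C _) => //= ? ?; congr nat_of_bool; lia.
Qed.

(** A discrete Jordan curve argument. The string of [p] cuts the stack in two, and a crossing would
    put [q] and [z q] on different sides, whereas the string of [q] never changes sides. *)
Lemma compose_noncrossing k (x y : {ffun pts k -> pts k}) :
  involutive x -> involutive y -> noncrossing x -> noncrossing y ->
  noncrossing (compose x y).
Proof.
move=> xK yK ncx ncy; apply/forallP=> p; apply/forallP=> q; apply/negP.
set z := compose x y; case/and3P=> pq qzp zpzq.
have zK : involutive z := compose_inv xK yK.
pose c := connect (joined (stk_up x) (stk_down y)).
have csym : connect_sym (joined (stk_up x) (stk_down y)).
  exact: connect_joined_sym (stk_upK xK) (stk_downK yK).
have [zp [zpp zpE cp uniqp isop]] : exists zp, [/\ zp != p, compose x y p = zp,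
    c (stk_of_outer p) (stk_of_outer zp),
    (forall r, c (stk_of_outer p) (stk_of_outer r) -> r = p \/ r = zp)
    & forall v, isolated_end x y v -> ~~ c (stk_of_outer p) v].
  by have [//|[E _ _]] := composeP xK yK p; move: qzp pq; rewrite /z E; lia.
rewrite -/z in zpE; rewrite zpE in qzp zpzq.
pose C v := c (stk_of_outer p) v.
have Cf v : C (stk_up x v) = C v.
  by rewrite /C /c ![connect _ (stk_of_outer p) _]csym; apply/esym/(same_connect csym)/joined_f.
have Cg v : C (stk_down y v) = C v.
  by rewrite /C /c ![connect _ (stk_of_outer p) _]csym; apply/esym/(same_connect csym)/joined_g.
pose Cx : pred (pts k) := fun u => C (inl u).
pose Cy : pred (pts k) := fun u => C (stk_of_down u).
have CxE u : Cx (x u) = Cx u by rewrite /Cx -[RHS]Cf.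
have CyE u : Cy (y u) = Cy u by rewrite /Cy -[RHS]Cg stk_down_of_down.
have Cxn u : Cx u -> x u != u.
  move=> Cu; apply/eqP => xu; suff /isop/negP[] : isolated_end x y (inl u) by [].
  by left; exists u.
have Cyn u : Cy u -> y u != u.
  move=> Cu; apply/eqP => yu; suff /isop/negP[] : isolated_end x y (stk_of_down u) by [].
  by right; exists u.
have ncE (f : {ffun pts k -> pts k}) : noncrossing f -> noncrossing [ffun u => f u].
  by congr (noncrossing _); apply/ffunP=> u; rewrite ffunE.
have oddx := odd_nbefore xK (ncE _ ncx) CxE Cxn.
have oddy := odd_nbefore yK (ncE _ ncy) CyE Cyn.
pose T := \sum_i C (inl (inl i)).
pose Mid := \sum_i C (inl (inr i)).
(* Points of [x] are placed by the boundary of [x], bottom points by that of [y]. The shift by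
   [T + Mid] makes the two counts agree in parity at the middle points off the string of [p]. *)
pose side v := match v with inl u => odd (nbefore Cx u)
  | inr i => odd (nbefore Cy (inr i) + (T + Mid)) end.
have side_down w : ~~ Cy w -> side (stk_of_down w) = odd (nbefore Cy w + (T + Mid)).
  case: w => i //= Ci; rewrite nbefore_inr nbefore_inl -/T.
  have -> : Mid = \sum_j (C (inl (inr j)) && (j < i)) + \sum_j (C (inl (inr j)) && (i < j)).
    rewrite -big_split; apply: eq_bigr => j _ /=; have [<-|ji] := eqVneq i j.
      by rewrite ltnn -[C _]/(Cy (inl i)) (negPf Ci).
    by case: (C _) => //=; case: ltngtP => // /ord_inj E; rewrite E eqxx in ji.
  rewrite /Cx /Cy /=; lia.
pose Co u := C (stk_of_outer u).
have side_outer r : side (stk_of_outer r) = odd (nbefore Co r).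
  case: r => i; rewrite /= ?nbefore_inl // !nbefore_inr /Cy /Co /= -/T -/Mid; lia.
have CoE u : Co u = (u == p) || (u == zp).
  apply/idP/orP => [/uniqp[]->|[]/eqP->]; rewrite ?eqxx; [by left|by right|exact: connect0|exact: cp].
have Cq : ~~ C (stk_of_outer q).
  by rewrite -/(Co q) CoE; apply/negP=> /orP[]/eqP E; move: pq qzp; rewrite E; lia.
have cq : c (stk_of_outer q) (stk_of_outer (z q)).
  by have [[r [_ E cr _ _]]|[E _ _]] := composeP xK yK q; rewrite /z E // /c connect0.
have : ~~ C (stk_of_outer (z q)) && (side (stk_of_outer (z q)) == side (stk_of_outer q)).
  apply: (@connect_joined_ind _ (stk_up x) (stk_down y)
    (fun v => ~~ C v && (side v == side (stk_of_outer q))) _ _ _ _ cq) => [u|]; last by rewrite Cq /=.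
  case/andP=> Cu /eqP <-; rewrite Cf Cg Cu /=; apply/andP; split.
    by case: u Cu => //= w Cw; rewrite oddx.
  have side_y w : ~~ Cy w -> side (stk_of_down (y w)) == side (stk_of_down w).
    by move=> Cw; rewrite !side_down ?CyE // !oddD oddy.
  case: u Cu => [[i|i]|i] Ci //=; first exact: (side_y (inl i)).
  exact: (side_y (inr i)).
case/andP=> _; rewrite !side_outer.
have nE r : nbefore Co r = (bdry p < bdry r) + (bdry zp < bdry r).
  rewrite /nbefore (bigD1 p) //= (bigD1 zp) //= !CoE !eqxx orbT big1 ?addn0 // => u.
  by case/andP=> /negPf up /negPf uzp; rewrite CoE up uzp.
rewrite !nE; move: pq qzp zpzq; lia.
Qed.

(** * Generators and relations *)

Section Generators.
Variable k : nat.
Implicit Types (a b c i : 'I_k) (A B : cols k) (F : cols k -> nat).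

Definition q_diag a : {ffun pts k -> pts k} :=
  [ffun p => match p with
    | inl i => if i == a then inl i else inr i
    | inr i => if i == a then inr i else inl i
    end].

Definition r_diag a b : {ffun pts k -> pts k} := reflect_diag (l_diag a b).

Definition upd A a (u : bool) : cols k := [ffun i => if i == a then u else A i].

Lemma q_diagK a : involutive (q_diag a).
Proof. by case=> i; rewrite !ffunE; have [->|/negPf ia] := eqVneq i a; rewrite ?eqxx ?ia. Qed.

Lemma e_diagK a b : a != b -> involutive (e_diag a b).
Proof.
move=> ab; have ba := ab; rewrite eq_sym in ba.
by case=> i; rewrite !ffunE; have [->|ia] := eqVneq i a; rewrite ?eqxx ?(negPf ab) ?(negPf ba) ?eqxx //;
  have [->|ib] := eqVneq i b; rewrite ?eqxx ?(negPf ab) ?(negPf ba) ?eqxx ?(negPf ia) ?(negPf ib).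
Qed.

Lemma l_diagK a b : a != b -> involutive (l_diag a b).
Proof.
move=> ab; have ba := ab; rewrite eq_sym in ba.
by case=> i; rewrite !ffunE; have [->|ia] := eqVneq i a; rewrite ?eqxx ?(negPf ab) ?(negPf ba) ?eqxx //;
  have [->|ib] := eqVneq i b; rewrite ?eqxx ?(negPf ab) ?(negPf ba) ?eqxx ?(negPf ia) ?(negPf ib).
Qed.

Lemma r_diagK a b : a != b -> involutive (r_diag a b).
Proof. by move=> ab; apply/reflect_inv/l_diagK. Qed.

Lemma tens_q a A B : tens (q_diag a) A B = ~~ A a && (A == B).
Proof.
apply/forallP/andP => [h|[Aa /eqP<-] p].
  split; first by have := h (inl a); rewrite ffunE !eqxx.
  apply/eqP/ffunP=> i; have := h (inl i); rewrite ffunE; have [->|_] /= := eqVneq i a.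
    by rewrite !eqxx /=; have := h (inr a); rewrite ffunE !eqxx /=; do 2!case: (_ a).
  by rewrite andbT => /eqP.
by case: p => i; rewrite ffunE; have [->|_] := eqVneq i a; rewrite /= ?eqxx.
Qed.

Lemma tens_l a b A B : a != b ->
  tens (l_diag a b) A B = ~~ A b && (B == upd (upd A a false) b (A a)).
Proof.
move=> ab; have ba := ab; rewrite eq_sym in ba.
apply/forallP/andP => [h|[Ab /eqP-> p]].
  split; first by have := h (inl b); rewrite ffunE (negPf ba) !eqxx.
  apply/eqP/ffunP=> i; rewrite !ffunE; have [->|ib] := eqVneq i b.
    by have := h (inl a); rewrite ffunE eqxx /= andbT => /eqP.
  have [->|ia] := eqVneq i a.
    by have := h (inr a); rewrite ffunE (negPf ab) !eqxx /= => /negPf.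
  by have := h (inr i); rewrite ffunE (negPf ia) (negPf ib) /= andbT => /eqP.
have Ba : upd (upd A a false) b (A a) a = false by rewrite !ffunE (negPf ab) eqxx.
have Bb : upd (upd A a false) b (A a) b = A a by rewrite !ffunE eqxx.
have Bi i : i != a -> i != b -> upd (upd A a false) b (A a) i = A i.
  by move=> ia ib; rewrite !ffunE (negPf ia) (negPf ib).
by case: p => i; rewrite ffunE; have [->|ia] := eqVneq i a;
  rewrite /= ?(negPf ab) /= ?eqxx ?Bb ?Ba ?eqxx //=;
  have [->|ib] := eqVneq i b; rewrite /= ?Bb ?Ba ?Ab ?eqxx ?Bi ?eqxx.
Qed.

Lemma tens_r a b A B : a != b ->
  tens (r_diag a b) A B = ~~ A a && (B == upd (upd A b false) a (A b)).
Proof.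
move=> ab; have ba := ab; rewrite eq_sym in ba.
rewrite tens_reflect tens_l //.
have swapE A' B' : ~~ B' b -> A' = upd (upd B' a false) b (B' a) ->
    ~~ A' a && (B' == upd (upd A' b false) a (A' b)).
  move=> B'b ->; rewrite !ffunE !eqxx (negPf ab); apply/eqP/ffunP=> i; rewrite !ffunE.
  have [->|ia] := eqVneq i a; first by [].
  by have [->|//] := eqVneq i b; rewrite (negPf B'b).
have swapE' A' B' : ~~ A' a -> B' = upd (upd A' b false) a (A' b) ->
    ~~ B' b && (A' == upd (upd B' a false) b (B' a)).
  move=> A'a ->; rewrite !ffunE !eqxx (negPf ba); apply/eqP/ffunP=> i; rewrite !ffunE.
  have [->|ib] := eqVneq i b; first by [].
  by have [->|//] := eqVneq i a; rewrite (negPf A'a).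
by apply/andP/andP => -[H1 /eqP H2]; apply/andP; [apply: swapE | apply: swapE'].
Qed.

Lemma tens_e a b A B : a != b ->
  tens (e_diag a b) A B = (A a == A b) && (B == upd (upd A a (B a)) b (B a)).
Proof.
move=> ab; have ba := ab; rewrite eq_sym in ba.
apply/forallP/andP => [h|[/eqP Aab /eqP BE] p].
  split; first by have := h (inl b); rewrite ffunE (negPf ba) !eqxx /= => /andP[].
  apply/eqP/ffunP=> i; rewrite !ffunE; have [->|ib] := eqVneq i b.
    by have := h (inr b); rewrite ffunE (negPf ba) !eqxx /= => /andP[/eqP].
  have [-> //|ia] := eqVneq i a.
  by have := h (inr i); rewrite ffunE (negPf ia) (negPf ib) /= andbT => /eqP.
have Bab : B b = B a by rewrite {1}BE !ffunE !eqxx.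
have Bi i : i != a -> i != b -> B i = A i.
  by move=> ia ib; rewrite {1}BE !ffunE (negPf ia) (negPf ib).
have inlE i j : (inl i == inl j :> pts k) = (i == j) by [].
have inrE i j : (inr i == inr j :> pts k) = (i == j) by [].
by case: p => i; rewrite ffunE; have [->|ia] := eqVneq i a;
  rewrite /= ?inlE ?inrE ?Aab ?Bab ?eqxx ?(negPf ba) //;
  have [->|ib] := eqVneq i b; rewrite /= ?inlE ?inrE ?Aab ?Bab ?eqxx ?(negPf ab) //= Bi ?eqxx.
Qed.

(** Every row of the matrix of a generator has at most two non-zero entries, so the action on
    functions has a closed form and a relation between words in the generators becomes a comparison
    of values at one colouring. *)
Definition act (x : pts k -> pts k) F A : nat := \sum_(B : cols k) tens x A B * F B.

Lemma act_compose (x y : pts k -> pts k) F A : involutive x -> involutive y ->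
  act x (act y F) A = 2 ^ kappa x y * act (compose x y) F A.
Proof.
move=> xK yK; transitivity (\sum_B \sum_C tens x A B * (tens y B C * F C)).
  by apply: eq_bigr => B _; rewrite [act y F B]/act big_distrr.
rewrite exchange_big /act big_distrr /=; apply: eq_bigr => C _.
by rewrite mulnA -tens_compose // big_distrl; apply: eq_bigr => B _; rewrite /= mulnA.
Qed.

Lemma act_inj (x y : {ffun pts k -> pts k}) m n : involutive x -> involutive y ->
  (forall F A, 2 ^ m * act x F A = 2 ^ n * act y F A) -> x = y /\ m = n.
Proof.
move=> xK yK xy; apply: tens_inj => // A B.
have actE (z : pts k -> pts k) : act z (fun C => C == B) A = tens z A B.
  by rewrite /act (bigD1 B) //= eqxx muln1 big1 ?addn0 // => C /negPf ->; rewrite muln0.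
by rewrite -!actE.
Qed.

Lemma act_q a F A : act (q_diag a) F A = ~~ A a * F A.
Proof.
rewrite /act (bigD1 A) //= tens_q eqxx andbT big1 ?addn0 // => B.
by rewrite tens_q eq_sym => /negPf ->; rewrite andbF.
Qed.

Lemma act_l a b F A : a != b ->
  act (l_diag a b) F A = ~~ A b * F (upd (upd A a false) b (A a)).
Proof.
move=> ab; rewrite /act (bigD1 (upd (upd A a false) b (A a))) //= tens_l // eqxx andbT.
by rewrite big1 ?addn0 // => B /negPf BN; rewrite tens_l // BN andbF.
Qed.

Lemma act_r a b F A : a != b ->
  act (r_diag a b) F A = ~~ A a * F (upd (upd A b false) a (A b)).
Proof.
move=> ab; rewrite /act (bigD1 (upd (upd A b false) a (A b))) //= tens_r // eqxx andbT.
by rewrite big1 ?addn0 // => B /negPf BN; rewrite tens_r // BN andbF.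
Qed.

Lemma act_e a b F A : a != b ->
  act (e_diag a b) F A =
  (A a == A b) * (F (upd (upd A a false) b false) + F (upd (upd A a true) b true)).
Proof.
move=> ab; pose U u := upd (upd A a u) b u.
have Ua u : U u a = u by rewrite !ffunE eqxx (negPf ab).
rewrite /act (bigD1 (U false)) //= (bigD1 (U true)) /=; last first.
  by apply/eqP=> /ffunP/(_ a); rewrite !Ua.
rewrite !tens_e // !Ua !eqxx !andbT big1 ?addn0 ?mulnDr // => B /andP[B0 B1].
by rewrite tens_e // -/(U (B a)); case: (B a); rewrite ?(negPf B0) ?(negPf B1) andbF.
Qed.

End Generators.

Section Relations.
Variable k : nat.
Implicit Types (a b c i : 'I_k) (A B : cols k) (F G : cols k -> nat).

Lemma act_ext (d : pts k -> pts k) F G A : F =1 G -> act d F A = act d G A.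
Proof. by move=> FG; apply: eq_bigr => B _; rewrite FG. Qed.

Lemma act_qq a F A : act (q_diag a) (act (q_diag a) F) A = act (q_diag a) F A.
Proof. by rewrite !act_q mulnA mulnb andbb. Qed.

Lemma act_ee a b F A : a != b ->
  act (e_diag a b) (act (e_diag a b) F) A = 2 * act (e_diag a b) F A.
Proof.
move=> ab; rewrite !act_e // !ffunE !eqxx (negPf ab) ?eqxx !mul1n mulnCA; congr (_ * _).
rewrite mul2n -addnn; congr (F _ + F _ + (F _ + F _)); apply/ffunP=> i; rewrite !ffunE;
  by repeat case: ifP.
Qed.

Lemma act_eqe a b F A : a != b ->
  act (e_diag a b) (act (q_diag a) (act (e_diag a b) F)) A = act (e_diag a b) F A.
Proof.
move=> ab; rewrite act_e // !act_q !act_e // !ffunE !eqxx (negPf ab) ?eqxx !mul1n mul0n addn0.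
congr (_ * (F _ + F _)); apply/ffunP=> i; rewrite !ffunE; by repeat case: ifP.
Qed.

Lemma act_eqqe a b F A : a != b ->
  act (e_diag a b) (act (q_diag a) (act (q_diag b) (act (e_diag a b) F))) A =
  act (e_diag a b) F A.
Proof.
move=> ab; rewrite act_e // !act_q !act_e // !ffunE !eqxx (negPf ab) ?eqxx !mul1n mul0n addn0.
congr (_ * (F _ + F _)); apply/ffunP=> i; rewrite !ffunE; by repeat case: ifP.
Qed.

Lemma act_qqeqq a b F A : a != b ->
  act (q_diag a) (act (q_diag b) (act (e_diag a b) (act (q_diag a) (act (q_diag b) F)))) A =
  act (q_diag a) (act (q_diag b) F) A.
Proof.
move=> ab; rewrite !act_q act_e // !act_q !ffunE !eqxx (negPf ab) ?eqxx !mul1n mul0n addn0.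
case Aa : (A a); rewrite ?mul0n // !mul1n; case Ab : (A b); rewrite ?mul0n //= !mul1n.
congr F; apply/ffunP=> i; rewrite !ffunE.
by have [->|_] := eqVneq i b; [rewrite Ab | have [->|//] := eqVneq i a].
Qed.

Lemma act_qe a b F A : a != b ->
  act (q_diag b) (act (e_diag a b) F) A = act (q_diag a) (act (e_diag a b) F) A.
Proof. by move=> ab; rewrite !act_q !act_e //; case: (A a); case: (A b). Qed.

Lemma act_eee a b c F A : a != b -> b != c -> a != c ->
  act (e_diag b c) (act (e_diag a b) (act (e_diag b c) F)) A = act (e_diag b c) F A.
Proof.
move=> ab bc ac; have [ba cb ca] : [/\ b != a, c != b & c != a] by rewrite ![_ == a]eq_sym ![c == _]eq_sym.
rewrite !act_e // !ffunE !eqxx (negPf ab) (negPf bc) (negPf ac) ?(negPf ba) ?(negPf cb) ?(negPf ca) ?eqxx.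
congr (_ * _).
have FE u v w : upd (upd (upd (upd (upd (upd A b u) c u) a v) b v) b w) c w =
                upd (upd (upd A a v) b w) c w.
  by apply/ffunP=> i; rewrite !ffunE; repeat case: ifP.
have FE2 u : upd (upd (upd A a (A a)) b u) c u = upd (upd A b u) c u.
  apply/ffunP=> i; rewrite !ffunE; repeat case: ifP => //; by case: eqP => // ->.
rewrite !FE; have := FE2 true; have := FE2 false.
by case: (A a) => <- <- /=; rewrite !(mul1n, mul0n, addn0, add0n).
Qed.

Lemma act_lr a b F A : a != b ->
  act (l_diag a b) (act (r_diag a b) F) A = act (q_diag b) F A.
Proof.
move=> ab; rewrite act_l // act_r // act_q !ffunE !eqxx (negPf ab) ?eqxx mul1n.
case Ab: (A b); rewrite ?mul0n // !mul1n; congr F; apply/ffunP=> i; rewrite !ffunE.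
by have [->//|_] := eqVneq i a; have [->|//] := eqVneq i b.
Qed.

Lemma act_rl a b F A : a != b ->
  act (r_diag a b) (act (l_diag a b) F) A = act (q_diag a) F A.
Proof.
move=> ab; have ba := ab; rewrite eq_sym in ba.
rewrite act_r // act_l // act_q !ffunE !eqxx (negPf ba) ?eqxx mul1n.
case Aa: (A a); rewrite ?mul0n // !mul1n; congr F; apply/ffunP=> i; rewrite !ffunE.
by have [->//|_] := eqVneq i b; have [->|//] := eqVneq i a.
Qed.

Lemma act_rq a b F A : a != b ->
  act (r_diag a b) (act (q_diag b) F) A = act (r_diag a b) F A.
Proof.
move=> ab; have ba := ab; rewrite eq_sym in ba.
by rewrite !act_r // act_q !ffunE (negPf ba) eqxx mul1n.
Qed.

Lemma act_lq a b F A : a != b ->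
  act (l_diag a b) (act (q_diag a) F) A = act (l_diag a b) F A.
Proof. by move=> ab; rewrite !act_l // act_q !ffunE (negPf ab) eqxx mul1n. Qed.

Section Vertical.
Variable d : pts k -> pts k.
Hypothesis dK : involutive d.

Lemma vert_col a A B : d (inl a) = inr a -> tens d A B -> A a = B a.
Proof. by move=> da /forallP/(_ (inl a)); rewrite da /= => /andP[/eqP ->]. Qed.

(** The two ends of a vertical strand meet no other string, so recolouring both affects no other
    condition. Commutation with the generators on vertical strands rests on this. *)
Lemma tens_vert a u A B : d (inl a) = inr a -> A a = B a ->
  tens d (upd A a u) (upd B a u) = tens d A B.
Proof.
move=> da AB; have da' : d (inr a) = inl a by rewrite -da dK.
apply: eq_forallb => p.
have colE q : q != inl a -> q != inr a ->
    colr (upd A a u) (upd B a u) q = colr A B q.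
  by case: q => i qa qb; rewrite /= ffunE; have [E|//] := eqVneq i a;
    [rewrite E eqxx in qa | rewrite E eqxx in qb].
have [->|pl] := eqVneq p (inl a); first by rewrite da /= !ffunE !eqxx AB eqxx.
have [->|pr] := eqVneq p (inr a); first by rewrite da' /= !ffunE !eqxx AB eqxx.
have dpl : d p != inl a by rewrite -da' (inj_eq (can_inj dK)).
have dpr : d p != inr a by rewrite -da (inj_eq (can_inj dK)).
by rewrite !colE.
Qed.

Lemma act_vert_upd a u F A : d (inl a) = inr a ->
  act d F (upd A a u) = act d (fun B => F (upd B a u)) A.
Proof.
move=> da.
have cond A' G : act d G A' = \sum_(B : cols k | B a == A' a) tens d A' B * G B.
  rewrite [RHS]big_mkcond; apply: eq_bigr => B _.
  by case: eqP => // BA; case tE: (tens d A' B) => //; case: BA; rewrite (vert_col da tE).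
rewrite !cond (reindex_onto (fun B => upd B a u) (fun B => upd B a (A a))) /=; last first.
  move=> B /eqP; rewrite !ffunE eqxx => Ba; apply/ffunP=> i; rewrite !ffunE.
  by case: eqP => // ->.
apply: eq_big => [B|B /andP[_ /eqP BE]].
  rewrite !ffunE !eqxx /=; apply/eqP/eqP => [<-|<-]; first by rewrite !ffunE eqxx.
  by apply/ffunP=> i; rewrite !ffunE; case: eqP => // ->.
by rewrite tens_vert // -BE !ffunE eqxx.
Qed.

Lemma act_vert_scal (w : cols k -> nat) F A :
  (forall B, tens d A B -> w A = w B) ->
  act d (fun B => w B * F B) A = w A * act d F A.
Proof.
move=> wE; rewrite /act big_distrr /=; apply: eq_bigr => B _.
by case tE: (tens d A B) => //; rewrite ?mul1n -?(wE _ tE) // mul0n muln0.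
Qed.

Lemma act_addr F G A : act d (fun B => F B + G B) A = act d F A + act d G A.
Proof. by rewrite /act -big_split; apply: eq_bigr => B _; rewrite mulnDr. Qed.

Lemma act_vert_q a F A : d (inl a) = inr a ->
  act d (act (q_diag a) F) A = act (q_diag a) (act d F) A.
Proof.
move=> da; rewrite act_q -(@act_vert_scal (fun B => nat_of_bool (~~ B a))).
  by apply: act_ext => B; rewrite act_q.
by move=> B /(vert_col da) ->.
Qed.

Lemma act_vert_e a b F A : a != b -> d (inl a) = inr a -> d (inl b) = inr b ->
  act d (act (e_diag a b) F) A = act (e_diag a b) (act d F) A.
Proof.
move=> ab da db; rewrite act_e // !act_vert_upd // -act_addr.
rewrite -(@act_vert_scal (fun B => nat_of_bool (B a == B b))).
  by apply: act_ext => B; rewrite act_e.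
by move=> B tB; rewrite (vert_col da tB) (vert_col db tB).
Qed.

Lemma act_vert_l a b F A : a != b -> d (inl a) = inr a -> d (inl b) = inr b ->
  act d (act (l_diag a b) F) A = act (l_diag a b) (act d F) A.
Proof.
move=> ab da db; rewrite act_l // !act_vert_upd //.
rewrite -(@act_vert_scal (fun B => nat_of_bool (~~ B b))); last by move=> B /(vert_col db) ->.
apply: eq_bigr => B _; rewrite act_l //; case tB: (tens d A B) => //.
by rewrite (vert_col da tB).
Qed.

Lemma act_vert_r a b F A : a != b -> d (inl a) = inr a -> d (inl b) = inr b ->
  act d (act (r_diag a b) F) A = act (r_diag a b) (act d F) A.
Proof.
move=> ab da db; rewrite act_r // !act_vert_upd //.
rewrite -(@act_vert_scal (fun B => nat_of_bool (~~ B a))); last by move=> B /(vert_col da) ->.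
apply: eq_bigr => B _; rewrite act_r //; case tB: (tens d A B) => //.
by rewrite (vert_col db tB).
Qed.

(** Flipping the colour of the strand [a] pairs the colourings that are false at [a] with those that
    are true there. *)
Lemma sum_vert a : d (inl a) = inr a ->
  \sum_(A : cols k) tens d A A = 2 * \sum_(A : cols k) ~~ A a * tens d A A.
Proof.
move=> da; pose s A := upd A a (~~ A a).
have sK : involutive s.
  by move=> A; apply/ffunP=> i; rewrite !ffunE; case: eqP => // ->; rewrite eqxx negbK.
have -> : \sum_A tens d A A = \sum_(A : cols k) (~~ A a * tens d A A + A a * tens d A A).
  by apply: eq_bigr => A _; case: (A a); rewrite !(mul1n, mul0n, addn0).
rewrite big_split mul2n -addnn /=; congr (_ + _).
rewrite (reindex_inj (can_inj sK)); apply: eq_bigr => A _.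
by rewrite !ffunE eqxx tens_vert.
Qed.

End Vertical.

(** The vertical strand closes up to a loop by itself, which the isolated points cut open; in
    colours this halves the trace by [sum_vert]. It is the source of the factor [D^-1] in the
    trace. *)
Lemma cl_loops_q (d : pts k -> pts k) a : involutive d -> d (inl a) = inr a ->
  (kappa d (q_diag a) + cl_loops (compose d (q_diag a))).+1 = cl_loops d.
Proof.
move=> dK da; apply: (expnI (isT : 1 < 2)).
rewrite expnS; apply: etrans (congr1 (muln 2) (sum_tens_compose dK (@q_diagK _ a))) _.
apply: etrans (esym (etrans (esym (tens_tr dK)) (sum_vert dK da))) => //.
congr (2 * _); apply: eq_bigr => A _.
rewrite (bigD1 A) //= tens_q eqxx andbT mulnC big1 ?addn0 // => B.
by rewrite tens_q => /negPf ->; rewrite andbF muln0.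
Qed.

(** The Markov property of the trace: the loop of the strand [b] is merged into the string at [a].
    In colours, the condition that [a] and [b] agree keeps one of the two colours of the strand
    [b]. *)
Lemma cl_loops_e (d : pts k -> pts k) a b : a != b ->
  involutive d -> d (inl b) = inr b ->
  (kappa d (e_diag a b) + cl_loops (compose d (e_diag a b))).+1 = cl_loops d.
Proof.
move=> ab dK db; apply: (expnI (isT : 1 < 2)).
rewrite expnS; apply: etrans (congr1 (muln 2) (sum_tens_compose dK (e_diagK ab))) _.
apply: etrans (tens_tr dK); pose s A := upd A b (~~ A b).
have sK : involutive s.
  by move=> A; apply/ffunP=> i; rewrite !ffunE; case: eqP => // ->; rewrite eqxx negbK.
have -> : \sum_(A : cols k) \sum_B tens d A B * tens (e_diag a b) B A
    = \sum_(A : cols k) (A a == A b) * tens d A A.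
  apply: eq_bigr => A _; rewrite (bigD1 A) //= tens_e // big1 ?addn0.
    rewrite mulnC; congr (_ * _); congr nat_of_bool.
    have [Aab|//] := eqVneq (A a) (A b); apply/eqP/ffunP=> i; rewrite !ffunE.
    by case: eqP => [->//|_]; case: eqP => // ->.
  move=> B BA; case tB: (tens d A B) => //; rewrite mul1n tens_e //.
  case: andP => // -[/eqP Bab /eqP AE].
  have Aab : A b = A a by rewrite {1}AE !ffunE eqxx.
  case/eqP: BA; apply/ffunP=> i; rewrite [in RHS]AE !ffunE.
  have Bb := vert_col db tB.
  have [->|_] := eqVneq i b; first by rewrite -Bb.
  by have [->|//] := eqVneq i a; rewrite Bab -Bb.
have -> : \sum_A tens d A A = \sum_(A : cols k)
    ((A a == A b) * tens d A A + (A a != A b) * tens d A A).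
  by apply: eq_bigr => A _; case: (A a == A b); rewrite !(mul1n, mul0n, addn0).
rewrite big_split mul2n -addnn /=; congr (_ + _).
rewrite [RHS](reindex_inj (can_inj sK)); apply: eq_bigr => A _.
by rewrite tens_vert // !ffunE eqxx (negPf ab); case: (A a); case: (A b).
Qed.

End Relations.

Lemma is_motzkinP k (f : {ffun pts k -> pts k}) :
  reflect (involutive f /\ (forall p q, bdry p < bdry q -> bdry q < bdry (f p) ->
                              bdry (f p) < bdry (f q) -> False))
    (is_motzkin f).
Proof.
apply: (iffP andP) => -[fK nc]; split.
- by move=> p; apply/eqP/(forallP fK).
- by move=> p q pq qfp fpfq; have /forallP/(_ p)/forallP/(_ q) := nc; rewrite pq qfp fpfq.
- by apply/forallP=> p; rewrite fK.
- by apply/forallP=> p; apply/forallP=> q; apply/negP=> /and3P[*]; apply: (nc p q).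
Qed.

Lemma motzkin_inv k (f : {ffun pts k -> pts k}) : is_motzkin f -> involutive f.
Proof. by case/is_motzkinP. Qed.

Lemma compose_motzkin k (x y : {ffun pts k -> pts k}) :
  is_motzkin x -> is_motzkin y -> is_motzkin (compose x y).
Proof.
move=> mx my; have xK := motzkin_inv mx; have yK := motzkin_inv my.
apply/andP; split; first by apply/forallP=> p; rewrite (compose_inv xK yK).
by apply: compose_noncrossing => //; [case/andP: mx | case/andP: my].
Qed.

Lemma bdry_flip k (p : pts k) : bdry (flip p) + bdry p = (k + k).-1.
Proof. by case: p => i /=; have := ltn_ord i; lia. Qed.

Lemma reflect_motzkin k (x : {ffun pts k -> pts k}) :
  is_motzkin x -> is_motzkin (reflect_diag x).
Proof.
case/is_motzkinP=> xK nc; apply/is_motzkinP; split; first exact: reflect_inv.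
move=> p q; rewrite !ffunE => pq qp pq'; apply: (nc (x (flip q)) (x (flip p))); rewrite ?xK.
all: have := bdry_flip p; have := bdry_flip q.
all: have := bdry_flip (x (flip p)); have := bdry_flip (x (flip q)); lia.
Qed.

Section GenMotzkin.
Variable k : nat.
Implicit Types (a b i j : 'I_k) (d : {ffun pts k -> pts k}).

Lemma id_motzkin : is_motzkin (id_diag k).
Proof.
apply/is_motzkinP; split; first exact: id_diagK.
by case=> i [] j /=; rewrite !ffunE /=; have := ltn_ord i; have := ltn_ord j; lia.
Qed.

Lemma q_motzkin a : is_motzkin (q_diag a).
Proof.
apply/is_motzkinP; split; first exact: q_diagK.
case=> i [] j /=; rewrite !ffunE /= -!val_eqE /=; have := ltn_ord i; have := ltn_ord j;
  case: eqP => /=; case: eqP => /=; lia.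
Qed.

Lemma e_motzkin a b : b = a.+1 :> nat -> is_motzkin (e_diag a b).
Proof.
move=> bE; have ab : a != b by rewrite -val_eqE /=; lia.
apply/is_motzkinP; split; first exact: e_diagK.
case=> i [] j /=; rewrite !ffunE /= -!val_eqE /=;
  have := ltn_ord i; have := ltn_ord j; have := ltn_ord b;
  repeat (case: eqP => /=); lia.
Qed.

Lemma l_motzkin a b : b = a.+1 :> nat -> is_motzkin (l_diag a b).
Proof.
move=> bE; have ab : a != b by rewrite -val_eqE /=; lia.
apply/is_motzkinP; split; first exact: l_diagK.
case=> i [] j /=; rewrite !ffunE /= -!val_eqE /=;
  have := ltn_ord i; have := ltn_ord j; have := ltn_ord b;
  repeat (case: eqP => /=); lia.
Qed.

Lemma r_motzkin a b : b = a.+1 :> nat -> is_motzkin (r_diag a b).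
Proof. by move=> bE; apply/reflect_motzkin/l_motzkin. Qed.

Inductive gen : {ffun pts k -> pts k} -> Prop :=
| gen_id : gen (id_diag k)
| gen_q a : gen (q_diag a)
| gen_e a b : b = a.+1 :> nat -> gen (e_diag a b)
| gen_l a b : b = a.+1 :> nat -> gen (l_diag a b)
| gen_r a b : b = a.+1 :> nat -> gen (r_diag a b)
| gen_compose x y : gen x -> gen y -> gen (compose x y).

Lemma gen_motzkin d : gen d -> is_motzkin d.
Proof.
elim=> {d} [|a|a b|a b|a b|x y _ mx _ my].
- exact: id_motzkin.
- exact: q_motzkin.
- exact: e_motzkin.
- exact: l_motzkin.
- exact: r_motzkin.
- exact: compose_motzkin.
Qed.

Lemma gen_reflect d : gen d -> gen (reflect_diag d).
Proof.
elim=> {d} [|a|a b ab|a b ab|a b ab|x y gx IHx gy IHy].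
- have -> : reflect_diag (id_diag k) = id_diag k; last exact: gen_id.
  by apply/ffunP=> -[i|i]; rewrite !ffunE.
- have -> : reflect_diag (q_diag a) = q_diag a; last exact: gen_q.
  by apply/ffunP=> -[i|i]; rewrite !ffunE /=; case: ifP.
- have -> : reflect_diag (e_diag a b) = e_diag a b; last exact: gen_e.
  by apply/ffunP=> -[i|i]; rewrite !ffunE /=; do 2?case: ifP.
- exact: gen_r.
- by rewrite /r_diag reflectK; apply: gen_l.
- have [|| -> _] := @reflect_compose _ x y; try exact/motzkin_inv/gen_motzkin.
  exact: gen_compose.
Qed.

Lemma compose_eq (x y z : {ffun pts k -> pts k}) :
  involutive x -> involutive y -> involutive z ->
  (forall F A, act x (act y F) A = act z F A) -> compose x y = z /\ kappa x y = 0.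
Proof.
move=> xK yK zK xyz; apply: act_inj => //; first exact: compose_inv.
by move=> F A; rewrite -act_compose // mul1n.
Qed.

(* A cup joining neighbours, or a matched top point just right of an isolated
   one, can be peeled off as a generator [e] or [r], leaving a diagram of
   smaller weight; diagrams without these patterns at top and bottom are
   products of [q]'s. *)
Definition weight d : nat :=
  \sum_(p : pts k) (d p != p) * (match p with inl i => i | inr i => i end).+1.

Definition reducible d : Prop :=
  (exists a b, b = a.+1 :> nat /\ d (inl a) = inl b) \/
  (exists a b, [/\ b = a.+1 :> nat, d (inl a) = inl a & d (inl b) <> inl b]).

(** [d'] isolates the two points of the cup. In the product the cup is supplied by the top of
    [e_diag a b], and the string at the bottom of [e_diag a b] meets isolated points and is
    discarded. *)
Lemma reduce_cup d a b : is_motzkin d -> b = a.+1 :> nat -> d (inl a) = inl b ->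
  exists d', [/\ is_motzkin d', weight d' < weight d & compose (e_diag a b) d' = d].
Proof.
move=> md bE da; have [dK nc] := is_motzkinP _ md.
have ab : a != b by rewrite -val_eqE /=; lia.
have ba : b != a by rewrite eq_sym.
have db : d (inl b) = inl a by rewrite -da dK.
pose d' : {ffun pts k -> pts k} :=
  [ffun p => if (p == inl a) || (p == inl b) then p else d p].
have d'E p : p != inl a -> p != inl b -> d' p = d p.
  by move=> /negPf pa /negPf pb; rewrite ffunE pa pb.
have d'a : d' (inl a) = inl a by rewrite ffunE eqxx.
have d'b : d' (inl b) = inl b by rewrite ffunE eqxx orbT.
have dpa p : p != inl b -> d p != inl a by rewrite -db (inj_eq (can_inj dK)).
have dpb p : p != inl a -> d p != inl b by rewrite -da (inj_eq (can_inj dK)).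
have d'K : involutive d'.
  move=> p; have [->|pa] := eqVneq p (inl a); first by rewrite !d'a.
  have [->|pb] := eqVneq p (inl b); first by rewrite !d'b.
  by rewrite (d'E p) // d'E ?dK ?dpa ?dpb.
have md' : is_motzkin d'.
  apply/is_motzkinP; split=> // p q pq; rewrite (ffunE _ p) (ffunE _ q).
  case: ifP => _; first by lia.
  by case: ifP => _; [lia | apply: nc].
exists d'; split=> //.
  rewrite /weight (bigD1 (inl a)) //= [X in _ < X](bigD1 (inl a)) //= d'a da.
  rewrite eqxx mul0n add0n.
  have -> : (inl b != inl a :> pts k) by rewrite -[_ == _]/(b == a).
  rewrite mul1n addSn ltnS; apply: leq_trans (leq_addl _ _).
  apply: leq_sum => p pa; have [->|pb] := eqVneq p (inl b); first by rewrite d'b eqxx.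
  by rewrite d'E.
apply: (proj1 (compose_eq (e_diagK ab) d'K dK _)) => F A.
rewrite act_e // /act -big_split big_distrr; apply: eq_bigr => B _ /=.
rewrite [tens d' (upd (upd A a true) b true) B](_ : _ = false); last first.
  by apply/negbTE/forallP=> /(_ (inl a)); rewrite d'a eqxx /= !ffunE !eqxx; case: ifP.
rewrite mul0n addn0 mulnA mulnb; congr (nat_of_bool _ * _).
have colE p : p != inl a -> p != inl b ->
   colr (upd (upd A a false) b false) B p = colr A B p.
  case: p => i //= pa pb; rewrite !ffunE; case: eqP => [E|_]; first by rewrite E eqxx in pb.
  by case: eqP => // E; rewrite E eqxx in pa.
apply/andP/forallP => [[/eqP Aab /forallP t] p|t]; last split.
- have [->|pa] := eqVneq p (inl a); first by rewrite da /= Aab eqxx /= -[_ == _]/(b == a) (negPf ba).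
  have [->|pb] := eqVneq p (inl b); first by rewrite db /= Aab eqxx /= -[_ == _]/(a == b) (negPf ab).
  by have := t p; rewrite d'E // !colE // ?dpa ?dpb.
- by have := t (inl a); rewrite da /= => /andP[/eqP -> ].
apply/forallP=> p; have [->|pa] := eqVneq p (inl a).
  by rewrite d'a /= !ffunE !eqxx (negPf ab).
have [->|pb] := eqVneq p (inl b); first by rewrite d'b /= !ffunE !eqxx.
by rewrite d'E // !colE // ?dpa ?dpb //.
Qed.

End GenMotzkin.

Section Generation.
Variable k : nat.
Implicit Types (a b i j : 'I_k) (d : {ffun pts k -> pts k}).

(** [d'] carries at [a] the string that [d] has at [b], which lowers the weight, and [r_diag a b]
    shifts it back. *)
Lemma reduce_shift d a b : is_motzkin d -> b = a.+1 :> nat ->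
  d (inl a) = inl a -> d (inl b) <> inl b ->
  exists d', [/\ is_motzkin d', weight d' < weight d & compose (r_diag a b) d' = d].
Proof.
move=> md bE da /eqP db; have [dK nc] := is_motzkinP _ md.
have ab : a != b by rewrite -val_eqE /=; lia.
have ba : b != a by rewrite eq_sym.
have [s [sa sb sE]] : exists s : pts k -> pts k, [/\ s (inl a) = inl b, s (inl b) = inl a
    & forall p, p != inl a -> p != inl b -> s p = p].
  exists (fun p => if p == inl a then inl b else if p == inl b then inl a else p).
  split; first by rewrite eqxx.
    by rewrite eqxx -[inl b == inl a]/(b == a) (negPf ba).
  by move=> p /negPf -> /negPf ->.
have sK : involutive s.
  move=> p; have [->|pa] := eqVneq p (inl a); first by rewrite sa sb.
  have [->|pb] := eqVneq p (inl b); first by rewrite sb sa.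
  by rewrite !sE.
pose d' : {ffun pts k -> pts k} := [ffun p => s (d (s p))].
have d'K : involutive d' by move=> p; rewrite !ffunE sK dK sK.
have d'b : d' (inl b) = inl b by rewrite ffunE sb da sa.
(* The exchange [s] of two neighbours preserves the boundary order away from [inl b], which is
   isolated in [d']; so planarity survives. *)
have ltE p q : p != inl b -> q != inl b -> bdry p < bdry q -> bdry (s p) < bdry (s q).
  have bs p' : p' != inl b -> bdry (s p') = if p' == inl a then a.+1 else bdry p'.
    move=> p'b; case: eqP => [->|/eqP p'a]; first by rewrite sa /= bE.
    by rewrite sE.
  have bb p' : p' != inl b -> bdry p' <> a.+1.
    by move=> /eqP p'b E; apply: p'b; apply: (@bdry_inj k); rewrite E /= bE.
  move=> pb qb; rewrite !bs //; have := bb _ pb; have := bb _ qb.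
  case: (p =P inl a) => [->|_]; case: (q =P inl a) => [->|_] /=; lia.
have md' : is_motzkin d'.
  apply/is_motzkinP; split=> // p q pq qp pq'.
  have np p' : bdry p' < bdry (d' p') -> (p' != inl b) && (d' p' != inl b).
    move=> lt; have p'b : p' != inl b by apply: contraTneq lt => ->; rewrite d'b ltnn.
    by rewrite p'b /= -d'b (inj_eq (can_inj d'K)).
  have /np/andP[pb dpb] : bdry p < bdry (d' p) by lia.
  have /np/andP[qb dqb] : bdry q < bdry (d' q) by lia.
  apply: (nc (s p) (s q)); first exact: ltE.
    by have := ltE _ _ qb dpb qp; rewrite ffunE sK.
  by have := ltE _ _ dpb dqb pq'; rewrite !ffunE !sK.
exists d'; split=> //.
  rewrite /weight (reindex_inj (can_inj sK)) /= (bigD1 (inl b)) //=.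
  rewrite [X in _ < X](bigD1 (inl b)) //= sb.
  have sdE p : (d' (s p) != s p) = (d p != p).
    by rewrite ffunE sK (inj_eq (can_inj sK)).
  have -> : (d' (inl a) != inl a) = (d (inl b) != inl b) by rewrite -sb sdE.
  rewrite db !mul1n bE [X in _ < X]addSn ltnS leq_add2l.
  apply: leq_sum => p pb; rewrite sdE.
  have [->|pa] := eqVneq p (inl a); first by rewrite da eqxx.
  by rewrite sE.
apply: (proj1 (compose_eq (r_diagK ab) d'K dK _)) => F A.
rewrite act_r // /act big_distrr; apply: eq_bigr => B _ /=.
rewrite mulnA mulnb; congr (nat_of_bool _ * _).
set A' := upd _ _ _.
have colE p : ~~ A a -> colr A' B p = colr A B (s p).
  move=> /negPf Aa; have [->|pa] := eqVneq p (inl a); first by rewrite sa /= !ffunE eqxx.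
  have [->|pb] := eqVneq p (inl b); first by rewrite sb /= !ffunE eqxx (negPf ba).
  rewrite sE //; case: p pa pb => i //= pa pb; rewrite !ffunE.
  case: eqP => [E|_]; first by rewrite E eqxx in pa.
  by case: eqP => // E; rewrite E eqxx in pb.
have pE p : (s (d (s p)) == p) = (d (s p) == s p).
  by apply/eqP/eqP => [E|->]; rewrite ?sK // -{2}E sK.
apply/andP/forallP => [[Aa /forallP t] p|t].
  by have := t (s p); rewrite ffunE !colE // !sK (inj_eq (can_inj sK)).
have Aa : ~~ A a by have := t (inl a); rewrite da !eqxx.
split=> //; apply/forallP=> p; rewrite ffunE !colE // sK pE.
exact: t.
Qed.

Lemma reducible_red d : is_motzkin d -> reducible d ->
  exists g d', [/\ gen g, is_motzkin d', weight d' < weight d & compose g d' = d].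
Proof.
move=> md [[a [b [bE dab]]]|[a [b [bE da db]]]].
  have [d' [md' wd' E]] := reduce_cup md bE dab.
  by exists (e_diag a b), d'; split=> //; apply: gen_e.
have [d' [md' wd' E]] := reduce_shift md bE da db.
by exists (r_diag a b), d'; split=> //; apply: gen_r.
Qed.

(** Induction on the width of the cup: by planarity the point just left of its right end [j] is
    joined to a point inside, giving a narrower cup, or is isolated, which is the second reducible
    pattern. *)
Lemma no_cup d i j : is_motzkin d -> ~ reducible d -> d (inl i) = inl j -> i < j -> False.
Proof.
move=> md nred; have [dK nc] := is_motzkinP _ md.
have [n] := ubnP (j - i); elim: n => // n IHn in i j *.
move=> le_n dij ltij; have [jE|neq] := eqVneq (j : nat) i.+1.
  by apply: nred; left; exists i, j.
have j'P : j.-1 < k by have := ltn_ord j; lia.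
pose l := Ordinal j'P; have jE : j = l.+1 :> nat by rewrite /=; lia.
have dji : d (inl j) = inl i by rewrite -dij dK.
case dl: (d (inl l)) => [m|m]; last first.
  apply: (nc (inl i) (inl l)); rewrite ?dij ?dl /=; have := ltn_ord j; lia.
have dm : d (inl m) = inl l by rewrite -dl dK.
have [ml|ml|ml] := ltngtP m l.
- have [mi|mi|mi] := ltngtP m i.
  + apply: (nc (inl m) (inl i)); rewrite ?dm ?dij /=; lia.
  + apply: (IHn m l) => //=; lia.
  + have E : m = i by apply: ord_inj.
    have : inl l = inl j :> pts k by rewrite -[inl l]dK dl E dij.
    by case=> /(congr1 val) /=; lia.
- have [mj|mj|mj] := ltngtP m j.
  + move: ml; rewrite /=; lia.
  + apply: (nc (inl i) (inl l)); rewrite ?dij ?dl /=; lia.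
  + have E : m = j by apply: ord_inj.
    have : inl l = inl i :> pts k by rewrite -[inl l]dK dl E dji.
    by case=> /(congr1 val) /=; lia.
- have E : m = l by apply: ord_inj.
  apply: nred; right; exists l, j; split=> //; first by rewrite dl E.
  by rewrite dji => -[/(congr1 val)] /=; lia.
Qed.

Lemma matched_down d i i' : is_motzkin d -> ~ reducible d ->
  d (inl i) <> inl i -> i' <= i -> exists j, d (inl i') = inr j.
Proof.
move=> md nred; have [dK nc] := is_motzkinP _ md.
have thr j : d (inl j) <> inl j -> exists m, d (inl j) = inr m.
  case dj: (d (inl j)) => [m|m] E; last by exists m.
  have [mj|mj|mj] := ltngtP m j; last by case: E; congr inl; apply: ord_inj.
  - by case: (no_cup md nred _ mj); rewrite -dj dK.
  - by case: (no_cup md nred dj mj).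
move=> di le; apply: thr; move: le; rewrite -(subnK (leq0n i')).
have [n] := ubnP (i - i'); elim: n i' => // n IHn i' le_n; rewrite subn0 addn0.
rewrite leq_eqVlt => /orP[/eqP E|lti]; first by have -> : i' = i by apply: ord_inj.
have i1P : i'.+1 < k by have := ltn_ord i; lia.
have := IHn (Ordinal i1P); rewrite subn0 addn0 /= => IH di'.
apply: nred; right; exists i', (Ordinal i1P); split=> //; apply: IH; lia.
Qed.

(** Without reducible patterns, the matched points at the top and at the bottom form initial
    segments and are joined across, so planarity forces vertical strings. *)
Lemma not_reducible d i : is_motzkin d -> ~ reducible d -> ~ reducible (reflect_diag d) ->
  d (inl i) <> inl i -> d (inl i) = inr i.
Proof.
move=> md nt nb; have [dK nc] := is_motzkinP _ md.
have [n] := ubnP i; elim: n => // n IHn in i *; rewrite ltnS => le_n di.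
have [j dij] := matched_down md nt di (leqnn i).
have dji : d (inr j) = inl i by rewrite -dij dK.
have below i' : i' < i -> d (inl i') = inr i'.
  move=> lt; apply: IHn; first by lia.
  by have [m ->] := matched_down md nt di (ltnW lt).
have [ji|ji|ji] := ltngtP j i.
- have E : inl j = inl i :> pts k by rewrite -[inl j]dK below // dji.
  by case: E ji => ->; rewrite ltnn.
- have rj : reflect_diag d (inl j) <> inl j by rewrite ffunE /= dji.
  have [m] := matched_down (reflect_motzkin md) nb rj (ltnW ji).
  rewrite ffunE /=; case dm: (d (inr i)) => [m'|m'] //= [E]; subst m'.
  have dmi : d (inl m) = inr i by rewrite -dm dK.
  have [mi|mi|mi] := ltngtP m i.
  + by have := below m mi; rewrite dmi => -[E]; rewrite E ltnn in mi.
  + case: (nc (inl i) (inl m)); rewrite ?dij ?dmi /=;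
      have := ltn_ord j; have := ltn_ord i; have := ltn_ord m; lia.
  + have E : m = i by apply: ord_inj.
    by move: dmi; rewrite E dij => -[E']; rewrite E' ltnn in ji.
- by rewrite dij; congr inr; apply: ord_inj.
Qed.

Definition diag_of (s : seq 'I_k) : {ffun pts k -> pts k} :=
  [ffun p => match p with
    | inl i => if i \in s then inl i else inr i
    | inr i => if i \in s then inr i else inl i
    end].

Lemma diag_ofK s : involutive (diag_of s).
Proof. by case=> i; rewrite !ffunE; case: ifP => is_; rewrite is_. Qed.

Lemma tens_diag_of s A B : tens (diag_of s) A B = all (fun i => ~~ A i) s && (A == B).
Proof.
apply/forallP/andP => [h|[/allP As /eqP<-] p]; last first.
  by case: p => i; rewrite ffunE; case: ifP => /= is_; rewrite ?eqxx ?As //.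
have As i : i \in s -> ~~ A i /\ ~~ B i.
  move=> is_; split; [have := h (inl i) | have := h (inr i)];
    by rewrite ffunE is_ !eqxx.
split; first by apply/allP => i /As[].
apply/eqP/ffunP=> i; have := h (inl i); rewrite ffunE; case: ifP => is_ /=.
  by have [/negPf -> /negPf ->] := As i is_.
by rewrite andbT => /eqP.
Qed.

Lemma gen_diag_of s : gen (diag_of s).
Proof.
have actE s' F A : act (diag_of s') F A = all (fun i => ~~ A i) s' * F A.
  rewrite /act (bigD1 A) //= tens_diag_of eqxx andbT big1 ?addn0 // => B.
  by rewrite tens_diag_of eq_sym => /negPf ->; rewrite andbF.
elim: s => [|a s IHs].
  have -> : diag_of [::] = id_diag k; last exact: gen_id.
  by apply/ffunP=> -[i|i]; rewrite !ffunE.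
have [|<- _] := @compose_eq k (q_diag a) (diag_of s) (diag_of (a :: s))
    (@q_diagK _ a) (@diag_ofK s) (@diag_ofK _).
  by move=> F A; rewrite act_q !actE /= mulnA mulnb.
by apply: gen_compose => //; apply: gen_q.
Qed.

Theorem motzkin_gen d : is_motzkin d -> gen d.
Proof.
have [n] := ubnP (weight d); elim: n => // n IHn in d *; rewrite ltnS => le_n md.
have wr (x : {ffun pts k -> pts k}) : weight (reflect_diag x) = weight x.
  rewrite /weight (reindex_inj (can_inj (@flipK k))); apply: eq_bigr => -[i|i] _;
  by rewrite ffunE flipK (inj_eq (can_inj (@flipK k))).
have [|nt] := boolp.pselect (reducible d).
  move=> /(reducible_red md)[g [d' [gg md' lt <-]]].
  by apply: gen_compose => //; apply: IHn => //; apply: leq_trans lt le_n.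
have [|nb] := boolp.pselect (reducible (reflect_diag d)).
  move=> /(reducible_red (reflect_motzkin md))[g [d' [gg md' lt E]]].
  rewrite -[d]reflectK -E; apply: gen_reflect; apply: gen_compose => //; apply: IHn => //.
  by rewrite wr in lt; apply: leq_trans lt le_n.
have dK := motzkin_inv md.
have dl i : d (inl i) <> inl i -> d (inl i) = inr i by apply: not_reducible.
have dr i : d (inr i) <> inr i -> d (inr i) = inl i.
  move=> ne; have := @not_reducible (reflect_diag d) i (reflect_motzkin md) nb.
  rewrite reflectK ffunE => /(_ nt) H; apply: (can_inj (@flipK k)); apply: H => E.
  by apply: ne; apply: (can_inj (@flipK k)).
suff -> : d = diag_of [seq i <- enum 'I_k | d (inl i) == inl i] by exact: gen_diag_of.
apply/ffunP=> -[i|i]; rewrite ffunE mem_filter mem_enum andbT.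
  by case: eqP => // /dl.
case: eqP => [di|/dl E]; last by rewrite -E dK.
have [//|/eqP/dr E] := eqVneq (d (inr i)) (inr i).
by rewrite -E dK in di.
Qed.

End Generation.

(** * Vertical strands and the addition of a strand on the right *)

Definition vertical k (d : pts k -> pts k) (i : 'I_k) : bool := d (inl i) == inr i.

Lemma vertical_id k i : vertical (id_diag k) i.
Proof. by rewrite /vertical ffunE. Qed.

Lemma vertical_q k (a i : 'I_k) : i != a -> vertical (q_diag a) i.
Proof. by rewrite /vertical ffunE => /negPf ->. Qed.

Lemma vertical_e k (a b i : 'I_k) : i != a -> i != b -> vertical (e_diag a b) i.
Proof. by rewrite /vertical ffunE => /negPf -> /negPf ->. Qed.

Lemma vertical_l k (a b i : 'I_k) : i != a -> i != b -> vertical (l_diag a b) i.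
Proof. by rewrite /vertical ffunE => /negPf -> /negPf ->. Qed.

Lemma vertical_reflect k (d : pts k -> pts k) i : involutive d ->
  vertical d i -> vertical (reflect_diag d) i.
Proof. by move=> dK /eqP di; rewrite /vertical ffunE /= -{1}di dK. Qed.

Lemma vertical_compose k (x y : pts k -> pts k) i : involutive x -> involutive y ->
  vertical x i -> vertical y i -> vertical (compose x y) i.
Proof.
move=> xK yK /eqP xi /eqP yi; apply/eqP/eq_compose => //=.
apply: (@connect_trans _ _ (inl (inr i))).
  by rewrite -xi; exact: (joined_f (stk_up x) (stk_down y) (inl (inl i))).
have := joined_g (stk_up x) (stk_down y) (inl (inr i)).
by rewrite /= yi.
Qed.

Section AddStrand.
Variable k : nat.
Implicit Types (x : {ffun pts k -> pts k}) (a b i : 'I_k).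

Local Notation widen := (widen_ord (leqnSn k)).

Lemma widen_lift i : widen i = lift ord_max i.
Proof. by apply: ord_inj; rewrite lift_max. Qed.

Lemma unlift_widen i : unlift ord_max (widen i) = Some i.
Proof. by rewrite widen_lift liftK. Qed.

Lemma widen_pt_inj : injective (@widen_pt k).
Proof. by case=> i [] j //= [/ord_inj ->]. Qed.

Variant pts_spec : pts k.+1 -> Type :=
| PtsWiden p : pts_spec (widen_pt p)
| PtsTop : pts_spec (inl ord_max)
| PtsBot : pts_spec (inr ord_max).

Lemma ptsP p : pts_spec p.
Proof.
case: p => i; case: (unliftP ord_max i) => [j ->|->]; try by constructor.
- by rewrite -widen_lift; apply: (PtsWiden (inl j)).
- by rewrite -widen_lift; apply: (PtsWiden (inr j)).
Qed.

Lemma add_strand_widen x p : add_strand x (widen_pt p) = widen_pt (x p).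
Proof. by rewrite ffunE; case: p => i /=; rewrite unlift_widen. Qed.

Lemma add_strand_top x : add_strand x (inl ord_max) = inr ord_max.
Proof. by rewrite ffunE unlift_none. Qed.

Lemma add_strand_bot x : add_strand x (inr ord_max) = inl ord_max.
Proof. by rewrite ffunE unlift_none. Qed.

(** The two new points lie between the top and the bottom points in clockwise order, so only the
    ranks of the bottom points move. *)
Lemma bdry_widen (p : pts k) :
  bdry (widen_pt p) = bdry p + (if p is inl _ then 0 else 2).
Proof. by case: p => i /=; have := ltn_ord i; lia. Qed.

Lemma bdry_lt (p : pts k) : if p is inl _ then bdry p < k else k <= bdry p.
Proof. by case: p => i /=; have := ltn_ord i; lia. Qed.

Lemma bdry_widen_lt (p q : pts k) : (bdry (widen_pt p) < bdry (widen_pt q)) = (bdry p < bdry q).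
Proof.
by have := bdry_lt p; have := bdry_lt q; rewrite !bdry_widen; case: p; case: q; lia.
Qed.

Lemma add_strand_motzkin x : is_motzkin x -> is_motzkin (add_strand x).
Proof.
case/is_motzkinP=> xK nc; apply/is_motzkinP; split.
  by case/ptsP=> [p||]; rewrite !(add_strand_widen, add_strand_top, add_strand_bot) ?xK.
case/ptsP=> [p||] q.
- rewrite add_strand_widen; case: (ptsP q) => [{}q||].
  + by rewrite add_strand_widen !bdry_widen_lt; apply: nc.
  + rewrite add_strand_top !bdry_widen /=; have := bdry_lt (x p); case: (x p); lia.
  + rewrite add_strand_bot /=; lia.
- rewrite add_strand_top /=; lia.
- by rewrite add_strand_bot /=; lia.
Qed.

Lemma strip_strand (d : {ffun pts k.+1 -> pts k.+1}) : is_motzkin d ->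
  vertical d ord_max -> exists2 x, is_motzkin x & d = add_strand x.
Proof.
case/is_motzkinP=> dK nc /eqP dt; have db : d (inr ord_max) = inl ord_max by rewrite -dt dK.
have dw p : exists q, d (widen_pt p) = widen_pt q.
  case E: _ / (ptsP (d (widen_pt p))) => [q||]; first by exists q.
  - by have := dK (widen_pt p); rewrite E dt; case: p {E} => i //= -[E']; have := ltn_ord i; lia.
  - by have := dK (widen_pt p); rewrite E db; case: p {E} => i //= -[E']; have := ltn_ord i; lia.
have [y yE] : exists y : {ffun pts k -> pts k}, forall p, d (widen_pt p) = widen_pt (y p).
  exists [ffun p => odflt p [pick q | d (widen_pt p) == widen_pt q]] => p.
  rewrite ffunE; case: pickP => [q /eqP //|no]; have [q E] := dw p.
  by have := no q; rewrite E eqxx.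
exists y.
  apply/is_motzkinP; split=> [p|p q]; first by apply: widen_pt_inj; rewrite -!yE dK.
  by rewrite -!bdry_widen_lt -!yE; apply: nc.
by apply/ffunP; case/ptsP=> [p||]; rewrite ?add_strand_widen ?add_strand_top ?add_strand_bot.
Qed.

Lemma add_strand_ext x (d : {ffun pts k.+1 -> pts k.+1}) :
  (forall p, d (widen_pt p) = widen_pt (x p)) ->
  d (inl ord_max) = inr ord_max -> d (inr ord_max) = inl ord_max -> add_strand x = d.
Proof.
move=> dw dt db; apply/ffunP; case/ptsP=> [p||];
by rewrite ?add_strand_widen ?add_strand_top ?add_strand_bot.
Qed.

Lemma widen_eq i j : (widen i == widen j) = (i == j).
Proof. by rewrite -!val_eqE. Qed.

Lemma max_widen i : (ord_max == widen i) = false.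
Proof. by rewrite -val_eqE /=; have := ltn_ord i; lia. Qed.

Lemma add_strand_e a b : add_strand (e_diag a b) = e_diag (widen a) (widen b).
Proof.
apply: add_strand_ext => [[i|i]||]; rewrite !ffunE /= ?widen_eq ?max_widen //;
by do 2?case: ifP.
Qed.

Lemma add_strand_l a b : add_strand (l_diag a b) = l_diag (widen a) (widen b).
Proof.
apply: add_strand_ext => [[i|i]||]; rewrite !ffunE /= ?widen_eq ?max_widen //;
by do 2?case: ifP.
Qed.

Lemma add_strand_reflect x : add_strand (reflect_diag x) = reflect_diag (add_strand x).
Proof.
have fw p : flip (widen_pt p) = widen_pt (flip p) :> pts k.+1 by case: p.
apply: add_strand_ext => [p||].
- by rewrite ffunE fw add_strand_widen fw [in RHS]ffunE.
- by rewrite ffunE /= add_strand_bot.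
- by rewrite ffunE /= add_strand_top.
Qed.

Lemma add_strand_id : add_strand (id_diag k) = id_diag k.+1.
Proof. by apply: add_strand_ext => [[i|i]||]; rewrite !ffunE. Qed.

Lemma vertical_add_strand x i : vertical (add_strand x) (widen i) = vertical x i.
Proof.
rewrite /vertical (add_strand_widen x (inl i)) -[inr (widen i)]/(widen_pt (inr i)).
by rewrite (inj_eq widen_pt_inj).
Qed.

Lemma vertical_add_strand_max x : vertical (add_strand x) ord_max.
Proof. by rewrite /vertical add_strand_top. Qed.

End AddStrand.

(** * Compression of a diagram between two isolated points *)

Section Compress.
Variables (k : nat) (d : {ffun pts k -> pts k}) (m : 'I_k).
Hypotheses (md : is_motzkin d) (vd : forall i : 'I_k, m < i -> vertical d i).

Definition at_m (p : pts k) := (p == inl m) || (p == inr m).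

(** Between two copies of [q_diag m], which force the colour [false] at [m], the diagram [d] cannot
    be told from one where the strand [m] is vertical and the former partners of its ends are
    isolated. *)
Definition compress : {ffun pts k -> pts k} :=
  [ffun p => if at_m p then flip p else if at_m (d p) then p else d p].

Let dK : involutive d := motzkin_inv md.

Lemma at_m_flip p : at_m (flip p) = at_m p.
Proof. by case: p => i; rewrite /at_m /= orbC. Qed.

Lemma compressK : involutive compress.
Proof.
move=> p; rewrite !ffunE; have [pm|pm] := boolP (at_m p).
  by rewrite at_m_flip pm flipK.
have [dpm|dpm] := boolP (at_m (d p)); first by rewrite (negPf pm) dpm.
by rewrite (negPf dpm) dK (negPf pm).
Qed.

Lemma compress_vertical (i : 'I_k) : m <= i -> vertical compress i.
Proof.
rewrite leq_eqVlt => /orP[/eqP/ord_inj <-|mi].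
  by rewrite /vertical ffunE /at_m eqxx.
have /eqP di := vd mi; rewrite /vertical ffunE di /at_m.
have im : i != m by rewrite -val_eqE /=; lia.
rewrite -[inl i == inl m]/(i == m) -[inr i == inr m]/(i == m) (negPf im).
by [].
Qed.

Lemma compress_motzkin : is_motzkin compress.
Proof.
have [_ nc] := is_motzkinP _ md.
(* Clockwise between [inl m] and [inr m] lie only points right of [m], all on vertical strands; so
   no string crosses the new one. *)
have bin p : (m < bdry p) && (bdry p < bdry (inr m)) ->
    (m < bdry (compress p)) && (bdry (compress p) < bdry (inr m)).
  have inside (i : 'I_k) : (m < bdry (inl i : pts k)) && (bdry (inl i : pts k) < bdry (inr m)) =
      (m < i) by rewrite /=; have := ltn_ord i; have := ltn_ord m; lia.
  have inside' (i : 'I_k) : (m < bdry (inr i : pts k)) && (bdry (inr i : pts k) < bdry (inr m)) =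
      (m < i) by rewrite /=; have := ltn_ord i; have := ltn_ord m; lia.
  case: p => i; rewrite ?inside ?inside' => mi; have /eqP ci := compress_vertical (ltnW mi).
    by rewrite ci inside'.
  by rewrite -ci compressK inside.
have cm : compress (inl m) = inr m by apply/eqP/compress_vertical.
have cm' : compress (inr m) = inl m by rewrite -cm compressK.
apply/is_motzkinP; split; first exact: compressK.
move=> p q pq qp pq'.
have [/orP[]/eqP pE|pm] := boolP (at_m p).
- move: pq qp pq'; rewrite pE cm => pq qp pq'.
  by have := bin q; rewrite pq qp => /(_ isT)/andP[_]; lia.
- by move: pq qp; rewrite pE cm' /=; have := ltn_ord m; lia.
have [/orP[]/eqP qE|qm] := boolP (at_m q).
- move: pq qp pq'; rewrite qE cm => pq qp pq'.
  by have := bin (compress p); rewrite qp pq' compressK => /(_ isT)/andP[]; move: pq; rewrite /=; lia.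
- by move: pq' qp; rewrite qE cm' /=; have := bdry_inj; have := ltn_ord m; lia.
move: qp pq'; rewrite !ffunE (negPf pm) (negPf qm).
case: ifP => _; first by lia.
case: ifP => _; first by lia.
exact: nc.
Qed.

Lemma act_compress F A :
  act (q_diag m) (act d (act (q_diag m) F)) A = act compress (act (q_diag m) F) A.
Proof.
rewrite act_q /act big_distrr; apply: eq_bigr => B _ /=; rewrite -!/(act _ _ _) act_q.
case Bm: (B m); rewrite ?(mul0n, muln0) // mul1n mulnA mulnb; congr (nat_of_bool _ * _).
have colm p : ~~ A m -> at_m p -> colr A B p = false.
  by move=> /negPf Am /orP[]/eqP ->.
apply/andP/forallP => [[Am /forallP t] p|t].
  rewrite ffunE; have [pm|pm] := boolP (at_m p).
    by rewrite !colm ?at_m_flip // implybT.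
  have := t p; have [dpm|dpm] := boolP (at_m (d p)); last by [].
  by rewrite colm // eqxx => /andP[/eqP <- _]; rewrite /= implybT.
have Am : ~~ A m.
  by have := t (inl m); rewrite (eqP (compress_vertical (leqnn m))) /= Bm; case: (A m).
split=> //; apply/forallP=> p.
have [pm|pm] := boolP (at_m p).
  rewrite (colm p) // implybT andbT; have [dpm|dpm] := boolP (at_m (d p)).
    by rewrite colm.
  have := t (d p); rewrite ffunE (negPf dpm) dK pm !eqxx /= => H.
  by rewrite (negPf H).
have := t p; rewrite ffunE (negPf pm); have [dpm|//] := boolP (at_m (d p)).
rewrite !eqxx (colm (d p)) //= => /negPf ->; by rewrite eqxx implybT.
Qed.

End Compress.

(** * Motzkin algebras *)

From mathcomp Require Import all_order all_algebra ring.

Import Order.TTheory GRing.Theory Num.Theory.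

Local Open Scope ring_scope.

(* Unfolding diagrams in conversion checks between elements of [motz] is
   prohibitively slow. *)
#[local] Opaque kappa compose cl_loops is_motzkin.

(** [D] does not enter the underlying space; as a parameter of the type it selects the product. *)
Definition motz (C : numClosedFieldType) (D : C) (N : nat) : Type :=
  {ffun motzkin N -> C^o}.
HB.instance Definition _ (C : numClosedFieldType) (D : C) (N : nat) :=
  GRing.Lmodule.copy (motz D N) {ffun motzkin N -> C^o}.

Section Ring.
Variables (C : numClosedFieldType) (D : C) (N : nat).
Local Notation motz := (motz D N).

Implicit Types (x y z : motz) (d : motzkin N) (f g : {ffun pts N -> pts N}).

Definition coef x d : C := (x : {ffun motzkin N -> C^o}) d.
Definition bas f : motz := [ffun d : motzkin N => (val d == f)%:R : C^o].

Lemma motzP x y : coef x =1 coef y -> x = y.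
Proof. by move=> xy; apply/ffunP. Qed.

Lemma coefD x y d : coef (x + y) d = coef x d + coef y d.
Proof. by rewrite /coef ffunE. Qed.
Lemma coefZ a x d : coef (a *: x) d = a * coef x d.
Proof. by rewrite /coef ffunE. Qed.
Lemma coef0 d : coef 0 d = 0.
Proof. by rewrite /coef ffunE. Qed.
Lemma coef_bas f d : coef (bas f) d = (val d == f)%:R.
Proof. by rewrite /coef ffunE. Qed.
Lemma coef_sum (I : finType) (F : I -> motz) d : coef (\sum_i F i) d = \sum_i coef (F i) d.
Proof. by apply: (big_morph (coef^~ d) (fun u v => coefD u v d) (coef0 d)). Qed.

#[local] Opaque coef bas.
#[local] Arguments coef : simpl never.
#[local] Arguments bas : simpl never.

Lemma expand x : x = \sum_d coef x d *: bas (val d).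
Proof.
apply: motzP => d; rewrite coef_sum (bigD1 d) //= coefZ coef_bas eqxx mulr1.
rewrite big1 ?addr0 // => d' d'd.
by rewrite coefZ coef_bas (inj_eq val_inj) eq_sym (negPf d'd) mulr0.
Qed.

Definition mul_bas (d d' : motzkin N) : motz :=
  D ^+ kappa (val d) (val d') *: bas (compose (val d) (val d')).

Definition mul x y : motz := \sum_d \sum_d' (coef x d * coef y d') *: mul_bas d d'.

Lemma mulDl : left_distributive mul +%R.
Proof.
move=> x y z; rewrite -big_split; apply: eq_bigr => d _; rewrite -big_split; apply: eq_bigr => d' _.
by rewrite /= coefD mulrDl scalerDl.
Qed.

Lemma mulDr : right_distributive mul +%R.
Proof.
move=> x y z; rewrite -big_split; apply: eq_bigr => d _; rewrite -big_split; apply: eq_bigr => d' _.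
by rewrite /= coefD mulrDr scalerDl.
Qed.

Lemma mulZl a x y : mul (a *: x) y = a *: mul x y.
Proof.
rewrite /mul scaler_sumr; apply: eq_bigr => d _; rewrite scaler_sumr; apply: eq_bigr => d' _.
by rewrite coefZ -mulrA -scalerA.
Qed.

Lemma mulZr a x y : mul x (a *: y) = a *: mul x y.
Proof.
rewrite /mul scaler_sumr; apply: eq_bigr => d _; rewrite scaler_sumr; apply: eq_bigr => d' _.
by rewrite coefZ mulrCA (scalerA a).
Qed.

Lemma mul_0l x : mul 0 x = 0.
Proof. by have := mulZl 0 0 x; rewrite !scale0r. Qed.
Lemma mul_0r x : mul x 0 = 0.
Proof. by have := mulZr 0 x 0; rewrite !scale0r. Qed.

Lemma mul_basE d d' : mul (bas (val d)) (bas (val d')) = mul_bas d d'.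
Proof.
have cE (c c' : motzkin N) : coef (bas (val c)) c' = (c' == c)%:R.
  by rewrite coef_bas (inj_eq val_inj).
rewrite /mul (bigD1 d isT) /= (bigD1 d' isT) /= !cE !eqxx mulr1 scale1r.
rewrite [X in _ + X]big1 => [|d'' /negPf nd]; last first.
  by apply: big1 => d3 _; rewrite cE nd mul0r scale0r.
rewrite addr0 [X in _ + X]big1 ?addr0 // => d'' /negPf nd.
by rewrite cE nd mulr0 scale0r.
Qed.

#[local] Opaque mul mul_bas.

Lemma mul_bas2 f g : is_motzkin f -> is_motzkin g ->
  mul (bas f) (bas g) = D ^+ kappa f g *: bas (compose f g).
Proof. by move=> mf mg; exact: (mul_basE (Sub f mf) (Sub g mg)). Qed.

Lemma motzkin_val d : is_motzkin (val d).
Proof. exact: valP d. Qed.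
#[local] Hint Resolve motzkin_val : core.

Lemma motzkin_val_inv d : involutive (val d).
Proof. exact: motzkin_inv. Qed.
#[local] Hint Resolve motzkin_val_inv : core.

Lemma motz_ind (P : motz -> Prop) : P 0 -> (forall x y, P x -> P y -> P (x + y)) ->
  (forall a x, P x -> P (a *: x)) -> (forall f, is_motzkin f -> P (bas f)) -> forall x, P x.
Proof. by move=> P0 PD PZ Pb x; rewrite (expand x); elim/big_ind: _ => // d _; apply/PZ/Pb. Qed.

Lemma mulA : associative mul.
Proof.
move=> x y z; elim/motz_ind: x => [|x x' IH IH'|a x IH|f mf].
- by rewrite !mul_0l.
- by rewrite !mulDl IH IH'.
- by rewrite !mulZl IH.
elim/motz_ind: y => [|y y' IH IH'|a y IH|g mg].
- by rewrite !(mul_0l, mul_0r).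
- by rewrite !(mulDl, mulDr) IH IH'.
- by rewrite !(mulZl, mulZr) IH.
elim/motz_ind: z => [|z z' IH IH'|a z IH|h mh].
- by rewrite !mul_0r.
- by rewrite !mulDr IH IH'.
- by rewrite !mulZr IH.
have [] := compose_assoc (motzkin_inv mf) (motzkin_inv mg) (motzkin_inv mh).
rewrite (mul_bas2 mf mg) (mul_bas2 mg mh) mulZl mulZr.
rewrite (mul_bas2 (compose_motzkin mf mg) mh) (mul_bas2 mf (compose_motzkin mg mh)).
rewrite !scalerA -!exprD.
by move=> -> ->.
Qed.

Lemma mul_id_l : left_id (bas (id_diag N)) mul.
Proof.
move=> x; elim/motz_ind: x => [|x x' IH IH'|a x IH|f mf].
- by rewrite mul_0r.
- by rewrite mulDr IH IH'.
- by rewrite mulZr IH.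
have [[cE kE] _] := compose_id (motzkin_inv mf).
by rewrite mul_bas2 ?id_motzkin // kE cE expr0 scale1r.
Qed.

Lemma mul_id_r : right_id (bas (id_diag N)) mul.
Proof.
move=> x; elim/motz_ind: x => [|x x' IH IH'|a x IH|f mf].
- by rewrite mul_0l.
- by rewrite mulDl IH IH'.
- by rewrite mulZl IH.
have [_ [cE kE]] := compose_id (motzkin_inv mf).
by rewrite mul_bas2 ?id_motzkin // kE cE expr0 scale1r.
Qed.

Lemma one_neq0 : bas (id_diag N) != 0.
Proof.
apply/eqP => /(congr1 (coef^~ (Sub (id_diag N) (id_motzkin N)))).
by rewrite coef0 coef_bas eqxx => /eqP; rewrite oner_eq0.
Qed.

HB.instance Definition _ := GRing.Zmodule_isNzRing.Build motz
  mulA mul_id_l mul_id_r mulDl mulDr one_neq0.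
HB.instance Definition _ := GRing.Lmodule_isLalgebra.Build C motz (fun a x y => esym (mulZl a x y)).
HB.instance Definition _ := GRing.Lalgebra_isAlgebra.Build C motz (fun a x y => esym (mulZr a x y)).

Lemma mulbE f g : is_motzkin f -> is_motzkin g ->
  bas f * bas g = D ^+ kappa f g *: bas (compose f g) :> motz.
Proof. exact: mul_bas2. Qed.

Lemma one_bas : 1 = bas (id_diag N) :> motz.
Proof. by []. Qed.

Definition star x : motz := \sum_d (coef x d)^* *: bas (reflect_diag (val d)).

Lemma starD x y : star (x + y) = star x + star y.
Proof.
rewrite -big_split; apply: eq_bigr => d _.
by rewrite /= coefD rmorphD scalerDl.
Qed.

Lemma starZ a x : star (a *: x) = a^* *: star x.
Proof. by rewrite scaler_sumr; apply: eq_bigr => d _; rewrite coefZ rmorphM scalerA. Qed.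

Lemma star0 : star 0 = 0.
Proof. by have := starZ 0 0; rewrite rmorph0 !scale0r. Qed.

Lemma star_bas f : is_motzkin f -> star (bas f) = bas (reflect_diag f).
Proof.
move=> mf; rewrite /star (bigD1 (Sub f mf)) //= coef_bas eqxx rmorph1 scale1r big1 ?addr0 // => d.
by rewrite coef_bas -(inj_eq val_inj) => /negPf ->; rewrite rmorph0 scale0r.
Qed.

Lemma starK : involutive star.
Proof.
move=> x; elim/motz_ind: x => [|x x' IH IH'|a x IH|f mf].
- by rewrite !star0.
- by rewrite !starD IH IH'.
- by rewrite !starZ IH conjCK.
- by rewrite star_bas // star_bas ?reflectK // reflect_motzkin.
Qed.

Lemma star1 : star 1 = 1.
Proof.
rewrite one_bas star_bas ?id_motzkin //; congr bas.
by apply/ffunP=> -[i|i]; rewrite !ffunE.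
Qed.

Definition tr x : C := \sum_d coef x d * (D ^+ cl_loops (val d) / D ^+ N).

Lemma trD x y : tr (x + y) = tr x + tr y.
Proof. by rewrite -big_split; apply: eq_bigr => d _; rewrite coefD mulrDl. Qed.

Lemma trZ a x : tr (a *: x) = a * tr x.
Proof. by rewrite mulr_sumr; apply: eq_bigr => d _; rewrite coefZ -mulrA. Qed.

Lemma tr0 : tr 0 = 0.
Proof. by have := trZ 0 0; rewrite scale0r mul0r. Qed.

Lemma tr_bas f : is_motzkin f -> tr (bas f) = D ^+ cl_loops f / D ^+ N.
Proof.
move=> mf; rewrite /tr (bigD1 (Sub f mf)) //= coef_bas eqxx mul1r big1 ?addr0 // => d.
by rewrite coef_bas -(inj_eq val_inj) => /negPf ->; rewrite mul0r.
Qed.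

Lemma trC x y : tr (x * y) = tr (y * x).
Proof.
elim/motz_ind: x => [|x x' IH IH'|a x IH|f mf].
- by rewrite mul0r mulr0.
- by rewrite mulrDl mulrDr !trD IH IH'.
- by rewrite -scalerAl -scalerAr !trZ IH.
elim/motz_ind: y => [|y y' IH IH'|a y IH|g mg].
- by rewrite mul0r mulr0.
- by rewrite mulrDl mulrDr !trD IH IH'.
- by rewrite -scalerAl -scalerAr !trZ IH.
rewrite (mulbE mf mg) (mulbE mg mf) !trZ (tr_bas (compose_motzkin mf mg)).
rewrite (tr_bas (compose_motzkin mg mf)) !mulrA -!exprD.
by rewrite (cl_loops_compose (motzkin_inv mf) (motzkin_inv mg)).
Qed.

Hypothesis D_real : D^* = D.

Lemma starM x y : star (x * y) = star y * star x.
Proof.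
elim/motz_ind: x => [|x x' IH IH'|a x IH|f mf].
- by rewrite !(mul0r, mulr0, star0).
- by rewrite mulrDl !starD mulrDr IH IH'.
- by rewrite -scalerAl !starZ -scalerAr IH.
elim/motz_ind: y => [|y y' IH IH'|a y IH|g mg].
- by rewrite !(mul0r, mulr0, star0).
- by rewrite mulrDr !starD mulrDl IH IH'.
- by rewrite -scalerAr !starZ -scalerAl IH.
have [cE kE] := reflect_compose (motzkin_inv mf) (motzkin_inv mg).
rewrite (mulbE mf mg) starZ rmorphXn /= D_real (star_bas mf) (star_bas mg).
rewrite (star_bas (compose_motzkin mf mg)) (mulbE (reflect_motzkin mg) (reflect_motzkin mf)).
by rewrite -cE -kE.
Qed.

Lemma tr_star x : tr (star x) = (tr x)^*.
Proof.
elim/motz_ind: x => [|x x' IH IH'|a x IH|f mf].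
- by rewrite star0 tr0 rmorph0.
- by rewrite starD !trD rmorphD IH IH'.
- by rewrite starZ !trZ rmorphM IH.
rewrite star_bas // !tr_bas ?reflect_motzkin // cl_loops_reflect; last exact: motzkin_inv.
by rewrite rmorphM fmorphV !rmorphXn /= D_real.
Qed.

End Ring.

#[local] Opaque coef bas mul mul_bas star tr.

(** * Words in diagrams, and support on the first strands *)

Section Words.
Variables (C : numClosedFieldType) (D : C) (N : nat).
Local Notation motz := (motz D N).
Local Notation diag := {ffun pts N -> pts N}.
Implicit Types (x y : motz) (f g : diag).

Definition word (s : seq diag) : motz := foldr (fun f x => bas D f * x) 1 s.

Lemma wordP (s : seq diag) : all (@is_motzkin N) s -> exists c (f : diag),
  [/\ is_motzkin f, forall F A, foldr (fun g => act g) F s A = (2 ^ c * act f F A)%N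
    & word s = D ^+ c *: bas D f].
Proof.
elim: s => [_|g s IH /= /andP[mg /IH[c [f [mf actE wE]]]]].
  exists 0%N, (id_diag N); split; first exact: id_motzkin.
    move=> F A; rewrite /= mul1n /act (bigD1 A) //= tens_id eqxx mul1n big1 ?addn0 // => B.
    by rewrite tens_id eq_sym => /negPf ->.
  by rewrite expr0 scale1r.
exists (c + kappa g f)%N, (compose g f); split; first exact: compose_motzkin.
  move=> F A; rewrite (act_ext g A (actE F)) expnD -mulnA.
  rewrite -(act_compose F A (motzkin_inv mg) (motzkin_inv mf)) /act big_distrr /=.
  by apply: eq_bigr => B _; rewrite mulnCA.
by rewrite wE -scalerAr (mulbE D mg mf) scalerA -exprD.
Qed.

(** The number 2 is only a probe: by [act_inj] an identity of actions determines the diagram and the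
    exponent, so 2 may be replaced by [D]. *)
Lemma word_eq c c' (s s' : seq diag) :
  all (@is_motzkin N) s -> all (@is_motzkin N) s' ->
  (forall F A, 2 ^ c * foldr (fun g => act g) F s A =
               2 ^ c' * foldr (fun g => act g) F s' A)%N ->
  D ^+ c *: word s = D ^+ c' *: word s'.
Proof.
move=> /wordP[d [f [mf fE ->]]] /wordP[d' [f' [mf' f'E ->]]] H.
have H' F A : (2 ^ (c + d) * act f F A = 2 ^ (c' + d') * act f' F A)%N.
  by rewrite !expnD -!mulnA -fE -f'E H.
have [ff' cc'] := act_inj (motzkin_inv mf) (motzkin_inv mf') H'.
by rewrite !scalerA -!exprD cc' ff'.
Qed.

Lemma word_eq0 (s s' : seq diag) :
  all (@is_motzkin N) s -> all (@is_motzkin N) s' ->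
  (forall F A, foldr (fun g => act g) F s A = foldr (fun g => act g) F s' A) ->
  word s = word s'.
Proof.
move=> ms ms' H; have := @word_eq 0 0 _ _ ms ms'; rewrite expr0 !scale1r; apply.
by move=> F A; rewrite H.
Qed.

(* Membership in the image of the algebra on the first [m] strands. *)
Definition supp m x : Prop :=
  forall d : motzkin N, coef x d != 0 -> forall i : 'I_N, (m <= i)%N -> vertical (val d) i.

Lemma supp_bas m f : is_motzkin f -> (forall i : 'I_N, (m <= i)%N -> vertical f i) ->
  supp m (bas D f).
Proof. by move=> mf vf d; rewrite coef_bas; have [-> //|_] := eqVneq (val d) f; rewrite eqxx. Qed.

Lemma supp0 m : supp m 0.
Proof. by move=> d; rewrite coef0 eqxx. Qed.

Lemma suppD m x y : supp m x -> supp m y -> supp m (x + y).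
Proof.
move=> sx sy d; rewrite coefD; have [->|/sx //] := eqVneq (coef x d) 0.
by rewrite add0r; apply: sy.
Qed.

Lemma suppZ m a x : supp m x -> supp m (a *: x).
Proof.
move=> sx d; rewrite coefZ => cx; apply: sx; apply: contraNneq cx => ->.
by rewrite mulr0.
Qed.

Lemma supp_ind m (P : motz -> Prop) : P 0 -> (forall x y, P x -> P y -> P (x + y)) ->
  (forall a x, P x -> P (a *: x)) ->
  (forall f, is_motzkin f -> (forall i : 'I_N, (m <= i)%N -> vertical f i) -> P (bas D f)) ->
  forall x, supp m x -> P x.
Proof.
move=> P0 PD PZ Pb x sx; rewrite (expand x); elim/big_ind: _ => // d _.
have [->|cx] := eqVneq (coef x d) 0; first by rewrite scale0r.
by apply: PZ; apply: Pb (motzkin_val d) _ => i; apply: sx.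
Qed.

Lemma suppM m x y : supp m x -> supp m y -> supp m (x * y).
Proof.
move=> sx sy; elim/supp_ind: x / sx => [|x x' IH IH'|a x IH|f mf vf].
- by rewrite mul0r; apply: supp0.
- by rewrite mulrDl; apply: suppD.
- by rewrite -scalerAl; apply: suppZ.
elim/supp_ind: y / sy => [|x x' IH IH'|a x IH|g mg vg].
- by rewrite mulr0; apply: supp0.
- by rewrite mulrDr; apply: suppD.
- by rewrite -scalerAr; apply: suppZ.
rewrite (mulbE D mf mg); apply: suppZ; apply: supp_bas (compose_motzkin mf mg) _ => i mi.
by apply: vertical_compose (vf i mi) (vg i mi); apply: motzkin_inv.
Qed.

Lemma supp1 m : supp m 1.
Proof. by apply: supp_bas (id_motzkin N) _ => i _; apply: vertical_id. Qed.

Lemma suppN m x : supp m x -> supp m (- x).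
Proof. by rewrite -scaleN1r; apply: suppZ. Qed.

Lemma supp_star m x : supp m x -> supp m (star x).
Proof.
elim/supp_ind: x / => [|x x' IH IH'|a x IH|f mf vf].
- by rewrite star0; apply: supp0.
- by rewrite starD; apply: suppD.
- by rewrite starZ; apply: suppZ.
rewrite (star_bas D mf); apply: supp_bas (reflect_motzkin mf) _ => i mi.
by apply: vertical_reflect (vf i mi); apply: motzkin_inv.
Qed.

Lemma supp_le m m' x : (m <= m')%N -> supp m x -> supp m' x.
Proof. by move=> mm' sx d cx i m'i; apply: (sx d cx); apply: leq_trans m'i. Qed.

End Words.

Section Gens.
Variables (C : numClosedFieldType) (D : C) (N' : nat).
Local Notation N := N'.+1.
Local Notation motz := (motz D N).
Implicit Types (x y : motz).

Definition gq i : motz := bas D (q_diag (inord i : 'I_N)).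
Definition ge i : motz := bas D (e_diag (inord i : 'I_N) (inord i.+1)).
Definition gl i : motz := bas D (l_diag (inord i : 'I_N) (inord i.+1)).
Definition gr i : motz := bas D (r_diag (inord i : 'I_N) (inord i.+1)).

Lemma inord_succ i : (i.+1 < N)%N -> (inord i.+1 : 'I_N) = (inord i : 'I_N).+1 :> nat.
Proof. by move=> iN; rewrite !inordK // ltnW. Qed.

Lemma inord_neq i j : (i < N)%N -> (j < N)%N -> i != j -> (inord i : 'I_N) != inord j.
Proof. by move=> iN jN; apply: contraNneq => /(congr1 val); rewrite /= !inordK // => ->. Qed.

Section Fixed.
Variables (i : nat) (iN : (i.+1 < N)%N).
Let a : 'I_N := inord i.
Let b : 'I_N := inord i.+1.
Let bE : b = a.+1 :> nat := inord_succ iN.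
Let ab : a != b. Proof. by apply: inord_neq => //; lia. Qed.

Let mq c : is_motzkin (q_diag c) := @q_motzkin N c.
Let me : is_motzkin (e_diag a b) := e_motzkin bE.
Let ml : is_motzkin (l_diag a b) := l_motzkin bE.
Let mr : is_motzkin (r_diag a b) := r_motzkin bE.

Ltac words s s' :=
  have := @word_eq0 C D N s s'; rewrite /word /= !mulr1 ?mq ?me ?ml ?mr => /(_ isT isT).

Lemma gee : ge i * ge i = D *: ge i.
Proof.
have := @word_eq C D N 0 1 [:: e_diag a b; e_diag a b] [:: e_diag a b].
rewrite /word /= !mulr1 me expr0 expr1 scale1r => /(_ isT isT); apply=> F A.
by rewrite mul1n act_ee.
Qed.

Lemma geqe : ge i * (gq i * ge i) = ge i.
Proof.
words [:: e_diag a b; q_diag a; e_diag a b] [:: e_diag a b]; apply=> F A.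
exact: act_eqe.
Qed.

Lemma geqqe : ge i * (gq i * (gq i.+1 * ge i)) = ge i.
Proof.
words [:: e_diag a b; q_diag a; q_diag b; e_diag a b] [:: e_diag a b]; apply=> F A.
exact: act_eqqe.
Qed.

Lemma gqqeqq : gq i * (gq i.+1 * (ge i * (gq i * gq i.+1))) = gq i * gq i.+1.
Proof.
words [:: q_diag a; q_diag b; e_diag a b; q_diag a; q_diag b] [:: q_diag a; q_diag b].
by apply=> F A; apply: act_qqeqq.
Qed.

Lemma gqe : gq i.+1 * ge i = gq i * ge i.
Proof.
words [:: q_diag b; e_diag a b] [:: q_diag a; e_diag a b]; apply=> F A.
exact: act_qe.
Qed.

Lemma glr : gl i * gr i = gq i.+1.
Proof. by words [:: l_diag a b; r_diag a b] [:: q_diag b]; apply=> F A; apply: act_lr. Qed.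

Lemma grl : gr i * gl i = gq i.
Proof. by words [:: r_diag a b; l_diag a b] [:: q_diag a]; apply=> F A; apply: act_rl. Qed.

Lemma grq : gr i * gq i.+1 = gr i.
Proof. by words [:: r_diag a b; q_diag b] [:: r_diag a b]; apply=> F A; apply: act_rq. Qed.

Lemma glq : gl i * gq i = gl i.
Proof. by words [:: l_diag a b; q_diag a] [:: l_diag a b]; apply=> F A; apply: act_lq. Qed.

Lemma geee : (i.+2 < N)%N -> ge i.+1 * (ge i * ge i.+1) = ge i.+1.
Proof.
move=> iN2; pose c : 'I_N := inord i.+2.
have me2 : is_motzkin (e_diag b c) by apply/e_motzkin/inord_succ.
have := @word_eq0 C D N [:: e_diag b c; e_diag a b; e_diag b c] [:: e_diag b c].
rewrite /word /= !mulr1 me me2 => /(_ isT isT); apply=> F A; apply: act_eee => //; apply: inord_neq; lia.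
Qed.

Lemma star_ge : star (ge i) = ge i.
Proof.
rewrite star_bas //; congr bas; apply/ffunP=> -[j|j]; rewrite !ffunE /=; by do 2?case: ifP.
Qed.

Lemma star_gl : star (gl i) = gr i.
Proof. by rewrite star_bas. Qed.

Lemma star_gr : star (gr i) = gl i.
Proof. by rewrite -star_gl starK. Qed.

Let commute_bas x (w : {ffun pts N -> pts N}) : is_motzkin w ->
  (forall f, is_motzkin f -> (forall j : 'I_N, (i <= j)%N -> vertical f j) ->
     forall F A, act f (act w F) A = act w (act f F) A) ->
  supp i x -> bas D w * x = x * bas D w.
Proof.
move=> mw H; elim/supp_ind: x / => [|x x' IH IH'|c x IH|f mf vf].
- by rewrite mul0r mulr0.
- by rewrite mulrDl mulrDr IH IH'.
- by rewrite -scalerAl -scalerAr IH.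
have := @word_eq0 C D N [:: w; f] [:: f; w]; rewrite /word /= !mulr1 mw mf => /(_ isT isT).
by apply=> F A; rewrite H.
Qed.

Let vab (f : {ffun pts N -> pts N}) : (forall j : 'I_N, (i <= j)%N -> vertical f j) ->
  f (inl a) = inr a /\ f (inl b) = inr b.
Proof. by move=> vf; split; apply/eqP/vf; rewrite /a /b inordK //; lia. Qed.

Lemma comm_ge x : supp i x -> ge i * x = x * ge i.
Proof.
apply: commute_bas => // f mf vf F A; have [fa fb] := vab vf.
by apply: act_vert_e => //; apply: motzkin_inv.
Qed.

Lemma comm_gl x : supp i x -> gl i * x = x * gl i.
Proof.
apply: commute_bas => // f mf vf F A; have [fa fb] := vab vf.
by apply: act_vert_l => //; apply: motzkin_inv.
Qed.

Lemma comm_gr x : supp i x -> gr i * x = x * gr i.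
Proof.
apply: commute_bas => // f mf vf F A; have [fa fb] := vab vf.
by apply: act_vert_r => //; apply: motzkin_inv.
Qed.

Let nle m j : (j < m)%N -> (j < N)%N -> forall k : 'I_N, (m <= k)%N -> k != inord j.
Proof. by move=> jm jN k mk; rewrite -val_eqE /= inordK //; lia. Qed.

Lemma supp_ge m : (i.+1 < m)%N -> supp m (ge i).
Proof.
by move=> im; apply: supp_bas => // k mk; apply: vertical_e; apply: (nle (m := m)) => //; lia.
Qed.

Lemma supp_gl m : (i.+1 < m)%N -> supp m (gl i).
Proof.
by move=> im; apply: supp_bas => // k mk; apply: vertical_l; apply: (nle (m := m)) => //; lia.
Qed.

Lemma supp_gr m : (i.+1 < m)%N -> supp m (gr i).
Proof. by move=> im; rewrite -star_gl; apply/supp_star/supp_gl. Qed.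

Hypothesis D0 : D != 0.

Lemma tr_ge x : supp i.+1 x -> tr (x * ge i) = D^-1 * tr x.
Proof.
elim/supp_ind: x / => [|x x' IH IH'|c x IH|f mf vf].
- by rewrite mul0r tr0 mulr0.
- by rewrite mulrDl !trD mulrDr IH IH'.
- by rewrite -scalerAl !trZ IH mulrCA.
rewrite (mulbE D mf me) trZ (tr_bas D (compose_motzkin mf me)) (tr_bas D mf) mulrA -exprD.
rewrite -(cl_loops_e ab (motzkin_inv mf) _); last by apply/eqP/vf; rewrite inordK.
by rewrite [X in _ = _ * (X / _)]exprS !mulrA mulVf ?mul1r.
Qed.

End Fixed.

Section FixedQ.
Variables (i : nat) (iN : (i < N)%N).
Let a : 'I_N := inord i.
Let mq : is_motzkin (q_diag a) := @q_motzkin N a.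

Lemma gqq : gq i * gq i = gq i.
Proof.
have := @word_eq0 C D N [:: q_diag a; q_diag a] [:: q_diag a].
rewrite /word /= !mulr1 !mq => /(_ isT isT); apply=> F A; exact: act_qq.
Qed.

Lemma star_gq : star (gq i) = gq i.
Proof.
rewrite star_bas //; congr bas; apply/ffunP=> -[j|j]; rewrite !ffunE /=; by case: ifP.
Qed.

Lemma comm_gq x : supp i x -> gq i * x = x * gq i.
Proof.
elim/supp_ind: x / => [|x x' IH IH'|c x IH|f mf vf].
- by rewrite mul0r mulr0.
- by rewrite mulrDl mulrDr IH IH'.
- by rewrite -scalerAl -scalerAr IH.
have := @word_eq0 C D N [:: q_diag a; f] [:: f; q_diag a].
rewrite /word /= !mulr1 mq mf => /(_ isT isT); apply=> F A /=.
apply/esym/act_vert_q.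
by apply/eqP/vf; rewrite inordK.
Qed.

Lemma supp_gq m : (i < m)%N -> supp m (gq i).
Proof.
move=> im; apply: supp_bas => // k mk; apply: vertical_q.
by rewrite -val_eqE /= inordK //; lia.
Qed.

Lemma compress_gq x : supp i.+1 x ->
  exists2 y, supp i y & gq i * (x * gq i) = y * gq i.
Proof.
elim/supp_ind: x / => [|x x' [y sy E] [y' sy' E']|c x [y sy E]|f mf vf].
- by exists 0; [apply: supp0 | rewrite !mul0r mulr0].
- by exists (y + y'); [apply: suppD | rewrite !mulrDl mulrDr E E'].
- by exists (c *: y); [apply: suppZ | rewrite -!scalerAl -scalerAr E].
have vf' (j : 'I_N) : (a < j)%N -> vertical f j by rewrite inordK //; apply: vf.
have mc := compress_motzkin mf vf'.
exists (bas D (compress f a)).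
  by apply: supp_bas => // j ij; apply: compress_vertical => //; rewrite inordK.
have := @word_eq0 C D N [:: q_diag a; f; q_diag a] [:: compress f a; q_diag a].
rewrite /word /= !mulr1 mq mf mc => /(_ isT isT); apply=> F A; exact: act_compress.
Qed.

Hypothesis D0 : D != 0.

Lemma tr_gq x : supp i x -> tr (x * gq i) = D^-1 * tr x.
Proof.
elim/supp_ind: x / => [|x x' IH IH'|c x IH|f mf vf].
- by rewrite mul0r tr0 mulr0.
- by rewrite mulrDl !trD mulrDr IH IH'.
- by rewrite -scalerAl !trZ IH mulrCA.
rewrite (mulbE D mf mq) trZ (tr_bas D (compose_motzkin mf mq)) (tr_bas D mf) mulrA -exprD.
rewrite -(cl_loops_q (motzkin_inv mf) (a := a)); last by apply/eqP/vf; rewrite inordK.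
by rewrite [X in _ = _ * (X / _)]exprS !mulrA mulVf ?mul1r.
Qed.

End FixedQ.

End Gens.

#[local] Opaque gq ge gl gr supp.

(* The part of the structure of the Motzkin algebra on [N] strands that the
   Jones-Wenzl argument uses; [ma_supp m x] says that all strands from the
   [m]-th on are vertical in [x], and [ma_q i] isolates the [i]-th points. *)
Record motzkin_alg (C : numClosedFieldType) (D : C) (N : nat) := MotzkinAlg {
  ma_car :> algType C;
  ma_star : ma_car -> ma_car;
  ma_tr : ma_car -> C;
  ma_supp : nat -> ma_car -> Prop;
  ma_q : nat -> ma_car;
  ma_e : nat -> ma_car;
  ma_l : nat -> ma_car;
  ma_r : nat -> ma_car;
  ma_starD : forall x y, ma_star (x + y) = ma_star x + ma_star y;
  ma_starZ : forall a x, ma_star (a *: x) = a^* *: ma_star x;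
  ma_starM : forall x y, ma_star (x * y) = ma_star y * ma_star x;
  ma_starK : involutive ma_star;
  ma_star1 : ma_star 1 = 1;
  ma_trD : forall x y, ma_tr (x + y) = ma_tr x + ma_tr y;
  ma_trZ : forall a x, ma_tr (a *: x) = a * ma_tr x;
  ma_trC : forall x y, ma_tr (x * y) = ma_tr (y * x);
  ma_tr_star : forall x, ma_tr (ma_star x) = (ma_tr x)^*;
  ma_supp1 : forall m, ma_supp m 1;
  ma_suppD : forall m x y, ma_supp m x -> ma_supp m y -> ma_supp m (x + y);
  ma_suppZ : forall m a x, ma_supp m x -> ma_supp m (a *: x);
  ma_suppM : forall m x y, ma_supp m x -> ma_supp m y -> ma_supp m (x * y);
  ma_supp_star : forall m x, ma_supp m x -> ma_supp m (ma_star x);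
  ma_supp_le : forall m m' x, (m <= m')%N -> ma_supp m x -> ma_supp m' x;
  ma_supp_q : forall i m, (i < N)%N -> (i < m)%N -> ma_supp m (ma_q i);
  ma_supp_e : forall i m, (i.+1 < N)%N -> (i.+1 < m)%N -> ma_supp m (ma_e i);
  ma_supp_r : forall i m, (i.+1 < N)%N -> (i.+1 < m)%N -> ma_supp m (ma_r i);
  ma_supp_l : forall i m, (i.+1 < N)%N -> (i.+1 < m)%N -> ma_supp m (ma_l i);
  ma_comm_q : forall i x, (i < N)%N -> ma_supp i x -> ma_q i * x = x * ma_q i;
  ma_comm_e : forall i x, (i.+1 < N)%N -> ma_supp i x -> ma_e i * x = x * ma_e i;
  ma_comm_r : forall i x, (i.+1 < N)%N -> ma_supp i x -> ma_r i * x = x * ma_r i;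
  ma_comm_l : forall i x, (i.+1 < N)%N -> ma_supp i x -> ma_l i * x = x * ma_l i;
  ma_star_q : forall i, (i < N)%N -> ma_star (ma_q i) = ma_q i;
  ma_star_e : forall i, (i.+1 < N)%N -> ma_star (ma_e i) = ma_e i;
  ma_star_r : forall i, (i.+1 < N)%N -> ma_star (ma_r i) = ma_l i;
  ma_qq : forall i, (i < N)%N -> ma_q i * ma_q i = ma_q i;
  ma_ee : forall i, (i.+1 < N)%N -> ma_e i * ma_e i = D *: ma_e i;
  ma_eqe : forall i, (i.+1 < N)%N -> ma_e i * (ma_q i * ma_e i) = ma_e i;
  ma_eqqe : forall i, (i.+1 < N)%N ->
    ma_e i * (ma_q i * (ma_q i.+1 * ma_e i)) = ma_e i;
  ma_qqeqq : forall i, (i.+1 < N)%N ->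
    ma_q i * (ma_q i.+1 * (ma_e i * (ma_q i * ma_q i.+1))) = ma_q i * ma_q i.+1;
  ma_qe : forall i, (i.+1 < N)%N -> ma_q i.+1 * ma_e i = ma_q i * ma_e i;
  ma_eee : forall i, (i.+2 < N)%N -> ma_e i.+1 * (ma_e i * ma_e i.+1) = ma_e i.+1;
  ma_lr : forall i, (i.+1 < N)%N -> ma_l i * ma_r i = ma_q i.+1;
  ma_rl : forall i, (i.+1 < N)%N -> ma_r i * ma_l i = ma_q i;
  ma_rq : forall i, (i.+1 < N)%N -> ma_r i * ma_q i.+1 = ma_r i;
  ma_lq : forall i, (i.+1 < N)%N -> ma_l i * ma_q i = ma_l i;
  ma_tr_q : forall i x, (i < N)%N -> ma_supp i x -> ma_tr (x * ma_q i) = D^-1 * ma_tr x;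
  ma_tr_e : forall i x, (i.+1 < N)%N -> ma_supp i.+1 x ->
    ma_tr (x * ma_e i) = D^-1 * ma_tr x;
  ma_compress : forall i x, (i < N)%N -> ma_supp i.+1 x ->
    exists2 y, ma_supp i y & ma_q i * (x * ma_q i) = y * ma_q i
}.

(** Closed by [Defined] so that the operations of the abstract structure compute to those of [motz]
    when the Jones-Wenzl argument is applied to projected vectors. *)
Definition motz_alg (C : numClosedFieldType) (D : C) (N' : nat)
  (D_real : D^* = D) (D0 : D != 0) : motzkin_alg D N'.+1.
Proof.
apply: (@MotzkinAlg C D N'.+1 (motz D N'.+1) (@star C D _) (@tr C D _) (@supp C D _)
  (gq D N') (ge D N') (gl D N') (gr D N')).
- exact: starD.
- exact: starZ.
- exact: starM.
- exact: starK.
- exact: star1.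
- exact: trD.
- exact: trZ.
- exact: trC.
- exact: tr_star.
- exact: supp1.
- exact: suppD.
- exact: suppZ.
- exact: suppM.
- exact: supp_star.
- exact: supp_le.
- by move=> i m iN; exact: supp_gq.
- by move=> i m iN; exact: supp_ge.
- by move=> i m iN; exact: supp_gr.
- by move=> i m iN; exact: supp_gl.
- by move=> i x iN; exact: comm_gq.
- by move=> i x iN; exact: comm_ge.
- by move=> i x iN; exact: comm_gr.
- by move=> i x iN; exact: comm_gl.
- by move=> *; exact: star_gq.
- exact: star_ge.
- exact: star_gr.
- by move=> *; exact: gqq.
- exact: gee.
- exact: geqe.
- exact: geqqe.
- exact: gqqeqq.
- exact: gqe.
- by move=> i iN; apply: geee => //; lia.
- exact: glr.
- exact: grl.
- exact: grq.
- exact: glq.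
- by move=> i x iN; exact: tr_gq.
- by move=> i x iN; exact: tr_ge.
- by move=> i x iN; exact: compress_gq.
Defined.

#[local] Transparent gq ge gl gr.

(** * Jones-Wenzl projections *)

Section JonesWenzl.
Variables (C : numClosedFieldType) (D : C) (N K : nat) (T : motzkin_alg D N).
Local Notation A := (ma_car T).
Implicit Types (x y z w : A).

Local Notation star := (@ma_star C D N T).
Local Notation tr := (@ma_tr C D N T).
Local Notation supp := (@ma_supp C D N T).
Local Notation q := (@ma_q C D N T).
Local Notation e := (@ma_e C D N T).
Local Notation l := (@ma_l C D N T).
Local Notation r := (@ma_r C D N T).

Lemma ma_starB x y : star (x - y) = star x - star y.
Proof. by rewrite -scaleN1r ma_starD ma_starZ rmorphN1 scaleN1r. Qed.

Lemma ma_suppN m x : supp m x -> supp m (- x).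
Proof. by rewrite -scaleN1r; apply: ma_suppZ. Qed.

Lemma ma_suppB m x y : supp m x -> supp m y -> supp m (x - y).
Proof. by move=> sx sy; apply: ma_suppD => //; apply: ma_suppN. Qed.

Lemma ma_supp0 m : supp m 0.
Proof. by rewrite -(scale0r 1); apply/ma_suppZ/ma_supp1. Qed.

Lemma ma_star0 : star 0 = 0.
Proof. by have := ma_starZ 0 (0 : A); rewrite rmorph0 !scale0r. Qed.

Lemma ma_trB x y : tr (x - y) = tr x - tr y.
Proof. by rewrite -scaleN1r ma_trD ma_trZ mulN1r. Qed.

(* For D = 2 cos theta + 1 and t > 0 this is sin ((t+1) theta) / sin (t theta);
   the value 0 at [t = 0] makes the corresponding inverse vanish. *)
Fixpoint jw_ratio (t : nat) : C :=
  if t is t'.+1 then D - 1 - (jw_ratio t')^-1 else 0.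
Local Notation g := jw_ratio.

(* The Jones-Wenzl projection on the [t] strands from [K] on, killed by all
   the [q]'s and [e]'s there. *)
Fixpoint jw (t : nat) : A :=
  if t is t'.+1 then
    jw t' * (1 - q (K + t')) - (g t')^-1 *: (jw t' * e (K + t').-1 * jw t')
  else 1.
Local Notation f := jw.

Definition jw_cup t : A := f t * e (K + t).-1 * f t.
Local Notation X := jw_cup.

Lemma jw_cupE t : X t = f t * e (K + t).-1 * f t.
Proof. by []. Qed.

Lemma jwS t : f t.+1 = f t * (1 - q (K + t)) - (g t)^-1 *: X t.
Proof. by []. Qed.

Lemma jw_ratio_real (D_real : D^* = D) t : (g t)^* = g t.
Proof. by elim: t => [|t IH] /=; rewrite ?rmorph0 // !rmorphB rmorph1 fmorphV /= IH D_real. Qed.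

Lemma jw_ratioV_real (D_real : D^* = D) t : ((g t)^-1)^* = (g t)^-1.
Proof. by rewrite fmorphV /= jw_ratio_real. Qed.

Lemma supp_jw t : (K + t <= N)%N -> supp (K + t) (f t).
Proof.
elim: t => [|t IH] Kt; first exact: ma_supp1.
have sf : supp (K + t.+1) (f t) by apply: ma_supp_le (IH _); lia.
have sq : supp (K + t.+1) (q (K + t)) by apply: ma_supp_q; lia.
rewrite jwS; apply: ma_suppD.
  by apply: ma_suppM => //; apply: ma_suppD; [apply: ma_supp1 | apply: ma_suppN].
apply: ma_suppN; case: t sf {IH sq} Kt => [|t] sf Kt; first by rewrite invr0 scale0r; apply: ma_supp0.
by apply: ma_suppZ; apply: ma_suppM => //; apply: ma_suppM => //; apply: ma_supp_e; lia.
Qed.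

Lemma jw_comm_q t i : (K + t <= i < N)%N -> q i * f t = f t * q i.
Proof. by case/andP=> ti iN; apply: ma_comm_q => //; apply: (ma_supp_le ti); apply: supp_jw; lia. Qed.

Lemma jw_comm_e t i : (K + t <= i)%N -> (i.+1 < N)%N -> e i * f t = f t * e i.
Proof. by move=> ti iN; apply: ma_comm_e => //; apply: (ma_supp_le ti); apply: supp_jw; lia. Qed.

Lemma jw_comm_r t i : (K + t <= i)%N -> (i.+1 < N)%N -> r i * f t = f t * r i.
Proof. by move=> ti iN; apply: ma_comm_r => //; apply: (ma_supp_le ti); apply: supp_jw; lia. Qed.

Lemma star_jw (D_real : D^* = D) t : (K + t <= N)%N -> star (f t) = f t.
Proof.
elim: t => [|t IH] Kt; first exact: ma_star1.
have {}IH : star (f t) = f t by apply: IH; lia.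
rewrite jwS ma_starB ma_starM ma_starB ma_star1 IH ma_star_q; last lia.
congr (_ - _); first by rewrite mulrBl mulrBr mul1r mulr1 jw_comm_q //; lia.
case: t IH Kt => [|t] IH Kt; first by rewrite invr0 !scale0r ma_star0.
rewrite /jw_cup ma_starZ (jw_ratioV_real D_real) !ma_starM IH ma_star_e ?mulrA //; lia.
Qed.

Lemma e_qS i : (i.+1 < N)%N -> e i * q i.+1 = e i * q i.
Proof.
move=> iN; have := congr1 star (ma_qe T iN).
by rewrite !ma_starM ma_star_e // !ma_star_q //; lia.
Qed.

(** Wenzl's induction. The last clause produces the recursion of [jw_ratio]: with [e] on the next
    two strands, [e * (1 - q) * e] is [D - 1] times [e], and in the cup term the Temperley-Lieb
    relation [ma_eee] removes the inner [e]. *)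
Lemma jw_props t : (K + t <= N)%N -> (forall u, (0 < u < t)%N -> g u != 0) ->
  [/\ f t * f t = f t,
      (0 < t)%N -> f t * f t.-1 = f t /\ f t.-1 * f t = f t,
      (0 < t)%N -> q (K + t).-1 * f t = 0 /\ f t * q (K + t).-1 = 0
    & (0 < t)%N -> (K + t < N)%N ->
      e (K + t).-1 * f t * e (K + t).-1 = g t *: (f t.-1 * e (K + t).-1)].
Proof.
elim: t => [|t IH] Kt gn; first by split=> //; rewrite mul1r.
have Kt' : (K + t < N)%N by lia.
have [||ff absorb kill efe] := IH; first by lia.
  by move=> u u_t; apply: gn; lia.
set s := q (K + t); set ft := f t.
have sf : s * ft = ft * s by rewrite jw_comm_q //; lia.
have ss : s * s = s by apply: ma_qq.
(* [q] slides from one leg of the cup to the other, where [f t] kills it. *)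
have sX : (0 < t)%N -> s * X t = 0.
  move=> t0; rewrite /jw_cup !mulrA -/ft sf -[_ * s * _]mulrA.
  have -> : s * e (K + t).-1 = q (K + t).-1 * e (K + t).-1.
    by rewrite /s -[in LHS](@prednK (K + t)) ?ma_qe //; lia.
  by rewrite mulrA (proj2 (kill t0)) !mul0r.
have Xs : (0 < t)%N -> X t * s = 0.
  move=> t0; rewrite /jw_cup -!mulrA -/ft -sf [_ * (s * _)]mulrA.
  have -> : e (K + t).-1 * s = e (K + t).-1 * q (K + t).-1.
    by rewrite /s -[in LHS](@prednK (K + t)) ?e_qS //; lia.
  by rewrite -mulrA (proj1 (kill t0)) !mulr0.
have fX : ft * X t = X t by rewrite /jw_cup !mulrA ff.
have Xf : X t * ft = X t by rewrite /jw_cup -!mulrA ff.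
have XX : (0 < t)%N -> X t * X t = g t *: X t.
  move=> t0; have -> : X t * X t = ft * (e (K + t).-1 * ft * e (K + t).-1) * ft.
    by rewrite /jw_cup -/ft -!mulrA [ft * (ft * _)]mulrA ff.
  rewrite (efe t0) // -scalerAr -scalerAl /jw_cup -/ft !mulrA.
  by rewrite (proj1 (absorb t0)).
set c := (g t)^-1; set B := c *: X t.
have B0 : t = 0%N -> B = 0 by rewrite /B /c => ->; rewrite invr0 scale0r.
have sB : s * B = 0.
  by have [/B0 ->|/sX sX0] := posnP t; [rewrite mulr0 | rewrite -scalerAr sX0 scaler0].
have Bs : B * s = 0.
  by have [/B0 ->|/Xs Xs0] := posnP t; [rewrite mul0r | rewrite -scalerAl Xs0 scaler0].
have fB : ft * B = B by rewrite -scalerAr fX.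
have Bf : B * ft = B by rewrite -scalerAl Xf.
have BB : B * B = B.
  have [/B0 ->|t0] := posnP t; first by rewrite mulr0.
  rewrite -scalerAr -scalerAl (XX t0) scalerA [_ *: (_ *: _)]scalerA -mulrA mulVf ?mulr1 //.
  by apply: gn; rewrite t0 ltnSn.
have fSE : f t.+1 = ft * (1 - s) - B by [].
have comm_1s : (1 - s) * ft = ft * (1 - s) by rewrite mulrBl mulrBr mul1r mulr1 sf.
have s1s : s * (1 - s) = 0 by rewrite mulrBr mulr1 ss subrr.
have s1s' : (1 - s) * s = 0 by rewrite mulrBl mul1r ss subrr.
have AA : ft * (1 - s) * (ft * (1 - s)) = ft * (1 - s).
  by rewrite mulrA -[ft * _ * ft]mulrA comm_1s mulrA ff -mulrA mulrBr mulr1 s1s' subr0.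
have AB : ft * (1 - s) * B = B.
  by rewrite -mulrA mulrBl mul1r sB subr0.
have BA : B * (ft * (1 - s)) = B.
  by rewrite mulrA Bf mulrBr mulr1 Bs subr0.
split=> [||_|_ KtN]; rewrite ?addnS ?succnK.
- rewrite !fSE; move: AA AB BA; set A := ft * (1 - s) => AA AB BA.
  by rewrite mulrBl !mulrBr AA AB BA BB subrr subr0.
- move=> _; rewrite fSE [(_ - B) * _]mulrBl [_ * (_ - B)]mulrBr Bf fB.
  by rewrite -mulrA comm_1s !mulrA ff.
- rewrite -/s fSE mulrBr mulrBl sB Bs !subr0 mulrA sf -!mulrA.
  by rewrite s1s s1s' !mulr0.
- set e' := e (K + t).
  have e'f : e' * ft = ft * e' by rewrite jw_comm_e //; lia.
  have KtN1 : ((K + t).+1 < N)%N by lia.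
  have e'se' : e' * s * e' = e' by rewrite -mulrA ma_eqe.
  rewrite fSE -/ft -/e' mulrBr mulrBl.
  have -> : e' * (ft * (1 - s)) * e' = (D - 1) *: (ft * e').
    rewrite mulrA e'f -!mulrA; have -> : e' * ((1 - s) * e') = (D - 1) *: e'.
      by rewrite mulrA mulrBr mulr1 mulrBl e'se' ma_ee // scalerBl scale1r.
    by rewrite -scalerAr.
  rewrite [g t.+1]/(D - 1 - c) [RHS]scalerBl; congr (_ - _).
  have [t0|t0] := posnP t; first by rewrite /B /c t0 invr0 !scale0r mulr0 mul0r.
  rewrite -scalerAr -scalerAl; congr (_ *: _).
  have eee : e' * (e (K + t).-1 * e') = e'.
    have := @ma_eee _ _ _ T (K + t).-1; rewrite prednK; last lia.
    by apply; lia.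
  have -> : e' * X t * e' = ft * (e' * (e (K + t).-1 * e')) * ft.
    by rewrite /jw_cup -/ft !mulrA e'f -!mulrA e'f.
  by rewrite eee -mulrA e'f mulrA ff.
Qed.

(** * Vectors commuting with the tail *)

(* [d] and its adjoint commute with [y] up to null vectors of the trace. *)
Definition cm y d : Prop :=
  (forall w, tr (w * (d * y)) = tr (w * (y * d))) /\
  (forall w, tr (w * (star d * y)) = tr (w * (y * star d))).

Lemma cm_star y d : cm y d -> cm y (star d).
Proof. by case=> h h'; split=> // w; rewrite ma_starK. Qed.

Let mulcm y d d' : (forall w, tr (w * (d * y)) = tr (w * (y * d))) ->
  (forall w, tr (w * (d' * y)) = tr (w * (y * d'))) ->
  forall w, tr (w * (d * d' * y)) = tr (w * (y * (d * d'))).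
Proof.
move=> h h' w; have -> : w * (d * d' * y) = w * d * (d' * y) by rewrite !mulrA.
rewrite h' mulrA ma_trC; have -> : d' * (w * d * y) = d' * w * (d * y) by rewrite !mulrA.
by rewrite h -mulrA ma_trC !mulrA.
Qed.

Lemma cmM y d d' : cm y d -> cm y d' -> cm y (d * d').
Proof. by case=> h1 h2 [h1' h2']; split; rewrite ?(ma_starM); apply: mulcm. Qed.

Lemma cmD y d d' : cm y d -> cm y d' -> cm y (d + d').
Proof.
by case=> h1 h2 [h1' h2']; split=> w; rewrite ?ma_starD !(mulrDl, mulrDr) !ma_trD ?h1 ?h2 ?h1' ?h2'.
Qed.

Lemma cmZ y a d : cm y d -> cm y (a *: d).
Proof.
by case=> h1 h2; split=> w; rewrite ?ma_starZ -!(scalerAl, scalerAr) !ma_trZ ?h1 ?h2.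
Qed.

Lemma cm1 y : cm y 1.
Proof. by split=> w; rewrite ?ma_star1 !(mul1r, mulr1). Qed.

Lemma cmB y d d' : cm y d -> cm y d' -> cm y (d - d').
Proof. by move=> h h'; rewrite -scaleN1r; apply: cmD => //; apply: cmZ. Qed.

Lemma cm_sub y y' d : cm y d -> cm y' d -> cm (y - y') d.
Proof.
by case=> h1 h2 [h1' h2']; split=> w; rewrite !(mulrBl, mulrBr) !ma_trB ?h1 ?h2 ?h1' ?h2'.
Qed.

Lemma cm_commute y d : d * y = y * d -> star d * y = y * star d -> cm y d.
Proof. by move=> h h'; split=> w; rewrite ?h ?h'. Qed.

(** The vector functional of [y]. By [psi_cyc] it behaves as a trace on elements commuting with [y],
    so it agrees on projections that are equivalent through such elements. *)
Definition vtrace y c : C := tr (star y * c * y).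
Local Notation psi := vtrace.

Lemma psiD y c d : psi y (c + d) = psi y c + psi y d.
Proof. by rewrite /vtrace mulrDr mulrDl ma_trD. Qed.

Lemma psiZ y a c : psi y (a *: c) = a * psi y c.
Proof. by rewrite /vtrace -scalerAr -scalerAl ma_trZ. Qed.

(** [cm] moves [d] from the left of [y] to its right, the trace brings it round to the left of
    [star y], and [cm] for the adjoint moves it past [star y]. *)
Lemma psi_cyc y c d : cm y d -> psi y (c * d) = psi y (d * c).
Proof.
case=> h h'; rewrite /psi.
have hs w : tr (w * (star y * d)) = tr (w * (d * star y)).
  rewrite ma_trC [RHS]ma_trC; have := congr1 Num.conj (h' (star w)).
  by rewrite -!ma_tr_star // !(ma_starM) !ma_starK.
have -> : star y * (c * d) * y = star y * c * (d * y) by rewrite !mulrA.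
rewrite h mulrA ma_trC; have -> : d * (star y * c * y) = d * star y * (c * y) by rewrite !mulrA.
by rewrite ma_trC -hs ma_trC !mulrA.
Qed.

Definition sqnorm x : C := tr (star x * x).
Local Notation nrm := sqnorm.

Lemma nrm_psi y c : star c = c -> c * c = c -> nrm (c * y) = psi y c.
Proof. by move=> sc cc; rewrite /sqnorm /vtrace (ma_starM) sc -mulrA [c * _]mulrA cc !mulrA. Qed.

Fixpoint q_prod a d : A := if d is d'.+1 then q a * q_prod a.+1 d' else 1.
Local Notation qs := q_prod.

Lemma supp_qs a d m : (a + d <= N)%N -> (a + d <= m)%N -> supp m (qs a d).
Proof.
elim: d a => [|d IH] a aN am /=; first exact: ma_supp1.
by apply: ma_suppM; [apply: ma_supp_q; lia | apply: IH; lia].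
Qed.

Lemma q_comm i j : (i < N)%N -> (j < N)%N -> q i * q j = q j * q i.
Proof.
wlog ij : i j / (i < j)%N.
  by move=> H iN jN; case: (ltngtP i j) => [ij|ij|-> //]; [|symmetry]; apply: H.
by move=> iN jN; rewrite (ma_comm_q jN) //; apply: ma_supp_q.
Qed.

Lemma q_qs i a d : (i < N)%N -> (a + d <= N)%N -> q i * qs a d = qs a d * q i.
Proof.
move=> iN; elim: d a => [|d IH] a aN /=; first by rewrite mulr1 mul1r.
by rewrite mulrA (q_comm iN) -?mulrA ?IH ?mulrA //; lia.
Qed.

Lemma qs_idem a d : (a + d <= N)%N -> qs a d * qs a d = qs a d.
Proof.
elim: d a => [|d IH] a aN /=; first by rewrite mulr1.
rewrite mulrA -[q a * _ * q a]mulrA -q_qs; [|lia|lia].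
by rewrite mulrA ma_qq ?[_ * _ * _]mulrA; [rewrite -mulrA IH //; lia | lia].
Qed.

Lemma star_qs a d : (a + d <= N)%N -> star (qs a d) = qs a d.
Proof.
elim: d a => [|d IH] a aN /=; first exact: ma_star1.
by rewrite ma_starM IH ?ma_star_q ?q_qs //; lia.
Qed.

Lemma qsSr a d : qs a d.+1 = qs a d * q (a + d).
Proof.
elim: d a => [|d IH] a; first by rewrite /= mul1r mulr1 addn0.
by rewrite -[LHS]/(q a * qs a.+1 d.+1) IH mulrA addSnnS.
Qed.

Lemma comm_qs x a d : supp a x -> (a + d <= N)%N -> x * qs a d = qs a d * x.
Proof.
elim: d a => [|d IH] a sx aN /=; first by rewrite mulr1 mul1r.
rewrite mulrA -ma_comm_q //; last lia.
by rewrite -mulrA IH ?mulrA //; [apply: ma_supp_le sx | lia].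
Qed.

Definition tail_comm m y : Prop :=
  forall i, (K <= i)%N -> (i.+1 < m)%N -> cm y (e i) /\ cm y (r i).

Lemma tail_comm_sub m y y' : tail_comm m y -> tail_comm m y' -> tail_comm m (y - y').
Proof.
by move=> h h' i Ki im; have [? ?] := h i Ki im; have [? ?] := h' i Ki im; split; apply: cm_sub.
Qed.

Lemma tail_comm_le m m' y : (m <= m')%N -> tail_comm m' y -> tail_comm m y.
Proof. by move=> mm' h i Ki im; apply: h => //; lia. Qed.

Section Tail.
Variables (m : nat) (y : A).
Hypotheses (mN : (m <= N)%N) (Km : (K.+1 < m)%N) (ty : tail_comm m y).

Lemma cm_e i : (K <= i)%N -> (i.+1 < m)%N -> cm y (e i).
Proof. by move=> Ki im; case: (ty Ki im). Qed.

Lemma cm_r i : (K <= i)%N -> (i.+1 < m)%N -> cm y (r i).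
Proof. by move=> Ki im; case: (ty Ki im). Qed.

Lemma cm_l i : (K <= i)%N -> (i.+1 < m)%N -> cm y (l i).
Proof. by move=> Ki im; rewrite -ma_star_r; [apply/cm_star/cm_r | lia]. Qed.

Lemma cm_q i : (K <= i)%N -> (i < m)%N -> cm y (q i).
Proof.
move=> Ki im; have [im1|im1] := ltnP i.+1 m.
  by rewrite -ma_rl; [apply: cmM; [apply: cm_r | apply: cm_l] | lia].
have -> : i = i.-1.+1 by lia.
by rewrite -ma_lr; [apply: cmM; [apply: cm_l | apply: cm_r]; lia | lia].
Qed.

Lemma cm_f t : (K + t <= m)%N -> cm y (f t).
Proof.
elim: t => [|t IH] tm; first exact: cm1.
have cf : cm y (f t) by apply: IH; lia.
rewrite jwS; apply: cmB.
  by apply: cmM => //; apply: cmB; [apply: cm1 | apply: cm_q; lia].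
case: t cf tm {IH} => [|t] cf tm; first by rewrite invr0 scale0r -(scale0r 1); apply/cmZ/cm1.
by apply: cmZ; apply: cmM => //; apply: cmM => //; apply: cm_e; lia.
Qed.

Lemma cm_qs a d : (K <= a)%N -> (a + d <= m)%N -> cm y (qs a d).
Proof.
elim: d a => [|d IH] a Ka am; first exact: cm1.
by apply: cmM; [apply: cm_q; lia | apply: IH; lia].
Qed.

(* [l i] and [r i] move the isolated point from [i] to [i + 1]. *)
Lemma psi_shift x a d : (K <= a)%N -> (a + d < m)%N ->
  (forall i, (a <= i < a + d)%N -> x * l i = l i * x) ->
  psi y (x * q a) = psi y (x * q (a + d)).
Proof.
move=> Ka; elim: d => [|d IH] am xl; first by rewrite addn0.
rewrite IH; [|lia|by move=> i ii; apply: xl; lia].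
have [adm Kad] : ((a + d).+1 < m)%N /\ (K <= a + d)%N by lia.
rewrite -(@ma_rl _ _ _ T (a + d)) ?addnS; last lia.
rewrite -(@ma_lr _ _ _ T (a + d)); last lia.
by rewrite mulrA psi_cyc ?mulrA -?xl //; [lia | apply: cm_l].
Qed.

(** [E * ss * E = E] and [ss * E * ss = ss], so up to scalars [E] and [ss] are projections
    equivalent through elements commuting with [y]. Cycling these replaces the cup by two isolated
    points, and the last clause of [jw_props] contributes [g t]. *)
Lemma psi_X t x : (0 < t)%N -> (K + t < m)%N -> (forall u, (0 < u < t)%N -> g u != 0) ->
  e (K + t).-1 * x = x * e (K + t).-1 -> f t * x = x * f t ->
  q (K + t).-1 * x = x * q (K + t).-1 -> q (K + t) * x = x * q (K + t) ->
  psi y (X t * x) = g t * psi y (f t.-1 * (q (K + t).-1 * q (K + t)) * x).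
Proof.
move=> t0 tm gn ex fx q1x q2x; have tN : (K + t <= N)%N by lia.
have [ff absorb _ efe] := jw_props tN gn.
have [ffl _] := absorb t0.
set E := e (K + t).-1 in ex efe *; set ss := q (K + t).-1 * q (K + t).
have cE : cm y E by apply: cm_e; lia.
have cf : cm y (f t) by apply: cm_f; lia.
have ct1 : ((K + t).-1.+1 = K + t)%N by lia.
have css : cm y ss by apply: cmM; apply: cm_q; lia.
have ssx : ss * x = x * ss by rewrite /ss -mulrA q2x mulrA q1x mulrA.
have EssE : E * ss * E = E.
  by have := @ma_eqqe _ _ _ T (K + t).-1; rewrite ct1 -/E /ss !mulrA; apply; lia.
have ssEss : ss * E * ss = ss.
  by have := @ma_qqeqq _ _ _ T (K + t).-1; rewrite ct1 -/E /ss !mulrA; apply; lia.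
have sf : ss * f t.-1 = f t.-1 * ss.
  by rewrite /ss -mulrA jw_comm_q ?mulrA ?jw_comm_q //; lia.
have ssss : ss * ss = ss.
  rewrite /ss mulrA -[_ * q (K + t).-1]mulrA -q_comm ?mulrA ?ma_qq -?mulrA ?ma_qq //; lia.
have XE : X t = f t * E * f t by [].
clearbody ss E.
have -> : X t * x = f t * E * (ss * E * f t * x).
  rewrite XE; have -> : f t * E * (ss * E * f t * x) = f t * (E * ss * E) * f t * x by rewrite !mulrA.
  by rewrite EssE.
rewrite -psi_cyc; last exact: cmM.
have -> : ss * E * f t * x * (f t * E) = ss * (E * f t * E) * x.
  by rewrite -!mulrA [x * (f t * E)]mulrA -fx -[f t * x * E]mulrA -ex !mulrA -[_ * f t * f t]mulrA ff.
rewrite efe //; last lia.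
rewrite -scalerAr -scalerAl psiZ; congr (_ * _).
have -> : ss * (f t.-1 * E) * x = ss * (f t.-1 * ss * E * x).
  by rewrite -sf !mulrA ssss.
rewrite -psi_cyc //.
have -> : f t.-1 * ss * E * x * ss = f t.-1 * (ss * E * ss) * x.
  by rewrite -!mulrA -ssx.
by rewrite ssEss.
Qed.

End Tail.

Section Collect.
Variables (m : nat) (y : A).
Hypotheses (mN : (m <= N)%N) (Km : (K.+1 < m)%N) (ty : tail_comm m y).

(** The isolated point at [u] is carried by shifts to [b], next to the block of isolated points
    starting at [b + 1]. *)
Lemma psi_collect x u b s : supp u x -> (K <= u <= b)%N -> (b.+1 + s <= m)%N ->
  psi y (x * q u * qs b.+1 s) = psi y (x * qs b s.+1).
Proof.
move=> sx /andP[Ku ub] bm.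
have qQ i : (i < N)%N -> x * (q i * qs b.+1 s) = x * qs b.+1 s * q i.
  by move=> iN; rewrite q_qs ?mulrA //; lia.
rewrite -mulrA [qs b _]/= !qQ; [|lia|lia].
have ubE : (u + (b - u) = b)%N by rewrite subnKC.
have := @psi_shift m y mN Km ty (x * qs b.+1 s) u (b - u) Ku.
rewrite ubE; apply=> [|i /andP[ui ib]]; first by lia.
rewrite -mulrA -comm_qs; [|apply: ma_supp_l; lia|lia].
by rewrite !mulrA ma_comm_l //; [lia | apply: ma_supp_le sx].
Qed.

End Collect.

(** * Path counts and the decomposition of the identity *)

Section Weights.
Variable n : nat.

(* The number of Motzkin paths of length [i] from 0 to [t] staying below [n]. *)
Fixpoint wt i t : nat :=
  if i is i'.+1 then
    if (t < n)%N then ((if t is t'.+1 then wt i' t' else 0) + wt i' t + wt i' t.+1)%N else 0%N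
  else (t == 0)%N.

Lemma wt_gt i t : (i < t)%N -> wt i t = 0%N.
Proof.
elim: i t => [|i IH] [|t] //= it; case: ifP => // _.
by rewrite !IH //; lia.
Qed.

Lemma wt_ge i t : (0 < n)%N -> (n <= t)%N -> wt i t = 0%N.
Proof. by move=> n0; case: i => [|i] nt /=; [rewrite eqn0Ngt; lia | rewrite ltnNge nt]. Qed.

(** A path to [t + 1] extends by a down step. Together with [wt_le0], this lets a weighted estimate
    pass to the next vector at the height below. *)
Lemma wt_le i t : (0 < n)%N -> (wt i t.+1 <= wt i.+1 t)%N.
Proof.
move=> n0 /=; have [tn|nt] := ltnP t n; first exact: leq_addl.
by rewrite wt_ge //; lia.
Qed.

Lemma wt_le0 i t : (0 < n)%N -> (wt i t <= wt i.+1 t)%N.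
Proof.
move=> n0 /=; have [tn|nt] := ltnP t n; last by rewrite wt_ge.
by rewrite -addnA addnCA leq_addr.
Qed.

(** The step operator of the paths is symmetric, so it moves from [P] to [w]; the boundary terms at
    [n] vanish by assumption. *)
Lemma sum_neighbours (w P : nat -> C) : (0 < n)%N -> w n = 0 -> P n = 0 ->
  \sum_(t < n) w t * (P t.+1 + P t + (if t : nat is t'.+1 then P t' else 0)) =
  \sum_(t < n) ((if t : nat is t'.+1 then w t' else 0) + w t + w t.+1) * P t.
Proof.
case: n => // n' _ wn Pn.
under eq_bigr do rewrite !mulrDr.
under [RHS]eq_bigr do rewrite !mulrDl.
rewrite !big_split /=; congr (_ + _ + _).
- by rewrite big_ord_recr [RHS]big_ord_recl /= Pn mulr0 mul0r addr0 add0r.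
- by rewrite big_ord_recl [RHS]big_ord_recr /= wn mulr0 mul0r addr0 add0r.
Qed.

End Weights.

Section Decomposition.
Variables (n j : nat) (y : A).
Hypotheses (n0 : (0 < n)%N) (j2 : (1 < j)%N) (KjN : (K + j <= N)%N).
Hypotheses (gn : forall u, (0 < u < n)%N -> g u != 0).
Hypotheses (ty : tail_comm (K + j) y) (fn0 : forall w, tr (w * f n) = 0).

(** Of [i] strands, [t] run through and the other [i - t] are isolated. The isolated points are
    parked at the far right, which leaves room for the next strand right after the first [t]; at
    [i = j] the two blocks are adjacent. *)
Let Phi i t := psi y (f t * qs (K + j - (i - t)) (i - t)).

(** [f t] splits into [f t.+1], [f t * q] and a multiple of [X t]: one more through string, one more
    isolated point, or one through string less. [psi_X] turns the cup into two isolated points, and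
    [psi_collect] parks isolated points at the right end. *)
Lemma Phi_step i t : (t <= i < j)%N -> (t < n)%N ->
  Phi i t = Phi i.+1 t.+1 + Phi i.+1 t + (if t is t'.+1 then Phi i.+1 t' else 0).
Proof.
move=> /andP[ti ij] tn; pose b := (K + j - (i - t)).-1.
have bE : (K + j - (i - t) = b.+1)%N by rewrite /b; lia.
have Km : (K.+1 < K + j)%N by lia.
have tK : (K + t <= N)%N by lia.
have ftE : f t = f t.+1 + f t * q (K + t) + (g t)^-1 *: X t.
  by rewrite jwS mulrBr mulr1 addrAC !subrK.
rewrite /Phi subSS bE {1}ftE !mulrDl !psiD; congr (_ + _ + _).
  rewrite subSn // (psi_collect KjN Km ty (supp_jw tK)); [|lia|lia].
  by congr (psi y (_ * qs _ _)); lia.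
case: t ti tn tK {ftE} b bE => [|t] ti tn tK b bE.
  have -> : (g 0)^-1 = 0 by exact: invr0.
  by rewrite scale0r mul0r -(scale0r 1) psiZ mul0r.
have gt0 : g t.+1 != 0 by apply: gn.
have qx u : (u < b.+1)%N -> (u < N)%N -> q u * qs b.+1 (i - t.+1) = qs b.+1 (i - t.+1) * q u.
  by move=> ub uN; rewrite q_qs //; lia.
rewrite -scalerAl psiZ (psi_X KjN Km ty) //; first last.
- by rewrite qx //; lia.
- by rewrite qx //; lia.
- by rewrite comm_qs //; [apply: ma_supp_le (supp_jw tK); lia | lia].
- by rewrite comm_qs //; [apply: ma_supp_e; lia | lia].
- by move=> u uu; apply: gn; lia.
- by lia.
rewrite mulKf // addnS /= !mulrA.
have tK' : (K + t <= N)%N by lia.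
have sfq : supp (K + t).+1 (f t * q (K + t)).
  by apply: ma_suppM; [apply: ma_supp_le (supp_jw tK'); lia | apply: ma_supp_q; lia].
rewrite (psi_collect KjN Km ty sfq); [|lia|lia].
have bE' : b = b.-1.+1 by lia.
rewrite bE' (psi_collect KjN Km ty (supp_jw tK')); [|lia|lia].
by congr (psi y (_ * qs _ _)); lia.
Qed.

(* As [psi y] agrees on equivalent projections, the identity decomposes along
   the paths counted by [wt], which stop at height [n], where [f n] is null. *)
Lemma psi_decomp :
  psi y 1 = \sum_(t < n) (wt n j t)%:R * psi y (f t * qs (K + t) (j - t)).
Proof.
have dec i : (i <= j)%N -> psi y 1 = \sum_(t < n) (wt n i t)%:R * Phi i t.
  elim: i => [_|i IH ij].
    rewrite (bigD1 (Ordinal n0)) //= big1 ?addr0 => [|t t0].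
      by rewrite mul1r /Phi /= mulr1.
    have t0' : (t == 0 :> nat) = false.
      by apply: contraNF t0 => /eqP E; apply/eqP/ord_inj.
    by rewrite /= t0' mul0r.
  rewrite IH; last lia.
  have Phin : Phi i.+1 n = 0.
    rewrite /Phi; set Q := qs _ _; rewrite /vtrace.
    have -> : star y * (f n * Q) * y = star y * (f n * (Q * y)) by rewrite !mulrA.
    by rewrite ma_trC -mulrA ma_trC fn0.
  rewrite (eq_bigr (fun t : 'I_n => (wt n i t)%:R * (Phi i.+1 t.+1 + Phi i.+1 t +
      (if t : nat is t'.+1 then Phi i.+1 t' else 0)))) => [|t _]; last first.
    have [ti|it] := leqP t i; first by rewrite -Phi_step // ti.
    by rewrite wt_gt // !mul0r.
  rewrite (@sum_neighbours n (fun t => (wt n i t)%:R) (Phi i.+1)) ?wt_ge //.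
  by apply: eq_bigr => t _ /=; rewrite ltn_ord !natrD; case: (t : nat).
rewrite (dec j) //; apply: eq_bigr => t _.
have [tj|jt] := leqP t j; last by rewrite wt_gt // !mul0r.
by congr (_ * psi y (_ * qs _ _)); lia.
Qed.

End Decomposition.

Lemma star_l i : (i.+1 < N)%N -> star (l i) = r i.
Proof. by move=> iN; rewrite -ma_star_r // ma_starK. Qed.

Lemma qr i : (i.+1 < N)%N -> q i * r i = r i.
Proof.
move=> iN; have := congr1 star (ma_lq T iN).
by rewrite ma_starM star_l // ma_star_q //; lia.
Qed.

(* [W t d] moves strand [K + t] to position [K + t + d]. *)
Fixpoint strand_shift t d : A :=
  if d is d'.+1 then r (K + t + d') * strand_shift t d' else 1.
Local Notation W := strand_shift.

Lemma supp_shift t d : (K + t + d < N)%N -> supp (K + t + d).+1 (W t d).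
Proof.
elim: d => [|d IH] dN; first exact: ma_supp1.
apply: ma_suppM; first by apply: ma_supp_r; lia.
by apply: ma_supp_le (IH _); lia.
Qed.

Lemma shift_jw t d : (K + t + d < N)%N -> f t * W t d = W t d * f t.
Proof.
elim: d => [|d IH] dN /=; first by rewrite mulr1 mul1r.
by rewrite mulrA -jw_comm_r -?mulrA ?IH //; lia.
Qed.

Lemma star_shift_shift t d : (K + t + d < N)%N -> star (W t d) * W t d = qs (K + t).+1 d.
Proof.
elim: d => [|d IH] dN; first by rewrite /= ma_star1 mul1r.
rewrite qsSr -IH /=; last lia.
rewrite ma_starM ma_star_r; last lia.
rewrite -mulrA [l _ * _]mulrA ma_lr; last lia.
by rewrite ma_comm_q ?mulrA ?addSn //; [lia | apply: supp_shift; lia].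
Qed.

Lemma shift_star_shift t d : (K + t + d < N)%N -> W t d * star (W t d) = qs (K + t) d.
Proof.
elim: d => [|d IH] dN; first by rewrite /= ma_star1 mul1r.
rewrite qsSr /= ma_starM ma_star_r; last lia.
rewrite -mulrA [W _ _ * _]mulrA IH; last lia.
by rewrite mulrA ma_comm_r -?mulrA ?ma_rl //; [lia | lia | apply: supp_qs; lia].
Qed.

Lemma shift_qs t d : (K + t + d < N)%N -> W t d * qs (K + t).+1 d = W t d.
Proof.
elim: d => [|d IH] dN; first by rewrite /= mulr1.
rewrite qsSr /= -mulrA [W _ _ * _]mulrA IH; last lia.
rewrite addSn -ma_comm_q; [|lia|by apply: supp_shift; lia].
by rewrite mulrA ma_rq //; lia.
Qed.

Lemma star_shift_qs t d : (K + t + d < N)%N -> star (W t d) * qs (K + t) d = star (W t d).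
Proof.
move=> dN; rewrite -shift_star_shift // mulrA star_shift_shift //.
by have := congr1 star (shift_qs dN); rewrite ma_starM star_qs //; lia.
Qed.

(** [X t] contains a cup between the strands K + t - 1 and K + t; [W] carries its right leg past [d]
    isolated points to the strand K + t + d. *)
Definition zeta t d : A := W t d * X t * star (W t d).

Definition jw_proj t d : A := f t * qs (K + t) d.
Local Notation proj := jw_proj.

Section Fixed.
Variables (t d : nat).
Hypotheses (tN : (K + t + d < N)%N) (D_real : D^* = D).
Hypothesis gn : forall u, (0 < u <= t)%N -> g u != 0.

Let tN' : (K + t <= N)%N. Proof. lia. Qed.
Let gn' : forall u, (0 < u < t)%N -> g u != 0. Proof. by move=> u ut; apply: gn; lia. Qed.
Let ff : f t * f t = f t. Proof. by have [] := jw_props tN' gn'. Qed.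

Lemma jw_qs : f t * qs (K + t) d = qs (K + t) d * f t.
Proof. by rewrite comm_qs //; [apply: supp_jw | lia]. Qed.

Lemma star_proj : star (proj t d) = proj t d.
Proof. by rewrite /jw_proj ma_starM star_qs ?star_jw // ?jw_qs //; lia. Qed.

Lemma proj_idem : proj t d * proj t d = proj t d.
Proof.
rewrite /jw_proj -mulrA [qs _ _ * _]mulrA -jw_qs -mulrA mulrA qs_idem ?[f t * _ * _]mulrA; last lia.
by rewrite ff.
Qed.

Hypothesis t0 : (0 < t)%N.

Let XX : X t * X t = g t *: X t.
Proof.
have [_ absorb _ efe] := jw_props tN' gn'; have [ffl _] := absorb t0.
have -> : X t * X t = f t * (e (K + t).-1 * f t * e (K + t).-1) * f t.
  by rewrite jw_cupE -!mulrA [f t * (f t * _)]mulrA ff.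
rewrite (efe t0); last lia.
by rewrite -scalerAr -scalerAl jw_cupE !mulrA ffl.
Qed.

Let suppX : supp (K + t).+1 (X t).
Proof.
have sf : supp (K + t).+1 (f t) by apply: ma_supp_le (supp_jw tN').
rewrite jw_cupE.
by apply: ma_suppM => //; apply: ma_suppM => //; apply: ma_supp_e; lia.
Qed.

Let starX : star (X t) = X t.
Proof. by rewrite jw_cupE !ma_starM star_jw // ma_star_e ?mulrA //; lia. Qed.

Lemma star_zeta : star (zeta t d) = zeta t d.
Proof. by rewrite /zeta ma_starM ma_starK (ma_starM (W t d)) starX mulrA. Qed.

Lemma zetaM : zeta t d * zeta t d = g t *: zeta t d.
Proof.
rewrite /zeta; have := XX; have := suppX; move: (X t) => x sx xx.
have -> : W t d * x * star (W t d) * (W t d * x * star (W t d)) =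
    W t d * (x * (star (W t d) * W t d)) * x * star (W t d) by rewrite !mulrA.
rewrite star_shift_shift // (comm_qs sx); last lia.
by rewrite mulrA shift_qs // -[W _ _ * x * x]mulrA xx -scalerAr -scalerAl.
Qed.

Lemma zeta_proj : zeta t d * proj t d = zeta t d.
Proof.
have fX : X t * f t = X t by rewrite jw_cupE -!mulrA ff.
have sWf : star (W t d) * f t = f t * star (W t d).
  by have := congr1 star (shift_jw tN); rewrite !ma_starM star_jw.
rewrite /zeta /jw_proj; move: (X t) fX => x fX.
by rewrite mulrA -[_ * _ * f t]mulrA sWf !mulrA -[_ * x * f t]mulrA fX -mulrA star_shift_qs.
Qed.

Lemma psi_zeta y : (K.+1 < K + t + d)%N -> tail_comm (K + t + d).+1 y ->
  psi y (zeta t d) = g t * psi y (proj t.-1 d.+2).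
Proof.
move=> Ktd ty; have mN : ((K + t + d).+1 <= N)%N by [].
have Km : (K.+1 < (K + t + d).+1)%N by lia.
have cW d' : (d' <= d)%N -> cm y (W t d').
  elim: d' => [|d' IH] d'd; first exact: cm1.
  by apply: cmM; [apply: (cm_r ty); lia | apply: IH; lia].
rewrite /zeta -mulrA -psi_cyc; last exact: cW.
rewrite -mulrA star_shift_shift // (psi_X mN Km ty) //; first last.
- by rewrite q_qs //; lia.
- by rewrite q_qs //; lia.
- by rewrite comm_qs //; apply: ma_supp_le (supp_jw tN').
- by rewrite comm_qs //; apply: ma_supp_e; lia.
- lia.
congr (_ * psi y _); rewrite /jw_proj -!mulrA.
have -> : (K + t.-1 = (K + t).-1)%N by lia.
by rewrite /= prednK //; lia.
Qed.

End Fixed.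

Lemma supp_zeta t d : (0 < t)%N -> (K + t + d < N)%N -> supp (K + t + d).+1 (zeta t d).
Proof.
move=> t0 tN; have sW := supp_shift tN.
have sf : supp (K + t + d).+1 (f t) by apply: (@ma_supp_le _ _ _ T (K + t)); [lia | apply: supp_jw; lia].
apply: ma_suppM; last exact: ma_supp_star.
apply: ma_suppM => //; rewrite jw_cupE.
by apply: ma_suppM => //; apply: ma_suppM => //; apply: ma_supp_e; lia.
Qed.

(* [zeta t d] is [g t] times a projection equivalent to [proj t.-1 d.+2], while
   its conditional expectation onto the algebra on the first K + t + d strands
   is a multiple of [proj t d]. *)
Lemma tr_zeta t d x : (0 < t)%N -> (K + t + d < N)%N ->
  (forall u, (0 < u < t)%N -> g u != 0) -> supp (K + t + d) x ->
  tr (x * zeta t d) = D^-1 * tr (x * proj t d).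
Proof.
move=> t0 + gn; elim: d x => [|d IH] x dN sx.
  have tN : (K + t <= N)%N by lia.
  have [ff _ _ _] := jw_props tN gn.
  rewrite addn0 in dN sx; rewrite /zeta /jw_proj /= ma_star1 mul1r !mulr1.
  have -> : tr (x * X t) = tr (f t * x * f t * e (K + t).-1).
    by rewrite jw_cupE mulrA ma_trC !mulrA.
  rewrite ma_tr_e; last 2 first.
  - by lia.
  - rewrite prednK; last lia.
    by apply: ma_suppM; [apply: ma_suppM => //|]; apply: supp_jw.
  by rewrite -mulrA ma_trC -mulrA ff.
set i := (K + t + d)%N in dN *; have iN : (i.+1 < N)%N by rewrite /i; lia.
have sx' : supp i.+1 x by rewrite /i -addnS.
have [x' sx1 x'E] := ma_compress (ltnW iN) sx'.
have sz : supp i.+1 (zeta t d) by apply: supp_zeta => //; rewrite /i in iN; lia.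
have sp : supp i (proj t d).
  apply: ma_suppM; last by apply: supp_qs; rewrite /i in iN *; lia.
  by apply: (@ma_supp_le _ _ _ T (K + t)); [rewrite /i; lia | apply: supp_jw; rewrite /i in iN; lia].
have zE : zeta t d.+1 = r i * zeta t d * l i.
  by rewrite /zeta /= ma_starM ma_star_r // -/i !mulrA.
(* Conjugation by [l i] and [r i] compresses [x] to fewer strands, which makes the induction on [d]
   possible. *)
have lxr : l i * x * r i = x' * q i.+1.
  have -> : l i * x * r i = l i * (q i * (x * q i)) * r i.
    by rewrite !mulrA ma_lq // -[_ * q i * r i]mulrA qr.
  by rewrite x'E -!mulrA qr // mulrA ma_comm_l // -mulrA ma_lr.
have -> : tr (x * zeta t d.+1) = tr (zeta t d * (x' * q i.+1)).
  by rewrite zE -lxr; move: (zeta t d) => z; rewrite !mulrA ma_trC !mulrA ma_trC !mulrA.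
rewrite [zeta t d * _]mulrA ma_tr_q //; last by apply: ma_suppM => //; apply: ma_supp_le sx1.
congr (_ * _); rewrite ma_trC IH //; last by rewrite /i in iN; lia.
have qp : q i * proj t d = proj t d * q i by apply: ma_comm_q => //; lia.
have -> : proj t d.+1 = proj t d * q i by rewrite /jw_proj qsSr mulrA.
move: (proj t d) sp qp => p sp qp.
rewrite -(@ma_tr_q _ _ _ T i); [|lia|exact: ma_suppM].
rewrite -mulrA -qp mulrA -x'E -mulrA ma_trC -!mulrA -qp [q i * (q i * _)]mulrA ma_qq //.
exact: ltnW.
Qed.

(** * Estimates from one height to the next *)

Section FinalEstimate.
Variable n : nat.
Local Notation wt := (wt n).

Hypothesis D_pos : 0 < D.
Hypothesis tr_pos : forall x, 0 <= tr (star x * x).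
Hypothesis tr_null : forall x, tr (star x * x) = 0 -> forall w, tr (w * x) = 0.
Hypothesis n0 : (0 < n)%N.
Hypothesis g_pos : forall u, (0 < u < n)%N -> 0 < g u.
Hypothesis gn0 : g n = 0.

Let D0 : D != 0. Proof. exact: lt0r_neq0. Qed.
Let D_real : D^* = D. Proof. by rewrite conj_Creal ?ger0_real ?ltW. Qed.
Let g_neq0 t : (t < n)%N -> forall u, (0 < u <= t)%N -> g u != 0.
Proof. by move=> tn u ut; apply/lt0r_neq0/g_pos; lia. Qed.

Lemma nrm_ge0 x : 0 <= nrm x.
Proof. exact: tr_pos. Qed.

Lemma nrmD x y : nrm (x + y) <= 2 * nrm x + 2 * nrm y.
Proof.
have -> : 2 * nrm x + 2 * nrm y = nrm (x + y) + nrm (x - y).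
  have -> : nrm (x + y) = nrm x + tr (star x * y) + (tr (star y * x) + nrm y).
    by rewrite /sqnorm ma_starD mulrDl !mulrDr !ma_trD.
  have -> : nrm (x - y) = nrm x - tr (star x * y) - (tr (star y * x) - nrm y).
    by rewrite /sqnorm ma_starB mulrBl !mulrBr !ma_trB.
  by ring.
by rewrite lerDl nrm_ge0.
Qed.

Lemma psi_ge0 y p : star p = p -> p * p = p -> 0 <= psi y p.
Proof. by move=> sp pp; rewrite -nrm_psi ?nrm_ge0. Qed.

(** The Markov properties give [tr (f m.+1) = g m.+1 * D^-1 * tr (f m)], which vanishes for
    [m.+1 = n]; as [f n] is a projection, it is then null. *)
Lemma jw_null w : (K + n <= N)%N -> tr (w * f n) = 0.
Proof.
move=> KnN; apply: tr_null; rewrite star_jw //.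
have gn' u : (0 < u < n)%N -> g u != 0 by move=> /g_pos/lt0r_neq0.
have [-> _ _ _] := jw_props KnN gn'.
case: n n0 KnN gn0 g_pos gn' => // m _ KmN gm0 _ gn'.
have KmN' : (K + m <= N)%N by lia.
have gm u : (0 < u < m)%N -> g u != 0 by move=> um; apply: gn'; lia.
have [ff _ _ _] := jw_props KmN' gm.
rewrite jwS ma_trB ma_trZ mulrBr mulr1 ma_trB ma_tr_q; [|lia|exact: supp_jw].
have XE : (g m)^-1 * tr (jw_cup m) = (g m)^-1 * (D^-1 * tr (f m)).
  case: m KmN KmN' ff {gm0 gn' gm} => [|m] KmN KmN' ff; first by rewrite invr0 !mul0r.
  rewrite jw_cupE ma_trC mulrA ff ma_tr_e //; first lia.
  by apply: ma_supp_le (supp_jw KmN'); lia.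
rewrite XE; have -> : tr (f m) - D^-1 * tr (f m) - (g m)^-1 * (D^-1 * tr (f m))
    = (D - 1 - (g m)^-1) * (D^-1 * tr (f m)) by move: (g m)^-1 => G; field.
by rewrite -[D - 1 - _]/(g m.+1) gm0 mul0r.
Qed.

(** [c] is [p] times a projection, so the difference of the two sides is the squared norm of
    [c * z - p *: z]. *)
Lemma nrm_scaled z c p : p != 0 -> p^* = p -> star c = c -> c * c = p *: c ->
  nrm (c * z) <= p ^+ 2 * nrm z.
Proof.
move=> p0 pr sc cc; rewrite -subr_ge0.
have -> : p ^+ 2 * nrm z - nrm (c * z) = nrm (c * z - p *: z); last exact: nrm_ge0.
have E : nrm (c * z) = p * tr (star z * (c * z)).
  by rewrite /sqnorm ma_starM sc -mulrA [c * (c * z)]mulrA cc -!(scalerAl, scalerAr) ma_trZ.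
have E' : tr (star z * c * z) = tr (star z * (c * z)) by rewrite mulrA.
rewrite E /sqnorm ma_starB ma_starZ pr ma_starM sc !(mulrBl, mulrBr) !ma_trB.
rewrite -!(scalerAl, scalerAr) !ma_trZ E'.
have -> : tr (star z * c * (c * z)) = p * tr (star z * (c * z)).
  by rewrite -E /sqnorm ma_starM sc.
by ring.
Qed.

(** In the application [u] is small but commutes with too few generators, whereas [v] commutes with
    those on one more strand. So [zeta] is merely bounded by [proj t d] on [u], and replaced by its
    equivalent at height [t - 1] on [v]. The factor 2 comes from splitting [y]. *)
Lemma proj_step t d y u v : (t < n)%N -> (K.+1 < K + t + d)%N -> (K + t + d < N)%N ->
  (0 < t)%N -> y = u + v -> supp (K + t + d) y -> tail_comm (K + t + d).+1 v ->
  psi y (proj t d) <= 2 * D * g t * (psi u (proj t d) + psi v (proj t.-1 d.+2)).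
Proof.
move=> tn Ktd tN t0 yE sy tv; have gn := g_neq0 tn.
have gn' i : (0 < i < t)%N -> g i != 0 by move=> it; apply: gn; lia.
have gt0 : 0 < g t by apply: g_pos; rewrite t0.
have gt : g t != 0 by apply: lt0r_neq0.
have sz := star_zeta tN D_real t0.
have zz := zetaM tN gn t0.
have nz x : nrm (zeta t d * x) = g t * psi x (zeta t d).
  by rewrite /sqnorm ma_starM sz -mulrA [zeta t d * (_ * _)]mulrA zz -!(scalerAl, scalerAr) ma_trZ mulrA.
(* As [y] does not reach the last strand, [tr_zeta] trades [proj t d] for [D] times [zeta t d], and
   [zeta t d] squares to [g t] times itself; hence the constant. *)
have -> : psi y (proj t d) = D * (g t)^-1 * nrm (zeta t d * y).
  have E (c : A) : psi y c = tr (y * star y * c).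
    by rewrite /vtrace -mulrA ma_trC -mulrA ma_trC.
  rewrite nz mulrA mulfVK // !E tr_zeta //; last by apply: ma_suppM => //; apply: ma_supp_star.
  by rewrite mulVKf.
have nv : nrm (zeta t d * v) = g t ^+ 2 * psi v (proj t.-1 d.+2).
  by rewrite nz (psi_zeta tN gn t0) // mulrA expr2.
have nu : nrm (zeta t d * u) <= g t ^+ 2 * psi u (proj t d).
  rewrite -(zeta_proj tN D_real gn) -mulrA.
  rewrite -(nrm_psi u (star_proj tN D_real) (proj_idem tN gn)).
  exact: nrm_scaled (jw_ratio_real D_real t) sz zz.
have -> : 2 * D * g t * (psi u (proj t d) + psi v (proj t.-1 d.+2)) =
  D * (g t)^-1 * (2 * (g t ^+ 2 * psi u (proj t d)) + 2 * (g t ^+ 2 * psi v (proj t.-1 d.+2))).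
  by field.
rewrite ler_pM2l; last by rewrite mulr_gt0 ?invr_gt0.
rewrite yE mulrDr; apply: le_trans (nrmD _ _) _; rewrite nv lerD2r.
by rewrite ler_pM2l // ltr0n.
Qed.

(** At height 0 there is no string to bend, and one more isolated point takes the place of [zeta];
    by [ma_tr_q] it costs the factor [D]. *)
Lemma proj_step0 d y u v : (K + d < N)%N -> y = u + v -> supp (K + d) y ->
  psi y (proj 0 d) <= 2 * D * (psi u (proj 0 d) + psi v (proj 0 d.+1)).
Proof.
move=> dN yE sy.
have pE d' : proj 0 d' = qs K d' by rewrite /jw_proj /= mul1r addn0.
have qd : q (K + d) * qs K d = qs K d * q (K + d) by rewrite q_qs //; lia.
have qq : q (K + d) * q (K + d) = q (K + d) by rewrite ma_qq.
have pS : qs K d.+1 = q (K + d) * qs K d by rewrite qsSr qd.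
have sp d' : (d' <= d.+1)%N -> star (qs K d') = qs K d' by move=> ?; apply: star_qs; lia.
have pp d' : (d' <= d.+1)%N -> qs K d' * qs K d' = qs K d' by move=> ?; apply: qs_idem; lia.
rewrite !pE; have -> : psi y (qs K d) = D * nrm (qs K d.+1 * y).
  have E (c : A) : psi y c = tr (y * star y * c).
    by rewrite /vtrace -mulrA ma_trC -mulrA ma_trC.
  rewrite nrm_psi ?sp ?pp //.
  rewrite !E qsSr mulrA ma_tr_q ?mulVKf //; apply: ma_suppM; last by apply: supp_qs; lia.
  by apply: ma_suppM => //; apply: ma_supp_star.
rewrite -!nrm_psi ?sp ?pp //.
have -> : 2 * D * (nrm (qs K d * u) + nrm (qs K d.+1 * v)) =
  D * (2 * nrm (qs K d * u) + 2 * nrm (qs K d.+1 * v)) by ring.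
rewrite ler_pM2l // yE mulrDr; apply: le_trans (nrmD _ _) _.
rewrite lerD2r ler_pM2l ?ltr0n //.
have := @nrm_scaled (qs K d * u) (q (K + d)) 1 (oner_neq0 _) (rmorph1 _).
rewrite expr1n mul1r mulrA -pS; apply; first by rewrite ma_star_q.
by rewrite scale1r.
Qed.

Lemma compress_qs d x : (K + d <= N)%N -> supp (K + d) x ->
  exists2 b, supp K b & qs K d * x * qs K d = b * qs K d.
Proof.
elim: d x => [|d IH] x dN sx; first by exists x; rewrite ?addn0 // in sx *; rewrite /= mul1r.
rewrite addnS in dN sx; have [x' sx' x'E] := ma_compress dN sx.
have [b sb bE] := IH x' (ltnW dN) sx'; exists b => //.
have qd : q (K + d) * qs K d = qs K d * q (K + d) by rewrite q_qs //; lia.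
rewrite qsSr; have -> : qs K d * q (K + d) * x * (qs K d * q (K + d)) =
   qs K d * (q (K + d) * (x * q (K + d))) * qs K d by rewrite -{2}qd !mulrA.
by rewrite x'E -[qs K d * (_ * _) * _]mulrA -[x' * _ * _]mulrA qd 2!mulrA bE mulrA.
Qed.

(** The error in units of [eta]: each step adds one new error and then multiplies by at most [c]. *)
Fixpoint Bconst (c : C) (m : nat) : C := if m is m'.+1 then c * (1 + Bconst c m') else 0.

Lemma Bconst_ge0 c m : 0 <= c -> 0 <= Bconst c m.
Proof. by move=> c0; elim: m => //= m IH; rewrite mulr_ge0 ?addr_ge0. Qed.

(* [b] is the compression of [a n] by [q]'s, so that [a n - b] vanishes at
   height 0; going back from [n] to 0, the steps [a i - a i.+1] being small,
   each height is bounded by the previous one ([proj_step], [proj_step0]). *)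
Theorem tail_approx (j : nat) (a : nat -> A) (c eta : C) :
  (1 < j)%N -> (K + j + n < N)%N ->
  2 * D <= c -> (forall u, (0 < u < n)%N -> 2 * D * g u <= c) ->
  (forall i, (i <= n)%N -> supp (K + j + i) (a i)) ->
  (forall i, (i <= n)%N -> tail_comm (K + j + i) (a i)) ->
  (forall i, (i < n)%N -> nrm (a i - a i.+1) <= eta) ->
  exists2 b, supp K b & nrm (a 0%N - b) <= n%:R * (Bconst c n * eta).
Proof.
move=> j2 jN c2D cg sa ta na.
have c0 : 0 <= c by apply: le_trans c2D; rewrite mulr_ge0 ?ltW.
have [b sb bE] : exists2 b, supp K b & qs K (j + n) * a n * qs K (j + n) = b * qs K (j + n).
  by apply: compress_qs; rewrite addnA; [lia | apply: sa].
have tb m : (m <= N)%N -> tail_comm m b.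
  move=> mN i Ki im; split; apply: cm_commute;
    rewrite ?ma_star_e ?ma_star_r ?ma_comm_e ?ma_comm_r ?ma_comm_l //;
    by [lia | apply: ma_supp_le sb].
exists b => //.
have tab i : (i <= n)%N -> tail_comm (K + j + i) (a i - b).
  by move=> i_n; apply: tail_comm_sub; [apply: ta | apply: tb; lia].
have tau i : (i < n)%N -> tail_comm (K + j + i) (a i - a i.+1).
  move=> i_n; apply: tail_comm_sub; first by apply: ta; lia.
  by apply: tail_comm_le (ta _ i_n); lia.
have sab i : (i <= n)%N -> supp (K + j + i) (a i - b).
  by move=> i_n; apply: ma_suppB; [apply: sa | apply: ma_supp_le sb; lia].
have gn' u : (0 < u < n)%N -> g u != 0 by move=> /g_pos/lt0r_neq0.
have fn0 w : tr (w * f n) = 0 by apply: jw_null; lia.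
have decomp i y : (i <= n)%N -> tail_comm (K + j + i) y ->
    nrm y = \sum_(t < n) (wt (j + i) t)%:R * psi y (proj t (j + i - t)).
  move=> i_n ty; have := @psi_decomp n (j + i) y n0.
  rewrite {1}/vtrace mulr1 /sqnorm addnA => -> //; lia.
have psi0 i t y : (i <= n)%N -> (t <= j + i)%N -> (t < n)%N -> 0 <= psi y (proj t (j + i - t)).
  move=> i_n tj tn; have tN : (K + t + (j + i - t) < N)%N by lia.
  by apply: psi_ge0; [apply: star_proj | apply: proj_idem (g_neq0 tn)].
(* [a n] commutes with [p] up to null vectors, so [p * a n] may be replaced by [p * a n * p], which
   is [b * p]. *)
have Y0 : psi (a n - b) (proj 0 (j + n)) = 0.
  rewrite /jw_proj /= mul1r addn0; set p := qs K (j + n) in bE *.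
  have pp : p * p = p by apply: qs_idem; lia.
  have [cp _] : cm (a n) p by apply: (cm_qs (m := (K + j + n)%N) _ _ (ta n (leqnn n))); lia.
  have bp : b * p = p * b by apply: comm_qs => //; lia.
  clearbody p.
  have E w : tr (w * (p * a n)) = tr (w * (p * b)).
    have -> : w * (p * a n) = w * p * (p * a n) by rewrite -!mulrA [p * (p * _)]mulrA pp.
    by rewrite cp -mulrA [p * (_ * _)]mulrA bE bp.
  by rewrite /vtrace -mulrA mulrBr mulrBr ma_trB E subrr.
have eta0 : 0 <= eta by apply: le_trans (na 0%N n0); apply: nrm_ge0.
(* A single summand of the decomposition of the squared norm, all of whose terms are nonnegative. *)
have weight_u i t : (i < n)%N -> (t < n)%N -> (t <= j + i)%N ->
    (wt (j + i) t)%:R * psi (a i - a i.+1) (proj t (j + i - t)) <= eta.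
  move=> i_n tn tj; apply: le_trans (na i i_n).
  rewrite (decomp i _ (ltnW i_n) (tau i i_n)) (bigD1 (Ordinal tn)) //= lerDl.
  apply: sumr_ge0 => s _; have [sj|js] := leqP s (j + i)%N; last by rewrite wt_gt // mul0r.
  by rewrite mulr_ge0 ?psi0 // ltnW.
(* Induction on the distance [m] to the last vector. There only height 0 is known, and each step
   back reaches one height more; for [i = 0] the range covers all [t < n]. *)
have claim m : forall t i, (t < n)%N -> (t <= m)%N -> (i + m = n)%N ->
    (wt (j + i) t)%:R * psi (a i - b) (proj t (j + i - t)) <= Bconst c m * eta.
  elim: m => [|m IH] t i tn tm imn.
    by rewrite addn0 in imn; move: tm; rewrite leqn0 => /eqP->; rewrite imn subn0 Y0 mulr0 mul0r.
  have i_n : (i < n)%N by lia.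
  have [tj|jt] := leqP t (j + i)%N; last by rewrite wt_gt // mul0r mulr_ge0 // Bconst_ge0.
  have w0 : 0 <= (wt (j + i) t)%:R :> C by [].
  have uv : a i - b = (a i - a i.+1) + (a i.+1 - b) by rewrite addrA subrK.
  have wu := weight_u i t i_n tn tj.
  have imn' : (i.+1 + m = n)%N by lia.
  (* Common end of both cases: [p] is the constant of the step, [P] the size of the next vector at
     the height to which the step leads, and [w'] the path count there. *)
  have bound (p P w' : C) : 0 <= p -> p <= c -> 0 <= P -> w' * P <= Bconst c m * eta ->
      (wt (j + i) t)%:R * P <= w' * P ->
      psi (a i - b) (proj t (j + i - t)) <= p * (psi (a i - a i.+1) (proj t (j + i - t)) + P) ->
      (wt (j + i) t)%:R * psi (a i - b) (proj t (j + i - t)) <= Bconst c m.+1 * eta.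
    move=> p0 pc P0 wP ww le; apply: le_trans (ler_wpM2l w0 le) _.
    rewrite mulrCA mulrDr /= -mulrA; apply: ler_pM => //.
      by rewrite addr_ge0 ?mulr_ge0 // psi0 // ltnW.
    by rewrite mulrDl mul1r lerD // (le_trans ww).
  case: t tn tm tj w0 wu bound => [|t] tn tm tj w0 wu bound.
    apply: (bound (2 * D) (psi (a i.+1 - b) (proj 0 (j + i).+1)) (wt (j + i).+1 0)%:R) => //.
    - by rewrite mulr_ge0 ?ltW.
    - by have := psi0 i.+1 0%N (a i.+1 - b); rewrite subn0 addnS; apply.
    - by have := IH 0%N i.+1 n0 isT imn'; rewrite subn0 addnS.
    - rewrite ler_wpM2r // ?ler_nat ?wt_le0 //.
      by have := psi0 i.+1 0%N (a i.+1 - b); rewrite subn0 addnS; apply.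
    - rewrite !subn0; apply: proj_step0 => //; first by lia.
      by rewrite addnA; apply: sab; exact: ltnW.
  have tE : (j + i.+1 - t = (j + i - t.+1).+2)%N by lia.
  have vP : 0 <= psi (a i.+1 - b) (proj t (j + i - t.+1).+2).
    by rewrite -tE; apply: psi0; lia.
  apply: (bound (2 * D * g t.+1) (psi (a i.+1 - b) (proj t (j + i - t.+1).+2))
    (wt (j + i).+1 t)%:R) => //.
  - by rewrite !mulr_ge0 ?ltW // g_pos.
  - by apply: cg.
  - by rewrite -tE -addnS; apply: IH => //; lia.
  - by rewrite ler_wpM2r // ler_nat wt_le.
  - have KE : (K + t.+1 + (j + i - t.+1) = K + j + i)%N by lia.
    apply: proj_step => //; rewrite ?KE; [lia|lia|exact/sab/ltnW|].
    by rewrite -addnS; apply: tab.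
rewrite (decomp 0%N _ (leq0n _) (tab 0%N (leq0n _))).
apply: le_trans (_ : \sum_(t < n) Bconst c n * eta <= _).
  apply: ler_sum => t _; apply: claim; [exact: ltn_ord | exact/ltnW/ltn_ord | exact: add0n].
by rewrite big_const_ord iter_addr addr0 mulr_natl.
Qed.

End FinalEstimate.

End JonesWenzl.

(** * The GNS representation *)

From mathcomp Require Import sesquilinear.
From mathcomp Require Import all_classical all_reals all_analysis.
From mathcomp Require Import complex.

Local Open Scope classical_set_scope.
Local Open Scope ring_scope.
Local Open Scope complex_scope.

(** * Sines and the Jones-Wenzl ratios *)

Section Trig.
Variables (R : realType) (n : nat) (D : R).
Hypotheses (n2 : (2 <= n)%N) (DE : D = 2 * cos (pi / n.+1%:R) + 1).
Let theta : R := pi / n.+1%:R.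

Lemma theta_gt0 : 0 < theta.
Proof. by rewrite divr_gt0 ?pi_gt0. Qed.

Lemma thetaS : n.+1%:R * theta = pi.
Proof. by rewrite mulrC divfK // pnatr_eq0. Qed.

Lemma sin_theta_gt0 u : (0 < u < n.+1)%N -> 0 < sin (u%:R * theta).
Proof.
move=> /andP[u0 un]; apply: sin_gt0_pi; rewrite mulr_gt0 ?ltr0n ?theta_gt0 //=.
by rewrite -thetaS ltr_pM2r ?theta_gt0 // ltr_nat.
Qed.

(** As [D - 1 = 2 cos theta], the recursion of [jw_ratio] is the identity [sin (x + theta) + sin (x
    - theta) = 2 cos theta sin x]. *)
Lemma jw_ratio_sin u : (u < n)%N ->
  jw_ratio D%:C u.+1 = (sin (u.+2%:R * theta) / sin (u.+1%:R * theta))%:C.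
Proof.
have DE1 : D%:C - 1 = (2 * cos theta)%:C by rewrite DE rmorphD rmorph1 addrK.
elim: u => [|u IH] un.
  rewrite /= invr0 subr0 DE1 mul1r; congr (_%:C).
  have s0 : sin theta != 0 by have := @sin_theta_gt0 1; rewrite mul1r => s1; apply/lt0r_neq0/s1; lia.
  have -> : 2%:R * theta = theta + theta by ring.
  by rewrite sinD; field.
rewrite -[LHS]/(D%:C - 1 - (jw_ratio D%:C u.+1)^-1) IH; last by lia.
rewrite DE1 -fmorphV -rmorphB; congr (_%:C).
have s2 : sin (u.+2%:R * theta) != 0 by apply/lt0r_neq0/sin_theta_gt0; lia.
rewrite invf_div.
have -> : u.+3%:R * theta = u.+2%:R * theta + theta by rewrite -addn1 natrD mulrDl mul1r.
have -> : u.+1%:R * theta = u.+2%:R * theta - theta.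
  by rewrite -[in RHS]addn1 natrD mulrDl mul1r addrK.
by rewrite sinB sinD; field.
Qed.

Lemma jw_ratio_gt0 u : (0 < u < n)%N -> 0 < jw_ratio D%:C u.
Proof.
case: u => // u /andP[_ un]; rewrite jw_ratio_sin ?ltcR; last by lia.
by rewrite divr_gt0 // sin_theta_gt0 //; lia.
Qed.

Lemma jw_ratio_n : jw_ratio D%:C n = 0.
Proof.
have n1 : (n.-1.+1 = n)%N by lia.
rewrite -{1}n1 jw_ratio_sin; last by lia.
by rewrite n1 thetaS sinpi mul0r.
Qed.

Lemma loop_gt0 : 0 < D.
Proof.
rewrite DE ltr_wpDl // mulr_ge0 // ltW // cos_gt0_pihalf //.
rewrite (lt_trans _ theta_gt0) ?oppr_lt0 //=.
by rewrite ltr_pM2l ?pi_gt0 // ltf_pV2 ?posrE ?ltr0n // ltr_nat ltnS.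
by rewrite divr_gt0 ?pi_gt0.
Qed.

End Trig.

Section Bridge.
Variables (R : realType) (D : R).

Lemma mmulE N (x y : motz D%:C N) : mmul D x y = x * y.
Proof.
apply: eq_bigr => d _; apply: eq_bigr => d' _.
by rewrite rmorphXn -scalerA.
Qed.

Lemma mstarE N (x : motz D%:C N) : mstar x = star x.
Proof. by []. Qed.

Lemma mtrE N (x : motz D%:C N) : mtr D x = tr x.
Proof. by apply: eq_bigr => d _; rewrite rmorphM fmorphV !rmorphXn. Qed.

Lemma mincl_linear N : linear (@mincl R N).
Proof.
move=> a x y; rewrite /mincl scaler_sumr -big_split; apply: eq_bigr => d _.
by rewrite !ffunE scalerDl scalerA.
Qed.

Lemma mincl_bas N f : is_motzkin f ->
  mincl (bas D%:C f : malg R N) = bas D%:C (add_strand f) :> motz D%:C N.+1.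
Proof.
move=> mf; rewrite /mincl (bigD1 (Sub f mf)) //= ffunE eqxx scale1r big1 ?addr0 // => d.
by rewrite ffunE -(inj_eq val_inj) /= => /negPf ->; rewrite scale0r.
Qed.

End Bridge.

(** * Extension of densely defined bounded operators *)

Section Extension.
Variables (C : numFieldType) (H : completeNormedModType C).
Implicit Types (u v w : H).

(** The order of [C] is partial; realness makes [x] and [y] comparable, so that the failing
    inequality can be reversed. *)
Lemma real_le_eps (k x y : C) : 0 <= k -> x \is Num.real -> y \is Num.real ->
  (forall e, 0 < e -> x <= y + k * e) -> x <= y.
Proof.
move=> k0 xr yr le; have [//|yx] := real_leP xr yr.
have k1 : 0 < k + 1 by rewrite ltr_wpDl.
have xy : 0 < x - y by rewrite subr_gt0.
have := le ((x - y) / (k + 1)) (divr_gt0 xy k1).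
rewrite -lerBlDl mulrCA ler_pMr // ler_pdivlMr // mul1r gerDl ler10 //.
Qed.

(* [P] is the graph of a densely defined bounded operator. *)
Lemma dense_extension (P : H -> H -> Prop) (M : C) : 0 <= M ->
  (forall u e, 0 < e -> exists v w, P v w /\ `|u - v| < e) ->
  (forall a u w u' w', P u w -> P u' w' -> P (a *: u + u') (a *: w + w')) ->
  (forall u w, P u w -> `|w| <= M * `|u|) ->
  exists phi : H -> H, (linear phi /\ continuous phi) /\ forall u w, P u w -> phi u = w.
Proof.
(* Candidates for the value at [u] are the second coordinates of graph points near [u]. A filter
   replaces the choice of a sequence, and the bound makes it Cauchy. *)
move=> M0 dP linP bP; pose B u (e : C) := [set w | exists2 v, P v w & `|u - v| < e].
pose F u := filter_from [set e : C | 0 < e] (B u).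
have PB v w v' w' : P v w -> P v' w' -> `|w - w'| <= M * `|v - v'|.
  move=> Pv Pv'; have /bP := linP (-1) _ _ _ _ Pv' Pv.
  by rewrite !scaleN1r !(addrC (- _)).
have FF u : ProperFilter (F u).
  apply: filter_from_proper; first last.
    by move=> e e0; have [v [w [Pvw uv]]] := dP u e e0; exists w, v.
  apply: filter_from_filter; first by exists 1 => /=.
  move=> e e' /= e0 e'0.
  have er : e \is Num.real by apply: gtr0_real.
  have e'r : e' \is Num.real by apply: gtr0_real.
  have [ee'|ee'] := real_leP er e'r.
    by exists e => // w [v Pv uv]; split; exists v => //; apply: lt_le_trans uv _.
  by exists e' => // w [v Pv uv]; split; exists v => //; apply: lt_trans uv _.
have cF u : cvg (F u).
  apply: cauchy_cvg; apply: cauchy_exP => e e0.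
  (* [M + 1] instead of [M] avoids a division by zero and makes the final inequality strict. *)
  pose e' := e / (2 * (M + 1)).
  have M1 : 0 < M + 1 by rewrite ltr_wpDl.
  have e'0 : 0 < e' by rewrite divr_gt0 // mulr_gt0.
  have [v [w [Pvw uv]]] := dP u e' e'0.
  exists w; exists e' => // w' [v' Pv' uv'].
  rewrite -ball_normE /=; apply: le_lt_trans (PB _ _ _ _ Pvw Pv') _.
  have vv' : `|v - v'| <= e' + e'.
    have -> : v - v' = (u - v') - (u - v) by rewrite opprB [RHS]addrC addrA subrK.
    by apply: le_trans (ler_normB _ _) _; apply: lerD; apply: ltW.
  apply: le_lt_trans (ler_wpM2l M0 vv') _.
  have -> : e = (M + 1) * (e' + e').
    by rewrite /e'; field; rewrite ?mulf_neq0 ?pnatr_eq0 //; apply: lt0r_neq0.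
  by rewrite ltr_pM2r ?ltrDl // addr_gt0.
pose phi u : H := lim (F u).
have phiE u v w : P v w -> `|phi u - w| <= M * `|u - v|.
  move=> Pvw; apply: (@real_le_eps (1 + M)) => //; rewrite ?rpredM ?ger0_real ?addr_ge0 //.
  move=> e e0; have /cvg_ex [l Fl] := cF u.
  have : nbhs (phi u) (ball (phi u) e) by apply: nbhsx_ballx.
  move=> /(cF u) [d /= d0 Bd].
  have [m m0 [md me]] : exists2 m, 0 < m & m <= d /\ m <= e.
    have dr : d \is Num.real by apply: gtr0_real.
    have er : e \is Num.real by apply: gtr0_real.
    have [de|de] := real_leP dr er; first by exists d.
    by exists e => //; split=> //; apply: ltW.
  have [v' [w' [Pv' uv']]] := dP u m m0.
  have : ball (phi u) e w' by apply: Bd; exists v' => //; apply: lt_le_trans uv' _.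
  rewrite -ball_normE /= => pw'.
  have -> : phi u - w = (phi u - w') + (w' - w) by rewrite addrA subrK.
  apply: le_trans (ler_normD _ _) _.
  have -> : M * `|u - v| + (1 + M) * e = e + M * (e + `|u - v|) by ring.
  apply: lerD; first exact: ltW.
  apply: le_trans (PB _ _ _ _ Pv' Pvw) _; apply: ler_wpM2l => //.
  have -> : v' - v = (u - v) - (u - v') by rewrite opprB [RHS]addrC addrA subrK.
  apply: le_trans (ler_normB _ _) _; rewrite addrC lerD2r.
  by apply: le_trans (ltW uv') _.
have phi_eq u w : P u w -> phi u = w.
  move=> Puw; apply/eqP; rewrite -subr_eq0 -normr_le0.
  by have := phiE u _ _ Puw; rewrite subrr normr0 mulr0.
have phi_lin : linear phi.
  move=> a u u'; apply/eqP; rewrite -subr_eq0 -normr_le0.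
  apply: (@real_le_eps (2 * M * (`|a| + 1))) => //; rewrite ?mulr_ge0 ?addr_ge0 //.
  move=> e e0; rewrite add0r.
  have [v [w [Pv uv]]] := dP u e e0; have [v' [w' [Pv' uv']]] := dP u' e e0.
  have Pvv := linP a _ _ _ _ Pv Pv'.
  have -> : phi (a *: u + u') - (a *: phi u + phi u') =
     (phi (a *: u + u') - (a *: w + w')) - (a *: (phi u - w) + (phi u' - w')).
    rewrite scalerBr; move: (phi _) (a *: phi u) (a *: w) (phi u') => x y z t.
    by rewrite addrACA -opprD [- (_ + _ - _)]opprB addrA subrK.
  apply: le_trans (ler_normB _ _) _.
  have -> : 2 * M * (`|a| + 1) * e = M * (`|a| * e + e) + M * (`|a| * e + e) by ring.
  apply: lerD.
    apply: le_trans (phiE _ _ _ Pvv) _; apply: ler_wpM2l => //.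
    have -> : a *: u + u' - (a *: v + v') = a *: (u - v) + (u' - v').
      by rewrite scalerBr opprD addrACA.
    apply: le_trans (ler_normD _ _) _; rewrite normrZ; apply: lerD; last exact: ltW.
    by apply: ler_wpM2l => //; apply: ltW.
  apply: le_trans (ler_normD _ _) _; rewrite normrZ mulrDr; apply: lerD.
    rewrite mulrCA; apply: ler_wpM2l => //; apply: le_trans (phiE _ _ _ Pv) _.
    by apply: ler_wpM2l => //; apply: ltW.
  by apply: le_trans (phiE _ _ _ Pv') _; apply: ler_wpM2l => //; apply: ltW.
exists phi; split=> //; split=> //.
have phi_bd u : `|phi u| <= M * `|u|.
  apply: (@real_le_eps (2 * M)) => //; rewrite ?rpredM ?ger0_real ?mulr_ge0 //.
  move=> e e0; have [v [w [Pv uv]]] := dP u e e0.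
  rewrite -[phi u](subrK w); apply: le_trans (ler_normD _ _) _.
  have -> : M * `|u| + 2 * M * e = M * e + M * (e + `|u|) by ring.
  apply: lerD; first by apply: le_trans (phiE _ _ _ Pv) _; apply: ler_wpM2l => //; apply: ltW.
  apply: le_trans (bP _ _ Pv) _; apply: ler_wpM2l => //.
  rewrite -[v](subrK u); apply: le_trans (ler_normD _ _) _.
  by rewrite lerD2r distrC ltW.
move=> x; apply/(@cvgrPdist_le _ _ _ (nbhs x)) => e e0.
have M1 : 0 < M + 1 by rewrite ltr_wpDl.
near=> z.
have -> : phi x - phi z = phi (x - z).
  by have := phi_lin (-1) z x; rewrite !scaleN1r !(addrC (- _)).
apply: le_trans (phi_bd _) _; apply: le_trans (_ : (M + 1) * `|x - z| <= _).
  by apply: ler_wpM2r => //; rewrite lerDl.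
rewrite mulrC -ler_pdivlMr //.
near: z; apply: cvgr_dist_le => //; exact: divr_gt0.
Unshelve. all: by end_near. Qed.

End Extension.

(** * The inclusions between the Motzkin algebras *)

Section Inclusion.
Variables (R : realType) (D : R).
Local Notation motz := (motz D%:C).
Local Notation up x := (mincl x : motz _).

Lemma minclP N a (x y : motz N) : up (a *: x + y) = a *: up x + up y.
Proof. exact: mincl_linear. Qed.

Lemma mincl0 N : up (0 : motz N) = 0.
Proof. by have := minclP (-1) (0 : motz N) 0; rewrite scaler0 addr0 scaleN1r addNr. Qed.

Lemma minclD N (x y : motz N) : up (x + y) = up x + up y.
Proof. by have := minclP 1 x y; rewrite !scale1r. Qed.

Lemma minclZ N a (x : motz N) : up (a *: x) = a *: up x.
Proof. by have := minclP a x 0; rewrite mincl0 !addr0. Qed.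

Lemma mincl_star N (x : motz N) : up (star x) = star (up x).
Proof.
elim/motz_ind: x => [|x y IH IH'|a x IH|f mf].
- by rewrite star0 !mincl0 star0.
- by rewrite starD !minclD starD IH IH'.
- by rewrite starZ !minclZ starZ IH.
rewrite star_bas // !mincl_bas ?reflect_motzkin // star_bas ?add_strand_motzkin //.
by rewrite add_strand_reflect.
Qed.

Lemma mincl1 N : up (1 : motz N) = 1.
Proof. by rewrite one_bas mincl_bas ?id_motzkin // add_strand_id. Qed.

Lemma supp_mincl N m (x : motz N) : supp m x -> supp m (up x).
Proof.
elim/supp_ind: x / => [|x y IH IH'|a x IH|f mf vf].
- by rewrite mincl0; apply: supp0.
- by rewrite minclD; apply: suppD.
- by rewrite minclZ; apply: suppZ.
rewrite mincl_bas //; apply: supp_bas; first exact: add_strand_motzkin.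
move=> i mi; have [j iE|->] := unliftP ord_max i; last exact: vertical_add_strand_max.
have -> : i = widen_ord (leqnSn N) j by rewrite widen_lift.
by rewrite vertical_add_strand; apply: vf; move: mi; rewrite iE lift_max.
Qed.

Lemma supp_full N (x : motz N) : supp N x.
Proof.
elim/motz_ind: x => [|x y|a x|f mf]; [exact: supp0 | exact: suppD | exact: suppZ | ].
by apply: supp_bas => // i; rewrite leqNgt ltn_ord.
Qed.

Lemma strip N m (y : motz N.+1) : (m <= N)%N -> supp m y ->
  exists2 x : motz N, supp m x & y = up x.
Proof.
move=> mN; elim/supp_ind: y / => [|x y [x' sx' ->] [y' sy' ->]|a x [x' sx' ->]|f mf vf].
- by exists 0; [apply: supp0 | rewrite mincl0].
- by exists (x' + y'); [apply: suppD | rewrite minclD].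
- by exists (a *: x'); [apply: suppZ | rewrite minclZ].
have [g mg fE] := strip_strand mf (vf ord_max mN).
exists (bas D%:C g); last by rewrite mincl_bas // fE.
apply: supp_bas => // i mi; rewrite -vertical_add_strand -fE.
by apply: vf.
Qed.

Fixpoint lift m d : motz m -> motz (d + m) :=
  if d is d'.+1 then fun x => up (lift d' x) else id.

Lemma mincl_ge N' i : (i < N')%N -> up (ge D%:C N' i) = ge D%:C N'.+1 i.
Proof.
move=> iN; rewrite /ge mincl_bas; last by apply/e_motzkin/inord_succ.
rewrite add_strand_e; congr (bas _ (e_diag _ _)); apply: ord_inj; rewrite /= !inordK //; lia.
Qed.

Lemma mincl_gl N' i : (i < N')%N -> up (gl D%:C N' i) = gl D%:C N'.+1 i.
Proof.
move=> iN; rewrite /gl mincl_bas; last by apply/l_motzkin/inord_succ.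
rewrite add_strand_l; congr (bas _ (l_diag _ _)); apply: ord_inj; rewrite /= !inordK //; lia.
Qed.

Lemma mincl_gr N' i : (i < N')%N -> up (gr D%:C N' i) = gr D%:C N'.+1 i.
Proof. by move=> iN; rewrite -!star_gl ?ltnS ?mincl_star ?mincl_gl //; lia. Qed.

Lemma mot_eE i : mot_e D i.+1 = (D^-1)%:C *: ge D%:C i.+1 i :> motz _.
Proof.
rewrite /mot_e -[mbasis _ _]/(bas D%:C _); congr (_ *: bas _ (e_diag _ _)).
by apply: ord_inj; rewrite inordK.
Qed.

Lemma mot_lE i : mot_l R i.+1 = gl D%:C i.+1 i :> motz _.
Proof.
rewrite /mot_l -[mbasis _ _]/(bas D%:C _); congr (bas _ (l_diag _ _)).
by apply: ord_inj; rewrite inordK.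
Qed.

Lemma mot_rE i : mot_r R i.+1 = gr D%:C i.+1 i :> motz _.
Proof.
have -> : gr D%:C i.+1 i = star (gl D%:C i.+1 i) by rewrite star_gl.
by rewrite -mot_lE.
Qed.

End Inclusion.

Section Generation.
Variables (C : numClosedFieldType) (D : C) (N' : nat).
Hypotheses (D0 : D != 0) (N0 : (0 < N')%N).
Local Notation motz := (motz D N'.+1).

(** [motzkin_gen] also uses the [q]'s; these are [r * l], or [l * r] on the last strand, which takes
    at least two strands. Powers of [D] from closed loops are divided out. *)
Lemma motz_gen_ind (Q : motz -> Prop) :
  (forall a x y, Q x -> Q y -> Q (a *: x + y)) -> (forall x y, Q x -> Q y -> Q (x * y)) ->
  Q 1 -> (forall i, (i < N')%N -> [/\ Q (D^-1 *: ge D N' i), Q (gl D N' i) & Q (gr D N' i)]) ->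
  forall x, Q x.
Proof.
move=> QP QM Q1 Qg; have Q0 : Q 0 by rewrite -(addNr 1) -scaleN1r; apply: QP.
have QZ a x : Q x -> Q (a *: x) by move=> qx; rewrite -[a *: x]addr0; apply: QP.
elim/motz_ind => [//|x y qx qy|a x qx|f mf]; first by rewrite -[x]scale1r; apply: QP.
  exact: QZ.
have adj (a b : 'I_N'.+1) : b = a.+1 :> nat -> (a < N')%N /\ (a = inord a /\ b = inord a.+1).
  move=> ab; split; first by rewrite -ltnS -ab.
  by split; apply: ord_inj; rewrite inordK // -ab.
elim: (motzkin_gen mf) => [//|a|a b ab|a b ab|a b ab|g h gg Qgg gh Qh].
- have [aN|aN] := ltnP a N'.
    have [_ Ql Qr] := Qg a aN.
    have -> : bas D (q_diag a) = gr D N' a * gl D N' a.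
      by rewrite grl // /gq; congr (bas _ (q_diag _)); apply: ord_inj; rewrite inordK.
    exact: QM.
  have aE : a = N' :> nat by apply/anti_leq; rewrite aN -ltnS ltn_ord.
  have pN : (N'.-1 < N')%N by rewrite prednK.
  have [_ Ql Qr] := Qg _ pN.
  have -> : bas D (q_diag a) = gl D N' N'.-1 * gr D N' N'.-1.
    rewrite glr ?prednK // /gq; congr (bas _ (q_diag _)); apply: ord_inj.
    by rewrite inordK.
  exact: QM.
- have [aN [aE bE]] := adj a b ab; have [/(QZ D) Qe _ _] := Qg a aN.
  by rewrite scalerA mulfV // scale1r in Qe; rewrite aE bE.
- have [aN [aE bE]] := adj a b ab; have [_ Ql _] := Qg a aN.
  by rewrite aE bE.
- have [aN [aE bE]] := adj a b ab; have [_ _ Qr] := Qg a aN.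
  by rewrite aE bE.
have [mg mh] := (gen_motzkin gg, gen_motzkin gh).
have := QM _ _ Qgg Qh; rewrite mulbE // => /(QZ (D ^- kappa g h)).
by rewrite scalerA mulVf ?expf_neq0 // scale1r.
Qed.

End Generation.

#[local] Opaque gq ge gl gr.

Section InnerProduct.
Variables (R : realType) (H : completeNormedModType R[i]) (dot : {dot H for Num.conj}).
Hypothesis hnorm : forall u : H, `|u| ^+ 2 = dot u u.
Implicit Types (u v w : H).

Lemma dotBl u v w : dot (u - v) w = dot u w - dot v w.
Proof. exact: linearBl. Qed.

Lemma dotDl u v w : dot (u + v) w = dot u w + dot v w.
Proof. exact: linearDl. Qed.

Lemma dotZl a u w : dot (a *: u) w = a * dot u w.
Proof. exact: linearZl_LR. Qed.

Lemma dotC u v : dot u v = Num.conj (dot v u).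
Proof. by rewrite hermC expr0 mul1r. Qed.

Lemma dotBr u v w : dot w (u - v) = dot w u - dot w v.
Proof. exact: linearBr. Qed.

Lemma dotDr u v w : dot w (u + v) = dot w u + dot w v.
Proof. exact: linearDr. Qed.

Lemma dotZr a u w : dot w (a *: u) = Num.conj a * dot w u.
Proof. exact: linearZr_LR. Qed.

Lemma pythagoras u v : dot u v = 0 -> `|u + v| ^+ 2 = `|u| ^+ 2 + `|v| ^+ 2.
Proof. by move=> uv; rewrite !hnorm dotDl !dotDr uv [dot v u]dotC uv rmorph0 addr0 add0r. Qed.

Lemma cauchy_schwarz u v : `|dot u v| <= `|u| * `|v|.
Proof.
have [->|v0] := eqVneq v 0.
  by rewrite [dot _ _]linear0r normr0 mulr_ge0.
have n0 : 0 < `|v| by rewrite normr_gt0.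
have vv0 : dot v v != 0 by rewrite -hnorm expf_neq0 // lt0r_neq0.
pose a := dot u v / dot v v.
have orth : dot (u - a *: v) (a *: v) = 0.
  by rewrite dotZr dotBl dotZl /a divfK // subrr mulr0.
rewrite -(@ler_pXn2r _ 2) // ?nnegrE ?mulr_ge0 // exprMn -ler_pdivrMr ?exprn_gt0 //.
have := pythagoras orth; rewrite subrK => ->.
rewrite normrZ /a normf_div !exprMn exprVn -hnorm (ger0_norm (exprn_ge0 2 (normr_ge0 v))).
have -> : `|dot u v| ^+ 2 / (`|v| ^+ 2) ^+ 2 * `|v| ^+ 2 = `|dot u v| ^+ 2 / `|v| ^+ 2.
  by field; apply: lt0r_neq0.
by rewrite lerDr exprn_ge0.
Qed.

Lemma op_bound (f : H -> H) : bounded_op f ->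
  exists2 M : R[i], 0 <= M & forall u, `|f u| <= M * `|u|.
Proof.
case=> fl fc; pose g : {linear H -> H} := HB.pack f (GRing.isLinear.Build _ _ _ _ f fl).
have /linear_boundedP := (linear_bounded_continuous g).2 fc.
by move=> /pinfty_ex_gt0 [M M0 fM]; exists M => //; apply: ltW.
Qed.

End InnerProduct.

(** * Left and right multiplications on the completion *)

Section GNS.
Variables (R : realType) (D : R) (H : completeNormedModType R[i]) (dot : {dot H for Num.conj}).
Variables (Lam : forall m, malg R m -> H) (rho : forall m, malg R m -> H -> H).
Hypothesis D0 : 0 < D.
Hypothesis hnorm : forall u : H, `|u| ^+ 2 = dot u u.
Hypothesis gns : is_GNS D dot Lam rho.

Local Notation motz := (motz D%:C).
Local Notation up x := (mincl x : motz _).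
Implicit Types (u v w : H).

Lemma D_real : Num.conj D%:C = D%:C.
Proof. by rewrite conj_Creal // ger0_real // lecR ltW. Qed.

Lemma lamP N a (x y : motz N) : Lam (a *: x + y) = a *: Lam x + Lam y.
Proof. exact: (GNS_lam_linear gns). Qed.

Lemma lam0 N : Lam (0 : motz N) = 0.
Proof. by have := lamP (-1) (0 : motz N) 0; rewrite scaler0 addr0 scaleN1r addNr. Qed.

Lemma lamB N (x y : motz N) : Lam (x - y) = Lam x - Lam y.
Proof. by have := lamP (-1) y x; rewrite !scaleN1r addrC => ->; rewrite addrC. Qed.

Lemma lam_up N (x : motz N) : Lam (up x) = Lam x.
Proof. exact: (GNS_lam_incl gns). Qed.

Lemma rho_up N (x : motz N) : rho (up x) = rho x.
Proof. exact: (GNS_rho_incl gns). Qed.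

Lemma lam_dot N (x y : motz N) : dot (Lam x) (Lam y) = tr (star y * x).
Proof. by rewrite (GNS_lam_dot gns) mtrE mstarE mmulE. Qed.

Lemma rho_lam N (x y : motz N) : rho x (Lam y) = Lam (x * y).
Proof. by rewrite (GNS_rho_lam gns) mmulE. Qed.

Lemma lam_norm N (x : motz N) : `|Lam x| ^+ 2 = tr (star x * x).
Proof. by rewrite hnorm lam_dot. Qed.

Lemma lam1 N : Lam (1 : motz N) = Lam (1 : motz 0).
Proof. by elim: N => // N <-; rewrite -mincl1 lam_up. Qed.

(** Brings elements of different algebras to a common number of strands; mere existence avoids casts
    between algebras whose strand numbers are only provably equal. *)
Lemma lift_ex m N (x : motz m) : (m <= N)%N -> exists y : motz N,
  [/\ supp m y, Lam y = Lam x, Lam (star y) = Lam (star x), rho y = rho x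
    & rho (star y) = rho (star x)].
Proof.
elim: N => [|N IH].
  by rewrite leqn0 => /eqP m0; subst m; exists x; split=> //; apply: supp_full.
rewrite leq_eqVlt => /orP[/eqP mN|mN].
  by subst m; exists x; split=> //; apply: supp_full.
have [y [sy y1 y2 y3 y4]] := IH mN; exists (up y).
by rewrite -mincl_star !lam_up !rho_up; split=> //; apply: supp_mincl.
Qed.

Lemma strip_ex m N (y : motz N) : (m <= N)%N -> supp m y ->
  exists x : motz m, Lam x = Lam y.
Proof.
elim: N y => [|N IH] y.
  by rewrite leqn0 => /eqP m0 _; subst m; exists y.
rewrite leq_eqVlt => /orP[/eqP mN|mN]; first by subst m => _; exists y.
rewrite ltnS in mN; move=> /(strip mN)[y' sy' ->]; rewrite lam_up; exact: IH.
Qed.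

Lemma rho_e N' i : (i < N')%N ->
  rho (mot_e D i.+1) = rho ((D^-1)%:C *: ge D%:C N' i : motz N'.+1).
Proof.
elim: N' => // N' IH; rewrite ltnS leq_eqVlt => /orP[/eqP <-|iN]; first by rewrite mot_eE.
by rewrite IH // -rho_up minclZ mincl_ge.
Qed.

Lemma rho_l N' i : (i < N')%N -> rho (mot_l R i.+1) = rho (gl D%:C N' i).
Proof.
elim: N' => // N' IH; rewrite ltnS leq_eqVlt => /orP[/eqP <-|iN]; first by rewrite (mot_lE D).
by rewrite IH // -rho_up mincl_gl.
Qed.

Lemma rho_r N' i : (i < N')%N -> rho (mot_r R i.+1) = rho (gr D%:C N' i).
Proof.
elim: N' => // N' IH; rewrite ltnS leq_eqVlt => /orP[/eqP <-|iN]; first by rewrite (mot_rE D).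
by rewrite IH // -rho_up mincl_gr.
Qed.

Lemma lam_dense u (e : R[i]) : 0 < e -> exists N (x : motz N), `|u - Lam x| < e.
Proof.
move=> e0; have : closure (\bigcup_k range (@Lam k)) u by rewrite (GNS_lam_dense gns).
move=> /(_ (ball u e) (nbhsx_ballx _ _ e0))[_ [[N _ [x _ <-]]]].
by rewrite -ball_normE /= => ux; exists N, x.
Qed.

Lemma eq_ops (f g : H -> H) : bounded_op f -> bounded_op g ->
  (forall N (x : motz N), f (Lam x) = g (Lam x)) -> f = g.
Proof.
move=> bf bg fg; apply/funext => u; apply/eqP; rewrite -subr_eq0 -normr_le0.
have [M M0 fM] := op_bound bf; have [M' M'0 gM] := op_bound bg.
apply: (@real_le_eps _ (M + M')); rewrite ?addr_ge0 // => e e0; rewrite add0r.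
have [N [x ux]] := lam_dense u e0.
have opB h : bounded_op h -> h (u - Lam x) = h u - h (Lam x).
  by case=> hl _; have := hl (-1) (Lam x) u; rewrite !scaleN1r !(addrC (- _)).
have -> : f u - g u = f (u - Lam x) - g (u - Lam x).
  by rewrite !opB // fg opprB addrA subrK.
apply: le_trans (ler_normB _ _) _; rewrite mulrDl; apply: lerD.
  by apply: le_trans (fM _) _; apply: ler_wpM2l => //; apply: ltW.
by apply: le_trans (gM _) _; apply: ler_wpM2l => //; apply: ltW.
Qed.

Lemma eq_functionals (f g : H -> R[i]) (M : R[i]) : 0 <= M ->
  (forall u v, f (u - v) = f u - f v) -> (forall u v, g (u - v) = g u - g v) ->
  (forall u, `|f u| <= M * `|u|) -> (forall u, `|g u| <= M * `|u|) ->
  (forall N (x : motz N), f (Lam x) = g (Lam x)) -> f =1 g.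
Proof.
move=> M0 fB gB fM gM fg u; apply/eqP; rewrite -subr_eq0 -normr_le0.
apply: (@real_le_eps _ (M + M)); rewrite ?addr_ge0 // => e e0; rewrite add0r.
have [N [x ux]] := lam_dense u e0.
have -> : f u - g u = f (u - Lam x) - g (u - Lam x).
  by rewrite fB gB fg opprB addrA subrK.
apply: le_trans (ler_normB _ _) _; rewrite mulrDl; apply: lerD.
  by apply: le_trans (fM _) _; apply: ler_wpM2l => //; apply: ltW.
by apply: le_trans (gM _) _; apply: ler_wpM2l => //; apply: ltW.
Qed.

Lemma adj_functionals (h : H -> H) v w : bounded_op h ->
  (forall N (x : motz N), dot (h (Lam x)) v = dot (Lam x) w) ->
  forall u, dot (h u) v = dot u w.
Proof.
move=> bh E; have [M M0 hM] := op_bound bh.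
have hB u u' : h (u - u') = h u - h u'.
  by case: bh => hl _; have := hl (-1) u' u; rewrite !scaleN1r !(addrC (- _)).
apply: (@eq_functionals _ _ (M * `|v| + `|w|)) => //.
- by rewrite addr_ge0 ?mulr_ge0.
- by move=> u u'; rewrite hB dotBl.
- by move=> u u'; rewrite dotBl.
- move=> u; apply: le_trans (cauchy_schwarz hnorm _ _) _.
  rewrite mulrDl -[X in X <= _]addr0; apply: lerD; last by rewrite mulr_ge0.
  by rewrite mulrAC; apply: ler_wpM2r.
- move=> u; apply: le_trans (cauchy_schwarz hnorm _ _) _.
  by rewrite mulrC; apply: ler_wpM2r => //; rewrite lerDr mulr_ge0.
Qed.

Lemma dot_lam_eq0 u : (forall N (x : motz N), dot (Lam x) u = 0) -> u = 0.
Proof.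
move=> E; apply/eqP; rewrite -normr_eq0 -sqrf_eq0 hnorm; apply/eqP.
have b1 : bounded_op (@idfun H) by split=> // x; apply: cvg_id.
rewrite (adj_functionals b1 (w := 0) _ u) ?[dot _ 0]linear0r //.
by move=> N x; rewrite E [dot _ 0]linear0r.
Qed.

Lemma lam_starN N (x : motz N) : `|Lam (star x)| = `|Lam x|.
Proof.
apply: (@pexpIrn _ 2); rewrite ?nnegrE // !lam_norm.
by rewrite starK trC.
Qed.

Lemma lam_upM N (x y : motz N) : Lam (up x * up y) = Lam (x * y).
Proof. by rewrite -!rho_lam rho_up lam_up. Qed.

Lemma rho_lift m d (x : motz m) : rho (lift d x) = rho x.
Proof. by elim: d => //= d <-; rewrite rho_up. Qed.

Lemma lift_star m d (x : motz m) : lift d (star x) = star (lift d x).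
Proof. by elim: d => //= d ->; rewrite mincl_star. Qed.

Lemma rho_bounded N (x : motz N) : bounded_op (rho x).
Proof. exact: (GNS_rho_bounded gns). Qed.

(** The vectors [Lam x] with [x] on at least [m] strands are dense, so [phi] is determined; writing
    the number of strands as [d + m] allows [c] to be lifted without casts. *)
Definition right_mul m (c : motz m) (phi : H -> H) : Prop :=
  bounded_op phi /\ forall d (x : motz (d + m)), phi (Lam x) = Lam (x * lift d c).

Lemma right_mul_ex m (c : motz m) : exists phi, right_mul c phi.
Proof.
pose P u v := exists d (x : motz (d + m)), u = Lam x /\ v = Lam (x * lift d c).
have raise d e (x : motz (d + m)) : (d <= e)%N -> exists y : motz (e + m),
    Lam y = Lam x /\ Lam (y * lift e c) = Lam (x * lift d c).
  elim: e => [|e IH].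
    by rewrite leqn0 => /eqP d0; subst d; exists x.
  rewrite leq_eqVlt => /orP[/eqP de|de]; first by subst d; exists x.
  by have [y [y1 y2]] := IH de; exists (up y); rewrite /= lam_upM lam_up.
have [M M0 bM] := op_bound (rho_bounded (star c)).
have [phi [bphi phiP]] : exists phi : H -> H,
    (linear phi /\ continuous phi) /\ forall u w, P u w -> phi u = w.
  apply: (@dense_extension _ H P M) => //.
  - move=> u e e0; have [N [x ux]] := lam_dense u e0.
    have [y [_ y1 _ _ _]] := lift_ex x (leq_addr m N).
    by exists (Lam y), (Lam (y * lift N c)); split; [exists N, y | rewrite y1].
  - move=> a _ _ _ _ [d [x [-> ->]]] [d' [x' [-> ->]]].
    have [y [<- <-]] := raise _ (maxn d d') x (leq_maxl _ _).
    have [y' [<- <-]] := raise _ (maxn d d') x' (leq_maxr _ _).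
    exists (maxn d d'), (a *: y + y').
    by rewrite mulrDl -scalerAl !lamP.
  - move=> _ _ [d [x [-> ->]]].
    (* [x * c] is the adjoint of [star c * star x], and the star preserves the norm; so a bound for
       left multiplication by [star c] serves for right multiplication by [c]. *)
    rewrite -lam_starN starM; last exact: D_real.
    rewrite -rho_lam -lift_star rho_lift -[X in _ <= _ * X]lam_starN.
    exact: bM.
by exists phi; split=> // d x; apply: phiP; exists d, x.
Qed.

Definition comm_right (f : H -> H) : Prop :=
  forall m (c : motz m) phi, right_mul c phi -> f \o phi = phi \o f.

Lemma bounded_comp (f g : H -> H) : bounded_op f -> bounded_op g -> bounded_op (f \o g).
Proof.
case=> fl fc [gl gc]; split; first by move=> a x y /=; rewrite gl fl.
by move=> x; apply: continuous_comp; [apply: gc | apply: fc].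
Qed.

Lemma rho_comm_right N (y : motz N) : comm_right (rho y).
Proof.
move=> m c phi [bphi phiE]; have br := rho_bounded y.
apply: eq_ops; [exact: bounded_comp | exact: bounded_comp | ].
move=> N' x /=; have [y' [_ _ _ <- _]] := lift_ex y (leq_trans (leq_addr N' N) (leq_addr m _)).
have [x' [_ <- _ _ _]] := lift_ex x (leq_trans (leq_addl N N') (leq_addr m _)).
by rewrite phiE !rho_lam phiE mulrA.
Qed.

Lemma comp_comm_right f g : comm_right f -> comm_right g -> comm_right (f \o g).
Proof.
move=> cf cg m c phi rphi.
by rewrite -compA (cg _ _ _ rphi) compA (cf _ _ _ rphi).
Qed.

(* The cyclic vector of the right multiplications is separating for their commutant. *)
Lemma comm_right_inj f g : bounded_op f -> bounded_op g -> comm_right f -> comm_right g ->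
  f (Lam (1 : motz 0)) = g (Lam (1 : motz 0)) -> f = g.
Proof.
move=> bf bg cf cg fg; apply: eq_ops => // N x.
have [phi rphi] := right_mul_ex x; have [_ /(_ 0%N 1)] := rphi.
rewrite mul1r /= => <-.
have := congr1 (@^~ (Lam (1 : motz N))) (cf _ _ _ rphi) => /= ->.
have := congr1 (@^~ (Lam (1 : motz N))) (cg _ _ _ rphi) => /= ->.
by rewrite lam1 fg.
Qed.

(** The record specifies [rho] only on vectors from the same algebra. Both sides commute with right
    multiplications, so comparing them at the cyclic vector is enough. *)
Lemma rhoM N (x y : motz N) : rho (x * y) = rho x \o rho y.
Proof.
apply: comm_right_inj; first exact: rho_bounded.
- by apply: bounded_comp; apply: rho_bounded.
- exact: rho_comm_right.
- by apply: comp_comm_right; apply: rho_comm_right.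
rewrite -(lam1 N) -[(rho x \o rho y) _]/(rho x (rho y _)) !rho_lam.
by rewrite -(mulrA x y 1).
Qed.

Lemma rho_dot N (x : motz N) N' (y : motz N') u :
  dot (rho x u) (Lam y) = dot u (rho (star x) (Lam y)).
Proof.
apply: adj_functionals; first exact: rho_bounded.
move=> N'' z.
have le1 : (N <= N + (N' + N''))%N by apply: leq_addr.
have le2 : (N' <= N + (N' + N''))%N by lia.
have le3 : (N'' <= N + (N' + N''))%N by lia.
have [x' [_ _ _ <- <-]] := lift_ex x le1.
have [y' [_ <- _ _ _]] := lift_ex y le2.
have [z' [_ <- _ _ _]] := lift_ex z le3.
rewrite !rho_lam !lam_dot starM; last exact: D_real.
by rewrite starK mulrA.
Qed.

Lemma rho_adj N (x : motz N) g : bounded_op g ->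
  (forall u v, dot (rho x u) v = dot u (g v)) -> g = rho (star x).
Proof.
move=> bg adj; apply: eq_ops => //; first exact: rho_bounded.
move=> N' z; apply/eqP; rewrite -subr_eq0; apply/eqP; apply: dot_lam_eq0 => N'' y.
by rewrite dotBr -adj rho_dot subrr.
Qed.

Lemma lam_liftM m d (x y : motz m) : Lam (lift d x * lift d y) = Lam (x * y).
Proof. by elim: d => //= d <-; rewrite lam_upM. Qed.

Lemma lam_lift m d (x : motz m) : Lam (lift d x) = Lam x.
Proof. by elim: d => //= d <-; rewrite lam_up. Qed.

Lemma right_mul_dot N (x y : motz N) phi u : right_mul x phi ->
  dot (phi u) (Lam y) = dot u (Lam (y * star x)).
Proof.
case=> bphi phiE; apply: adj_functionals => // N' z.
have [z' [_ <- _ _ _]] := lift_ex z (leq_addr N N').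
rewrite phiE -(lam_lift N' y) -(lam_liftM N' y (star x)) !lam_dot starM; last exact: D_real.
rewrite lift_star starK; move: (lift N' x) (star (lift N' y)) => c w.
by rewrite mulrA [LHS]trC mulrA.
Qed.

Lemma rhoP N a (x y : motz N) : rho (a *: x + y) = fun u => a *: rho x u + rho y u.
Proof.
have [[xl xc] [yl yc]] := (rho_bounded x, rho_bounded y).
apply: comm_right_inj; first exact: rho_bounded.
- split; last by move=> u; apply: cvgD; [apply: cvgZr; apply: xc | apply: yc].
  by move=> b u v; rewrite xl yl !scalerDr !scalerA [a * b]mulrC addrACA.
- exact: rho_comm_right.
- move=> m c phi rphi; apply/funext => u /=.
  have := congr1 (@^~ u) (rho_comm_right x rphi) => /= ->.
  have := congr1 (@^~ u) (rho_comm_right y rphi) => /= ->.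
  by case: rphi => -[philin _] _; rewrite philin.
by rewrite -(lam1 N) !rho_lam mulrDl -scalerAl lamP.
Qed.

(** Gram-Schmidt along the list of diagrams supported on the first [m] strands; [inspan] is the
    linear span, as the intersection of the subspaces containing the list. *)
Lemma proj_ex N m u : exists2 a : motz N, supp m a &
  forall y : motz N, supp m y -> dot (u - Lam a) (Lam y) = 0.
Proof.
pose inspan (s : seq (motz N)) a := forall Q : motz N -> Prop, Q 0 ->
  (forall b x y, Q x -> Q y -> Q (b *: x + y)) -> (forall d, d \in s -> Q d) -> Q a.
have proj s : forall u, exists2 a, inspan s a & forall y, inspan s y -> dot (u - Lam a) (Lam y) = 0.
  elim: s => [|z s IH] {}u.
    exists 0 => [Q Q0 //|y sy]; apply: (sy (fun y => dot (u - Lam 0) (Lam y) = 0)) => //.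
    - by rewrite lam0 [dot _ 0]linear0r.
    - by move=> b x y' ex ey; rewrite lamP dotDr dotZr ex ey mulr0 addr0.
  have [a sa oa] := IH u; have [z' sz oz] := IH (Lam z).
  have sub y : inspan s y -> inspan (z :: s) y.
    by move=> sy Q Q0 QP Qd; apply: sy => // d ds; apply: Qd; rewrite inE ds orbT.
  (* [w] may vanish although the diagrams are independent, the trace being only semidefinite; [t] is
     then 0 by the convention on division by zero. *)
  pose w := Lam z - Lam z'; pose t := dot (u - Lam a) w / dot w w.
  have tw : dot (u - Lam a - t *: w) w = 0.
    rewrite dotBl dotZl /t; have [->|w0] := eqVneq w 0; first by rewrite ![dot _ 0]linear0r mulr0 subrr.
    by rewrite divfK ?subrr // -hnorm expf_neq0 // normr_eq0.
  exists (t *: (z - z') + a).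
    move=> Q Q0 QP Qd; apply: (QP) (sub _ sa Q Q0 QP Qd).
    rewrite addrC -scaleN1r; apply: (QP) (sub _ sz Q Q0 QP Qd) _.
    by apply: Qd; rewrite inE eqxx.
  rewrite lamP lamB -/w.
  have -> : u - (t *: w + Lam a) = u - Lam a - t *: w by rewrite opprD addrA addrAC.
  have os y : inspan s y -> dot (u - Lam a - t *: w) (Lam y) = 0.
    by move=> sy; rewrite dotBl dotZl oa // oz // mulr0 subrr.
  move=> y sy; apply: (sy (fun y => dot (u - Lam a - t *: w) (Lam y) = 0)).
  - by rewrite lam0 [dot _ 0]linear0r.
  - by move=> b x y' ex ey; rewrite lamP dotDr dotZr ex ey mulr0 addr0.
  move=> d; rewrite inE => /orP[/eqP ->|ds].
    by rewrite -[Lam z](subrK (Lam z')) dotDr tw os ?addr0.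
  by apply: os => Q _ _; apply.
pose s := [seq bas D%:C (val d) | d : motzkin N <- enum {: motzkin N} &
  [forall i : 'I_N, (m <= i)%N ==> vertical (val d) i]].
have sd d : d \in s -> supp m d.
  case/mapP=> f; rewrite mem_filter => /andP[/forallP vf _] ->.
  apply: supp_bas; first exact: motzkin_val.
  by move=> i; apply/implyP/vf.
have [a sa oa] := proj s u; exists a.
  apply: (sa (supp m)) => //; first exact: supp0.
  by move=> b x y sx sy; apply: suppD => //; apply: suppZ.
move=> y sy; apply: oa => Q Q0 QP Qs; elim/supp_ind: y / sy => //.
- by move=> x y qx qy; rewrite -[x]scale1r; apply: QP.
- by move=> b x qx; rewrite -[b *: x]addr0; apply: QP.
move=> f mf vf; apply: Qs; apply/mapP; exists (Sub f mf); last by rewrite SubK.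
rewrite mem_filter mem_enum andbT; apply/forallP => i; apply/implyP => mi.
by rewrite SubK; apply: vf.
Qed.

Local Notation Omega := (Lam (1 : motz 0)).

Let Dc0 : D%:C != 0.
Proof. by apply: lt0r_neq0; rewrite ltcR. Qed.

Lemma nrm_lam N (x : motz N) : tr (star x * x) = `|Lam x| ^+ 2.
Proof. by rewrite lam_norm. Qed.

Lemma tr_star_ge0 N (x : motz N) : 0 <= tr (star x * x).
Proof. by rewrite nrm_lam exprn_ge0. Qed.

Lemma tr_star_eq0 N (x : motz N) : tr (star x * x) = 0 -> forall w : motz N, tr (w * x) = 0.
Proof.
rewrite nrm_lam => /eqP; rewrite sqrf_eq0 normr_eq0 => /eqP x0 w.
by rewrite -[w]starK -lam_dot x0 [dot 0 _]linear0l.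
Qed.

Lemma proj_dist N m u (a y : motz N) :
  (forall y : motz N, supp m y -> dot (u - Lam a) (Lam y) = 0) -> supp m a -> supp m y ->
  `|u - Lam y| ^+ 2 = `|u - Lam a| ^+ 2 + `|Lam (y - a)| ^+ 2.
Proof.
move=> oa sa sy; have say : supp m (a - y) by apply: suppD => //; apply: suppN.
rewrite -[Lam (y - a)]opprK normrN lamB opprB -lamB.
rewrite -(pythagoras hnorm); last exact: oa.
by rewrite lamB addrA subrK.
Qed.

Lemma lam_dense_sq u (e : R[i]) : 0 < e -> exists N (x : motz N), `|u - Lam x| ^+ 2 <= e.
Proof.
move=> e0; have e1 : 0 < 1 + e by rewrite addr_gt0.
(* [e / (1 + e)] is at most 1 and at most [e], so its square is at most [e]. *)
have [N [x ux]] := lam_dense u (divr_gt0 e0 e1); exists N, x.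
have e'0 : 0 <= e / (1 + e) by apply/ltW/divr_gt0.
have e'1 : e / (1 + e) <= 1 by rewrite ler_pdivrMr // mul1r lerDr.
apply: le_trans (_ : (e / (1 + e)) ^+ 2 <= e).
  by rewrite ler_pXn2r ?nnegrE // ltW.
apply: le_trans (_ : e / (1 + e) <= e).
  by rewrite expr2 -[X in _ <= X]mulr1; apply: ler_wpM2l.
by rewrite ler_pdivrMr // mulrDr mulr1 lerDl mulr_ge0 // ltW.
Qed.

Section Vector.
Variables (T : H -> H).
Hypotheses (bT : bounded_op T) (cT : comm_right T).
Local Notation xi := (T Omega).

(** [T] commutes with left and right multiplication by [d], so these agree on [xi]. Both, and their
    adjoints, preserve the algebra on [m] strands, so they also agree on the projection of [xi]. *)
Lemma proj_comm N m (a d : motz N) : supp m d -> T \o rho d = rho d \o T -> supp m a ->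
  (forall y : motz N, supp m y -> dot (xi - Lam a) (Lam y) = 0) -> Lam (d * a) = Lam (a * d).
Proof.
move=> sd Td sa oa; have [phi rphi] := right_mul_ex d.
have phi_xi : phi xi = rho d xi.
  have := congr1 (@^~ Omega) (cT rphi) => /= <-.
  have := congr1 (@^~ Omega) Td => /= <-.
  congr (T _); case: rphi => _ /(_ 0%N 1) /=.
  by rewrite -!(lam1 N) rho_lam mulr1 mul1r.
have sda : supp m (d * a - a * d) by apply: suppD; [|apply: suppN]; apply: suppM.
apply/eqP; rewrite -subr_eq0 -lamB -normr_eq0 -sqrf_eq0 hnorm; apply/eqP.
have main (y : motz N) : supp m y -> dot (Lam (d * a)) (Lam y) = dot (Lam (a * d)) (Lam y).
  move=> sy.
  have E (z : motz N) : supp m z -> dot (Lam a) (Lam z) = dot xi (Lam z).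
    by move=> sz; have := oa z sz; rewrite dotBl => /subr0_eq ->.
  have -> : dot (Lam (d * a)) (Lam y) = dot (Lam a) (Lam (star d * y)).
    rewrite !lam_dot starM ?starK ?mulrA //; exact: D_real.
  have -> : dot (Lam (a * d)) (Lam y) = dot (Lam a) (Lam (y * star d)).
    rewrite !lam_dot starM ?starK; last exact: D_real.
    by rewrite mulrA [LHS]trC mulrA.
  rewrite !E; last 2 first.
  - by apply: suppM => //; apply: supp_star.
  - by apply: suppM => //; apply: supp_star.
  rewrite -(right_mul_dot _ _ rphi) phi_xi rho_dot.
  by rewrite rho_lam.
by rewrite {1}(lamB) dotBl main // subrr.
Qed.

Lemma proj_cm N m (a d : motz N) : supp m d ->
  T \o rho d = rho d \o T -> T \o rho (star d) = rho (star d) \o T -> supp m a ->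
  (forall y : motz N, supp m y -> dot (xi - Lam a) (Lam y) = 0) ->
  (forall w : motz N, tr (w * (d * a)) = tr (w * (a * d))) /\
  (forall w : motz N, tr (w * (star d * a)) = tr (w * (a * star d))).
Proof.
move=> sd Td Tsd sa oa.
have E (x y w : motz N) : Lam x = Lam y -> tr (w * x) = tr (w * y).
  have trE z : tr (w * z) = dot (Lam z) (Lam (star w)) by rewrite lam_dot starK.
  by move=> xy; rewrite [LHS]trE xy -trE.
split=> w; apply: E; apply: proj_comm sa oa => //.
exact: supp_star.
Qed.

Variables (n K : nat) (c : R[i]).
Hypotheses (n0 : (0 < n)%N) (g_pos : forall i, (0 < i < n)%N -> 0 < jw_ratio D%:C i).
Hypothesis gn0 : jw_ratio D%:C n = 0.
Hypothesis T_tail : forall i N', (K <= i < N')%N ->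
  [/\ T \o rho ((D^-1)%:C *: ge D%:C N' i) = rho ((D^-1)%:C *: ge D%:C N' i) \o T,
      T \o rho (gl D%:C N' i) = rho (gl D%:C N' i) \o T
    & T \o rho (gr D%:C N' i) = rho (gr D%:C N' i) \o T].

(* [tail_approx] is applied to the projections of [xi] on the algebras on
   K + j, ..., K + j + n strands; these commute with the tail up to null
   vectors since they are orthogonal projections of [xi], which commutes. *)
Lemma tail_approx_lam (e : R[i]) : 2 * D%:C <= c ->
  (forall i, (0 < i < n)%N -> 2 * D%:C * jw_ratio D%:C i <= c) -> 0 < e ->
  exists b : motz K, `|xi - Lam b| ^+ 2 <= (2 + 2 * (n%:R * Bconst c n)) * e.
Proof.
move=> c2D cg e0; have [N0 [x0 x0e]] := lam_dense_sq xi e0.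
(* [j] is at least 2 and K + j strands contain the approximation [x0]; [N'.+1] leaves one strand
   beyond those of the last vector. *)
pose j := N0.+2; pose N' := (K + j + n)%N.
have N0N : (N0 <= N'.+1)%N by rewrite /N' /j; lia.
have [y0 [sy0 y0E _ _ _]] := lift_ex x0 N0N.
have /choice[a aP] : forall i, exists a : motz N'.+1, supp (K + j + i) a /\
    forall y : motz N'.+1, supp (K + j + i) y -> dot (xi - Lam a) (Lam y) = 0.
  by move=> i; have [a sa oa] := @proj_ex N'.+1 (K + j + i) xi; exists a.
have dist i : `|xi - Lam (a i)| ^+ 2 <= e.
  have [sa oa] := aP i; apply: le_trans x0e; rewrite -y0E.
  have sy : supp (K + j + i) y0 by apply: supp_le sy0; rewrite /j; lia.
  by rewrite (proj_dist oa sa sy) lerDl exprn_ge0.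
have Dc_pos : 0 < D%:C by rewrite ltcR.
pose A := motz_alg N' D_real Dc0.
have tail i : (i <= n)%N -> @tail_comm _ _ _ K A (K + j + i) (a i).
  move=> i_n l Kl lj; have [sa oa] := aP i.
  have lN : (l.+1 < N'.+1)%N by rewrite /N'; lia.
  have KlN : (K <= l < N')%N by rewrite /N'; lia.
  have [Te Tl Tr] := T_tail KlN.
  have real_Dinv : Num.conj (D^-1)%:C = (D^-1)%:C by rewrite conj_Creal // ger0_real // lecR invr_ge0 ltW.
  split.
    have -> : ma_e A l = D%:C *: ((D^-1)%:C *: ge D%:C N' l) :> motz N'.+1.
      by rewrite scalerA fmorphV mulfV // scale1r.
    apply: cmZ; apply: proj_cm sa oa => //.
      by apply/suppZ/supp_ge.
    by rewrite starZ real_Dinv star_ge.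
  apply: proj_cm sa oa => //; first exact: supp_gr.
  by rewrite star_gr.
have sqE (x : motz N'.+1) : sqnorm (T := A) x = `|Lam x| ^+ 2 by rewrite -nrm_lam.
have na i : (i < n)%N -> sqnorm (T := A) (a i - a i.+1) <= e.
  move=> i_n; rewrite sqE; apply: le_trans (dist i).
  have [sa _] := aP i; have [sa' oa'] := aP i.+1.
  have sa1 : supp (K + j + i.+1) (a i) by apply: supp_le sa; lia.
  by rewrite (proj_dist oa' sa' sa1) lerDr exprn_ge0.
have jN : (K + j + n < N'.+1)%N by [].
have sa i : (i <= n)%N -> @ma_supp _ _ _ A (K + j + i) (a i) by have [] := aP i.
have [b sb bE] := @tail_approx R[i] D%:C N'.+1 K A n Dc_pos (@tr_star_ge0 _)
    (@tr_star_eq0 _) n0 g_pos gn0 j a c e isT jN c2D cg sa tail na.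
rewrite sqE in bE.
have KN : (K <= N'.+1)%N by rewrite /N'; lia.
have [b' b'E] := strip_ex KN sb.
exists b'; rewrite b'E.
have -> : xi - Lam b = (xi - Lam (a 0%N)) + Lam (a 0%N - b) by rewrite lamB addrA subrK.
have d2 u v : `|u + v| ^+ 2 <= 2 * `|u| ^+ 2 + 2 * `|v| ^+ 2.
  have -> : 2 * `|u| ^+ 2 + 2 * `|v| ^+ 2 = `|u + v| ^+ 2 + `|u - v| ^+ 2.
    by rewrite !hnorm dotBl !dotBr dotDl !dotDr; ring.
  by rewrite lerDl exprn_ge0.
apply: le_trans (d2 _ _) _.
have -> : (2 + 2 * (n%:R * Bconst c n)) * e = 2 * e + 2 * (n%:R * (Bconst c n * e)) by ring.
by apply: lerD; apply: ler_wpM2l.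
Qed.

(** [b] comes from projecting [xi] on the algebra on [K] strands. As [tail_approx_lam] provides
    elements there arbitrarily close to [xi], the distance from [xi] to its projection is zero. *)
Lemma tail_commutant_lam : 2 * D%:C <= c ->
  (forall i, (0 < i < n)%N -> 2 * D%:C * jw_ratio D%:C i <= c) ->
  exists b : motz K, T = rho b.
Proof.
move=> c2D cg; have [b _ ob] := @proj_ex K K xi.
have c0 : 0 <= c by apply: le_trans c2D; rewrite mulr_ge0 // lecR ltW.
exists b; apply: comm_right_inj => //; first exact: rho_bounded.
  exact: rho_comm_right.
rewrite -{2}(lam1 K) rho_lam mulr1; apply/eqP.
rewrite -subr_eq0 -normr_eq0 -sqrf_eq0; apply/eqP/le_anti; rewrite exprn_ge0 // andbT.
apply: (@real_le_eps _ (2 + 2 * (n%:R * Bconst c n))) => //.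
  by rewrite addr_ge0 ?mulr_ge0 // Bconst_ge0.
move=> e e0; rewrite add0r; have [b' b'E] := tail_approx_lam c2D cg e0.
apply: le_trans b'E.
by rewrite (proj_dist ob (@supp_full _ _ _ b) (@supp_full _ _ _ b')) lerDl exprn_ge0.
Qed.

End Vector.

Local Notation gens := (gens D rho).
Local Notation eE i := ((D^-1)%:C *: ge D%:C i.+1 i : motz i.+2).

(** Translation from the indices of [gens], counted from 1, to strands counted from 0. *)
Lemma gensP K T : gens K.+1 T <-> exists2 i, (K <= i)%N &
  [\/ T = rho (eE i), T = rho (gl D%:C i.+1 i) | T = rho (gr D%:C i.+1 i)].
Proof.
split=> [[[//|i] Ki]|[i Ki]].
  by rewrite mot_eE (mot_lE D) (mot_rE D) => TE; exists i.
by rewrite -mot_eE -(mot_lE D) -(mot_rE D) => TE; exists i.+1.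
Qed.

Lemma gens_ex K T : gens K.+1 T -> exists N (x : motz N), T = rho x.
Proof. by case/gensP=> i _ [] ->; eexists; eexists. Qed.

Lemma star_eE i : star (eE i) = eE i.
Proof. by rewrite starZ star_ge // conj_Creal // ger0_real // lecR invr_ge0 ltW. Qed.

(** Adjoints are unique, hence given by the star, which fixes the [e]'s and exchanges the [l]'s and
    [r]'s. *)
Lemma adjoints_gens K : adjoints dot (gens K.+1) `<=` gens K.+1.
Proof.
move=> g [bg [f /gensP[i Ki fE] adj]]; apply/gensP; exists i => //.
case: fE adj => -> /(rho_adj bg) ->.
- by rewrite star_eE; constructor 1.
- by rewrite star_gl //; constructor 3.
- by rewrite star_gr //; constructor 2.
Qed.

Lemma sub_vN_gen (S : set (H -> H)) T : bounded_op T -> S T -> vN_gen dot S T.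
Proof. by move=> bT ST; split=> // f [_ fS]; rewrite fS //; left. Qed.

(** Right multiplications commute with every [rho x], so they lie in the commutant of the
    generators. *)
Lemma vN_comm_right T : vN_gen dot (gens 1) T -> comm_right T.
Proof.
case=> _ TC m c phi rphi; apply: TC; split; first by case: rphi.
move=> g Sg; have {}Sg : gens 1 g by case: Sg => //; apply: adjoints_gens.
have [N [x ->]] := gens_ex Sg.
by rewrite (rho_comm_right x rphi).
Qed.

Lemma rho_comm N (x y : motz N) : x * y = y * x -> rho x \o rho y = rho y \o rho x.
Proof. by move=> xy; rewrite -!rhoM xy. Qed.

Lemma rho_comm_gens K (x : motz K) T : gens K.+1 T -> rho x \o T = T \o rho x.
Proof.
case/gensP=> i Ki TE.
have Ki2 : (K <= i.+2)%N by lia.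
have [y [sy _ _ <- _]] := lift_ex x Ki2.
have {}sy : supp i y by apply: supp_le sy.
case: TE => ->; apply: rho_comm.
- by rewrite -scalerAl -scalerAr comm_ge.
- by rewrite comm_gl.
- by rewrite comm_gr.
Qed.

(** An element on the first [K] strands commutes with the generators further right, so it lies in
    the commutant whose own commutant is the tail algebra. *)
Lemma rho_tail_commutant K (x : motz K) : commutant (vN_gen dot (gens K.+1)) (rho x).
Proof.
have br := rho_bounded x; split=> // g [_ gC]; apply/esym/gC; split=> // T ST.
apply: rho_comm_gens; case: ST => //; exact: adjoints_gens.
Qed.

Lemma rho_vN K (x : motz K) : vN_gen dot (gens 1) (rho x).
Proof.
split=> [|f [[fl fc] fC]]; first exact: rho_bounded.
(* Two additional strands make room for a generator even when [K] is 0, as [motz_gen_ind]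
   requires. *)
have K2 : (K <= K.+2)%N by lia.
have [y [_ _ _ <- _]] := lift_ex x K2.
have fS T : gens 1 T -> forall u, T (f u) = f (T u).
  by move=> ST u; have := congr1 (@^~ u) (fC T (or_introl ST)).
apply/funext; elim/(@motz_gen_ind R[i] D%:C K.+1 Dc0 isT): y => [a y z IHy IHz u|y z IHy IHz u|u|i iK].
- by rewrite rhoP /= fl -[f (rho y u)]IHy -[f (rho z u)]IHz.
- rewrite rhoM -[LHS]/(rho y (rho z (f u))) -[RHS]/(f (rho y (rho z u))).
  by rewrite -[RHS](IHy (rho z u)) /= -[f (rho z u)](IHz u).
- have -> : rho (1 : motz K.+2) = idfun; last by [].
    apply: comm_right_inj.
    + exact: rho_bounded.
    + by split=> // v; apply: cvg_id.
    + exact: rho_comm_right.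
    + by [].
    by rewrite -(lam1 K.+2) rho_lam mulr1.
split=> u.
- rewrite -fmorphV -(rho_e iK); apply: fS.
  by exists i.+1 => //; constructor 1.
- by rewrite -(rho_l iK); apply: fS; exists i.+1 => //; constructor 2.
- by rewrite -(rho_r iK); apply: fS; exists i.+1 => //; constructor 3.
Qed.

End GNS.

Theorem proposition4p10 (R : realType) (n k : nat) (D : R)
  (H : completeNormedModType R[i]) (dot : {dot H for Num.conj})
  (Lam : forall m, malg R m -> H) (rho : forall m, malg R m -> H -> H) :
  (2 <= n)%N ->
  D = 2 * cos (pi / n.+1%:R) + 1 ->
  (1 <= k)%N ->
  (forall u : H, `|u| ^+ 2 = dot u u) ->
  is_GNS D dot Lam rho ->
  let M := vN_gen dot (gens D rho 1) in
  let Mk := vN_gen dot (gens D rho k) in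
  commutant Mk `&` M = range (rho k.-1).
Proof.
move=> n2 DE; case: k => // K _ hnorm gns M Mk; have D0 := loop_gt0 n2 DE.
apply/seteqP; split=> [T [TMk TM]|_ [x _ <-]]; last first.
  by split; [exact: (rho_tail_commutant D0 hnorm gns x) | exact: (rho_vN D0 hnorm gns x)].
have [bT TC] := TMk; have cT := vN_comm_right D0 hnorm gns TM.
have Tg g : gens D rho K.+1 g -> T \o g = g \o T.
  move=> Sg; apply: TC; apply: sub_vN_gen (Sg) => //.
  by have [N [x ->]] := gens_ex Sg; apply: (rho_bounded gns).
pose g := jw_ratio D%:C; have D0' : 0 <= D%:C by rewrite lecR ltW.
have g0 i : (0 < i < n)%N -> 0 < g i by exact: jw_ratio_gt0.
(* A sum of nonnegative terms bounds all the step constants at once, with no maximum in the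
   partially ordered [R[i]]. *)
pose c := 2 * D%:C + \sum_(i < n | (0 < i)%N) 2 * D%:C * g i.
have s0 (P : pred 'I_n) : 0 <= \sum_(i < n | (0 < i)%N && P i) 2 * D%:C * g i.
  apply: sumr_ge0 => i /andP[i0 _]; rewrite !mulr_ge0 // ltW // g0 // i0; exact: ltn_ord.
have [b ->] : exists b : motz D%:C K, T = rho K b; last by exists b.
apply: (@tail_commutant_lam _ _ _ _ _ _ D0 hnorm gns T bT cT n K c) => //.
- by lia.
- exact: (jw_ratio_n n2 DE).
- move=> i N' /andP[Ki iN]; have KiN : (K <= i < N')%N by rewrite Ki.
  rewrite -(rho_e gns iN) -(rho_l gns iN) -(rho_r gns iN).
  by split; apply: Tg; exists i.+1 => //; [constructor 1 | constructor 2 | constructor 3].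
- by rewrite /c lerDl; under eq_bigl do rewrite -[(0 < _)%N]andbT; apply: s0.
move=> i /andP[i0 iN]; rewrite /c (bigD1 (Ordinal iN)) //= addrCA lerDl.
by rewrite addr_ge0 ?mulr_ge0 ?s0.
Qed.
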